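(* Let $\mathcal{Z},\mathcal{X}$ be Polish spaces and assume: (1) $\mu_n=\frac1n\sum_{i=1}^n\delta_{z_{n,i}}\to\mu$ in $\mathcal{P}(\mathcal{Z})$; (2) for each $k\ge1$, $(P^k_z;z\in\mathcal{Z})$ is a Feller system on $\mathcal{X}$; (3) for each $z\in\mathcal{Z}$, $(P^k_z)_{k\ge1}$ obeys the $k$-LDP in $\mathcal{X}$ with a good rate function $J_z$. For $k,n\ge1$ let $X^k_{n,1},\dots,X^k_{n,n}$ be independent with $X^k_{n,i}\sim P^k_{z_{n,i}}$ and $K^k_n=\frac1n\sum_{i=1}^n\delta_{(z_{n,i},X^k_{n,i})}$. Then $\{K^k_n\}_{k,n\ge1}$ obeys the $(k,n)$-LDP in $\mathcal{P}(\mathcal{Z}\times\mathcal{X})$ with the affine good rate function $$i(q)=\begin{cases}\int_{\mathcal{Z}\times\mathcal{X}}J_z(x)\,q(dzdx)&\text{if }q_{\mathcal{Z}}=\mu,\\+\infty&\text{otherwise,}\end{cases}\qquad q\in\mathcal{P}(\mathcal{Z}\times\mathcal{X}).$$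
   Context: $\mathcal{P}(E)$: Borel probability measures on Polish $E$ with narrow topology. Feller system: $z\mapsto\int f\,dP^k_z$ continuous for all bounded continuous $f$. $k$-LDP with good rate function $J$: compact level sets, $-\inf_{\mathrm{int}A}J\le\liminf\frac1k\log P^k(A)\le\limsup\frac1k\log P^k(A)\le-\inf_{\mathrm{cl}A}J$. $(k,n)$-LDP with rate $I$: for all measurable $B$, $-\inf_{\mathrm{int}B}I\le\liminf_k\liminf_n\frac1{kn}\log\mathbb{P}(K^k_n\in B)\le\limsup_k\limsup_n\frac1{kn}\log\mathbb{P}(K^k_n\in B)\le-\inf_{\mathrm{cl}B}I$. $q_{\mathcal{Z}}$ is the $\mathcal{Z}$-marginal of $q$. *)

(* Defs.v *)
From HB Require Import structures.
From mathcomp Require Import all_boot all_order all_algebra.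
From mathcomp Require Import all_classical all_reals all_analysis.
Set Implicit Arguments. Unset Strict Implicit. Unset Printing Implicit Defensive.
Import Order.TTheory GRing.Theory Num.Theory.
Import numFieldNormedType.Exports.
Local Open Scope classical_set_scope.
Local Open Scope ring_scope.

Definition separable_space (T : topologicalType) : Prop :=
  exists D : set T, countable D /\ closure D = setT.

(* A Polish space: a complete, separable, Hausdorff (i.e. metric, not only
   pseudometric) metric space. *)
Definition polish (R : realType) (T : completePseudoMetricType R) : Prop :=
  hausdorff_space T /\ separable_space T.

(* The product of two pointed topological spaces is a pointed topological
   space (both structures already exist on the product; this just joins them). *)
HB.instance Definition _ (A B : ptopologicalType) := Pointed.on (A * B)%type.

Definition borel (T : ptopologicalType) : Type := g_sigma_algebraType (@open T).

Definition Pmeas (R : realType) (T : ptopologicalType) : Type :=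
  probability (borel T) R.

Section narrow.
Variables (R : realType) (T : ptopologicalType).
Local Notation PT := (Pmeas R T).

Definition bcont (f : T -> R) : Prop :=
  continuous f /\ exists M : R, forall x, `|f x| <= M.

Definition pint (q : PT) (f : T -> R) : \bar R := (\int[q]_x (f x)%:E)%E.

(* Narrow topology on P(T): the initial topology making every
   q |-> \int f dq (f bounded continuous) continuous.  A set is open iff it
   contains a basic neighbourhood of each of its points. *)
Definition narrow_open (U : set PT) : Prop :=
  forall q, U q -> exists (m : nat) (f : 'I_m -> T -> R) (e : R),
    0 < e /\ (forall j, bcont (f j)) /\
    [set q' : PT | forall j, (`| pint q' (f j) - pint q (f j) | < e%:E)%E]
      `<=` U.

Definition narrow_interior (A : set PT) : set PT :=
  [set q | exists V, narrow_open V /\ V q /\ V `<=` A].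

Definition narrow_closure (A : set PT) : set PT :=
  [set q | forall V, narrow_open V -> V q -> V `&` A !=set0].

Definition narrow_closed (A : set PT) : Prop := narrow_closure A `<=` A.

Definition narrow_compact (A : set PT) : Prop :=
  forall (I : Type) (V : I -> set PT), (forall i, narrow_open (V i)) ->
    A `<=` \bigcup_i V i ->
    exists (m : nat) (g : 'I_m -> I), A `<=` \bigcup_j V (g j).

Definition narrow_measurable (B : set PT) : Prop := <<s narrow_open >> B.

Definition narrow_good_rate (I : PT -> \bar R) : Prop :=
  (forall q, (0 <= I q)%E) /\
  forall a : R, narrow_closed [set q | (I q <= a%:E)%E] /\
                narrow_compact [set q | (I q <= a%:E)%E].

End narrow.

Definition good_rate (R : realType) (T : topologicalType) (J : T -> \bar R) : Prop :=
  (forall x, (0 <= J x)%E) /\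
  forall a : R, closed [set x | (J x <= a%:E)%E] /\ compact [set x | (J x <= a%:E)%E].

Definition elog (R : realType) (x : \bar R) : \bar R :=
  match x with
  | EFin r => if 0 < r then (ln r)%:E else -oo%E
  | +oo%E => +oo%E
  | -oo%E => -oo%E
  end.

Definition feller (R : realType) (Z X : ptopologicalType) (P : Z -> Pmeas R X) : Prop :=
  forall f : X -> R, bcont f -> continuous (fun z => fine (pint (P z) f)).

(* (P k)_{k >= 1} satisfies the k-LDP with good rate function J
   (the sequence is indexed so that P k.+1 is P^{k+1}) *)
Definition kLDP (R : realType) (X : ptopologicalType) (P : nat -> Pmeas R X)
    (J : X -> \bar R) : Prop :=
  good_rate J /\
  forall A : set X, measurable (A : set (borel X)) ->
    let a := fun k : nat => ((((k.+1)%:R)^-1)%:E * elog (P k.+1 A))%E in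
    ((- ereal_inf (J @` interior A) <= limn_einf a) /\
     (limn_einf a <= limn_esup a) /\
     (limn_esup a <= - ereal_inf (J @` closure A)))%E.

Definition rate_i (R : realType) (Z X : ptopologicalType) (mu : Pmeas R Z)
    (J : Z -> X -> \bar R) (q : Pmeas R (Z * X)%type) : \bar R :=
  if `[< forall A : set Z, measurable (A : set (borel Z)) ->
          q (fst @^-1` A) = mu A >]
  then (\int[q]_p J p.1 p.2)%E
  else +oo%E.

Definition is_empirical (R : realType) (T : ptopologicalType) (n : nat)
    (pts : 'I_n -> T) (q : Pmeas R T) : Prop :=
  forall A : set T, measurable (A : set (borel T)) ->
    q A = ((n%:R)^-1 * \sum_(i < n) \1_A (pts i))%:E.

Definition mutually_independent (R : realType) (d : measure_display)
    (Om : measurableType d) (Pr : probability Om R) (X : ptopologicalType)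
    (n : nat) (Y : 'I_n -> Om -> X) : Prop :=
  forall A : 'I_n -> set X, (forall i, measurable (A i : set (borel X))) ->
    Pr (\bigcap_i (Y i @^-1` A i)) = (\prod_(i < n) Pr (Y i @^-1` A i))%E.

(* Main.v *)
Require Import Defs.
From HB Require Import structures.
From mathcomp Require Import all_boot all_order all_algebra.
From mathcomp Require Import all_classical all_reals all_analysis.
From mathcomp Require Import measurable_realfun ring lra.
Set Implicit Arguments. Unset Strict Implicit. Unset Printing Implicit Defensive.
Import Order.TTheory GRing.Theory Num.Theory.
Import numFieldNormedType.Exports.
Local Open Scope classical_set_scope.
Local Open Scope ring_scope.

(** Upper bound and goodness.  For bounded continuous [g], [lam g z] is the upper limit of
    [(1/k) log E_{P^k_z} exp (k g)].  The LDP of [P^k_z] makes [J z x] the supremum over [g] of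
    [g x - lam g z], so [i q <= a] says exactly that [q] passes all the linear tests
    [int F dq <= a + int L dmu] obtained from such pairs, and by independence and the Feller property each
    test fails for the empirical measure with probability about [exp (- k n a)].  Along an ultrafilter of
    measures passing the tests there is tightness (goodness of [J z]), hence a limit by Daniell's theorem;
    this gives compactness of the sublevel sets and reduces any closed set to finitely many tests.

    Lower bound.  Given [q] with marginal [mu], cut most of its mass into finitely many disjoint pieces [V l]
    inside rectangles on which the given test functions are almost constant.  The densities of the marginals
    of [q] restricted to [V l] with respect to [mu], made continuous, prescribe which proportion of the
    points [z_{n,i}] near [z] should send [X_{n,i}] into the [l]-th rectangle; a deterministic assignment
    with the right counts exists by a second-moment argument.  The event that all [X_{n,i}] follow the
    assignment has probability at least [exp (- k n (int J dq + e))], the cost of each prescription being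
    capped to keep it bounded: capped indices are too few to matter. *)

(** * Expectations and bounded continuous functions *)

(** No uniformity in [z] is available: the asymptotics of [P k z] may set in arbitrarily late, and
    [J] is not even assumed measurable in [z]. The order of the limits compensates. For fixed [k]
    the Feller property makes the relevant quantities bounded continuous functions of [z], so [n]
    can go to infinity by convergence of the averages over the points. Only then does [k] grow, and
    bounds that hold eventually at each [z] pass through the integral by a reverse Fatou argument;
    this is why costs and log-Laplace transforms are kept bounded. The upper limit [lam g] is
    measurable but not continuous in [z], so tests replace it by continuous functions close to it in
    L1(mu). Test pairs are closed under maxima, so that a sequence of them can increase to [J] and
    monotone convergence exchanges supremum and integral. In the lower bound, a prescribed rectangle
    may have tiny or zero probability. The cap [L] repairs this by Markov's inequality: the total
    cost is at most n (j + e), so at most a fraction (j + e) / L of the indices reach the cap. *)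

Section Expectation.
Variables (R : realType) (T : ptopologicalType).
Implicit Types (q : Pmeas R T) (f g : T -> R).

Definition bmeas f : Prop :=
  measurable_fun setT (f : borel T -> R) /\ exists M : R, forall x, `|f x| <= M.

(** Real-valued, so that estimates become plain arithmetic; by [pintE], [fine] loses nothing on
    [bmeas] functions. *)
Definition Ex q f : R := fine (pint q f).

Lemma bcont_bmeas f : bcont f -> bmeas f.
Proof.
move=> [cf bf]; split=> //.
apply: (measurability _ (RGenOpens.measurableE R)) => //.
move=> _ [_ [a [b ->]] <-]; rewrite setTI.
by apply: sub_sigma_algebra; apply: open_comp => [x _|]; [exact: cf|exact: interval_open].
Qed.

Lemma bmeas_cst (c : R) : bmeas (fun=> c).
Proof. by split; [exact: measurable_cst|exists `|c|]. Qed.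

Lemma bmeasD f g : bmeas f -> bmeas g -> bmeas (fun x => f x + g x).
Proof.
move=> [mf [M fM]] [mg [N gN]]; split; first exact: measurable_funD.
by exists (M + N) => x; rewrite (le_trans (ler_normD _ _))// lerD.
Qed.

Lemma bmeasM f g : bmeas f -> bmeas g -> bmeas (fun x => f x * g x).
Proof.
move=> [mf [M fM]] [mg [N gN]]; split; first exact: measurable_funM.
by exists (M * N) => x; rewrite normrM ler_pM.
Qed.

Lemma bmeasZ (c : R) f : bmeas f -> bmeas (fun x => c * f x).
Proof. by move=> bf; apply: bmeasM => //; exact: bmeas_cst. Qed.

Lemma bmeasN f : bmeas f -> bmeas (fun x => - f x).
Proof.
move=> bf; rewrite (_ : (fun x => - f x) = (fun x => -1 * f x)); first exact: bmeasZ.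
by apply/funext => x; rewrite mulN1r.
Qed.

Lemma bmeasB f g : bmeas f -> bmeas g -> bmeas (fun x => f x - g x).
Proof. by move=> bf bg; apply: bmeasD => //; exact: bmeasN. Qed.

Lemma bmeas_max f g : bmeas f -> bmeas g -> bmeas (fun x => Num.max (f x) (g x)).
Proof.
move=> [mf [M fM]] [mg [N gN]]; split; first exact: measurable_maxr.
exists (Num.max M N) => x; rewrite le_max; case: (leP (f x) (g x)) => _.
  by rewrite gN orbT.
by rewrite fM.
Qed.

Lemma bmeas_min f g : bmeas f -> bmeas g -> bmeas (fun x => Num.min (f x) (g x)).
Proof.
move=> [mf [M fM]] [mg [N gN]]; split; first exact: measurable_minr.
exists (Num.max M N) => x; rewrite le_max; case: (leP (f x) (g x)) => _.
  by rewrite fM.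
by rewrite gN orbT.
Qed.

Lemma bmeas_norm f : bmeas f -> bmeas (fun x => `|f x|).
Proof.
move=> [mf [M fM]]; split; last by exists M => x; rewrite normr_id.
exact: measurableT_comp.
Qed.

Lemma bmeas_indic (A : set T) : measurable (A : set (borel T)) ->
  bmeas (\1_A : T -> R).
Proof.
move=> mA; split; first exact: measurable_indic.
exists 1 => x; rewrite indicE; case: (_ \in _) => /=; by rewrite ?normr1 ?normr0.
Qed.

Lemma bmeas_sum (I : Type) (s : seq I) (F : I -> T -> R) :
  (forall i, bmeas (F i)) -> bmeas (fun x => \sum_(i <- s) F i x).
Proof.
move=> bF; elim: s => [|i s ih].
  rewrite (_ : (fun _ => _) = fun=> 0); first exact: bmeas_cst.
  by apply/funext => x; rewrite big_nil.
rewrite (_ : (fun _ => _) = fun x => F i x + \sum_(j <- s) F j x).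
  exact: bmeasD.
by apply/funext => x; rewrite big_cons.
Qed.

Lemma bmeas_integrable q f : bmeas f -> q.-integrable setT (EFin \o (f : borel T -> R)).
Proof.
move=> [mf [M fM]]; apply: (@le_integrable _ _ _ q setT measurableT _ (cst M%:E)).
- exact/measurable_EFinP.
- by move=> x _ /=; rewrite lee_fin (le_trans (fM x))// ler_norm.
- by apply: finite_measure_integrable_cst; exact: measurableT.
Qed.

Lemma pintE q f : bmeas f -> pint q f = (Ex q f)%:E.
Proof.
move=> bf; rewrite /Ex fineK// /pint.
exact: (integrable_fin_num _ (bmeas_integrable q bf)).
Qed.

Lemma ExE q f : Ex q f = Rintegral q setT (f : borel T -> R).
Proof. by []. Qed.

Lemma Ex_cst q (c : R) : Ex q (fun=> c) = c.
Proof.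
rewrite ExE Rintegral_cst; last exact: measurableT.
rewrite -[RHS]mulr1; congr (_ * _).
exact: (congr1 fine (probability_setT q)).
Qed.

Lemma ExD q f g : bmeas f -> bmeas g -> Ex q (fun x => f x + g x) = Ex q f + Ex q g.
Proof.
move=> bf bg; rewrite !ExE RintegralD//; first exact: (bmeas_integrable q bf).
exact: (bmeas_integrable q bg).
Qed.

Lemma ExZ q (c : R) f : bmeas f -> Ex q (fun x => c * f x) = c * Ex q f.
Proof.
by move=> bf; rewrite !ExE RintegralZl//; exact: (bmeas_integrable q bf).
Qed.

Lemma ExN q f : bmeas f -> Ex q (fun x => - f x) = - Ex q f.
Proof.
move=> bf; rewrite -mulN1r -ExZ//; congr (Ex q _).
by apply/funext => x; rewrite mulN1r.
Qed.

Lemma ExB q f g : bmeas f -> bmeas g -> Ex q (fun x => f x - g x) = Ex q f - Ex q g.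
Proof. by move=> bf bg; rewrite ExD//; [rewrite ExN|exact: bmeasN]. Qed.

Lemma Ex_le q f g : bmeas f -> bmeas g -> (forall x, f x <= g x) -> Ex q f <= Ex q g.
Proof.
move=> bf bg fg; rewrite !ExE le_Rintegral//; first exact: (bmeas_integrable q bf).
exact: (bmeas_integrable q bg).
Qed.

Lemma Ex_ge0 q f : (forall x, 0 <= f x) -> 0 <= Ex q f.
Proof. by move=> f0; rewrite ExE Rintegral_ge0. Qed.

Lemma Ex_sum q (I : Type) (s : seq I) (F : I -> T -> R) : (forall i, bmeas (F i)) ->
  Ex q (fun x => \sum_(i <- s) F i x) = \sum_(i <- s) Ex q (F i).
Proof.
move=> bF; elim: s => [|i s ih].
  rewrite big_nil (_ : (fun _ => _) = fun=> 0); first by rewrite Ex_cst.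
  by apply/funext => x; rewrite big_nil.
rewrite (_ : (fun _ => _) = fun x => F i x + \sum_(j <- s) F j x).
  by rewrite ExD//; [rewrite ih big_cons|exact: bmeas_sum].
by apply/funext => x; rewrite big_cons.
Qed.

Lemma Ex_indic q (A : set T) : measurable (A : set (borel T)) ->
  Ex q (\1_A : T -> R) = fine (q A).
Proof.
move=> mA; congr fine; rewrite /pint integral_indic; last exact: mA.
  by rewrite setIT.
exact: measurableT.
Qed.

Lemma Ex_norm q f : bmeas f -> `|Ex q f| <= Ex q (fun x => `|f x|).
Proof.
move=> bf; have bn := bmeas_norm bf.
rewrite ler_norml -ExN// ; apply/andP; split; apply: Ex_le => //.
- exact: bmeasN.
- by move=> x; rewrite lerNl -normrN ler_norm.
- by move=> x; exact: ler_norm.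
Qed.

Lemma Ex_bnd q f (M : R) : bmeas f -> (forall x, `|f x| <= M) -> `|Ex q f| <= M.
Proof.
move=> bf fM; apply: (le_trans (Ex_norm q bf)); rewrite -[leRHS](Ex_cst q).
by apply: Ex_le => //; [exact: bmeas_norm|exact: bmeas_cst].
Qed.

(** Bounded convergence, dominated by the constant [M]. Measurability of the limit is part of the
    conclusion because [f] is given only as a pointwise limit. *)
Lemma Ex_cvg q (F : nat -> T -> R) f (M : R) : (forall n, bmeas (F n)) ->
  (forall n x, `|F n x| <= M) -> (forall x, (F n x) @[n --> \oo] --> f x) ->
  bmeas f /\ (Ex q (F n)) @[n --> \oo] --> Ex q f.
Proof.
move=> bF FM cF.
have mf : measurable_fun setT (f : borel T -> R).
  apply: (@measurable_fun_cvg _ (borel T) R setT (fun n => F n : borel T -> R)) => //.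
    by move=> n; exact: (bF n).1.
have fM : forall x, `|f x| <= M.
  move=> x; have cn := cvg_norm (cF x).
  by apply: (cvgr_to_le (cn _)); near=> n; exact: FM.
have bf : bmeas f by split=> //; exists M.
split=> //.
have [|||||_ _ h] := @dominated_convergence _ (borel T) R q setT measurableT
  (fun n => EFin \o (F n : borel T -> R)) (EFin \o (f : borel T -> R)) (cst M%:E).
- by move=> n; apply/measurable_EFinP; exact: (bF n).1.
- exact/measurable_EFinP.
- by apply: aeW => x _; apply: cvg_EFin; [exact: nearW|exact: cF].
- by apply: finite_measure_integrable_cst; exact: measurableT.
- by apply: aeW => x n _; rewrite /= lee_fin.
by apply: fine_cvg; rewrite -/(pint q f) pintE// in h.
Unshelve. all: by end_near. Qed.

End Expectation.

Section Bcont.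
Variables (R : realType) (T : ptopologicalType).
Implicit Types (f g : T -> R).

Lemma bcont_cst (c : R) : bcont (fun _ : T => c).
Proof. by split; [move=> x; exact: cvg_cst|exists `|c|]. Qed.

Lemma bcontD f g : bcont f -> bcont g -> bcont (fun x => f x + g x).
Proof.
move=> bf bg; split; last exact: (bmeasD (bcont_bmeas bf) (bcont_bmeas bg)).2.
by move=> x; apply: cvgD; [exact: bf.1|exact: bg.1].
Qed.

Lemma bcontM f g : bcont f -> bcont g -> bcont (fun x => f x * g x).
Proof.
move=> bf bg; split; last exact: (bmeasM (bcont_bmeas bf) (bcont_bmeas bg)).2.
by move=> x; apply: cvgM; [exact: bf.1|exact: bg.1].
Qed.

Lemma bcontZ (c : R) f : bcont f -> bcont (fun x => c * f x).
Proof. by move=> bf; apply: bcontM => //; exact: bcont_cst. Qed.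

Lemma bcontN f : bcont f -> bcont (fun x => - f x).
Proof.
move=> bf; split; last exact: (bmeasN (bcont_bmeas bf)).2.
by move=> x; apply: cvgN; exact: bf.1.
Qed.

Lemma bcontB f g : bcont f -> bcont g -> bcont (fun x => f x - g x).
Proof. by move=> bf bg; apply: bcontD => //; exact: bcontN. Qed.

Lemma bcont_max f g : bcont f -> bcont g -> bcont (fun x => Num.max (f x) (g x)).
Proof.
move=> bf bg; split; last exact: (bmeas_max (bcont_bmeas bf) (bcont_bmeas bg)).2.
by move=> x; apply: (@continuous_max _ _ f g x); [exact: bf.1|exact: bg.1].
Qed.

Lemma bcont_min f g : bcont f -> bcont g -> bcont (fun x => Num.min (f x) (g x)).
Proof.
move=> bf bg; split; last exact: (bmeas_min (bcont_bmeas bf) (bcont_bmeas bg)).2.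
by move=> x; apply: (@continuous_min _ _ f g x); [exact: bf.1|exact: bg.1].
Qed.

Lemma bcont_sum (I : Type) (s : seq I) (F : I -> T -> R) :
  (forall i, bcont (F i)) -> bcont (fun x => \sum_(i <- s) F i x).
Proof.
move=> bF; elim: s => [|i s ih].
  rewrite (_ : (fun _ => _) = fun=> 0); first exact: bcont_cst.
  by apply/funext => x; rewrite big_nil.
rewrite (_ : (fun _ => _) = fun x => F i x + \sum_(j <- s) F j x).
  exact: bcontD.
by apply/funext => x; rewrite big_cons.
Qed.

End Bcont.

Section BcontComp.
Variables (R : realType) (T U : ptopologicalType).

Lemma bcont_comp (phi : T -> U) (f : U -> R) : continuous phi -> bcont f ->
  bcont (fun x => f (phi x)).
Proof.
move=> cphi [cf [M fM]]; split; last by exists M.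
by move=> x; apply: (@continuous_comp _ _ _ phi f); [exact: cphi|exact: cf].
Qed.

Lemma measurable_continuous (phi : T -> U) : continuous phi ->
  measurable_fun setT (phi : borel T -> borel U).
Proof.
move=> cphi; apply: (@measurability _ _ (borel T) (borel U) setT phi (@open U)) => //.
move=> _ [V oV <-]; rewrite setTI.
by apply: sub_sigma_algebra; apply: open_comp => // x _; exact: cphi.
Qed.

Lemma bmeas_comp (phi : T -> U) (f : U -> R) : continuous phi -> bmeas f ->
  bmeas (fun x => f (phi x)).
Proof.
move=> cphi [mf [M fM]]; split; last by exists M.
exact: (measurableT_comp mf (measurable_continuous cphi)).
Qed.

End BcontComp.

(** * Truncated distances and bump functions *)

Section Tdist.
Variables (R : realType) (T : pseudoPMetricType R).
Implicit Types (A : set T) (x y : T).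

(* Truncated distance to A: a pseudometric structure only provides balls, and the value 1 keeps the infimum over a nonempty set. *)
Definition tdist A x : R :=
  inf ([set e | 0 < e /\ exists y, A y /\ ball x e y] `|` [set 1]).

Lemma tdist_set A x : has_inf ([set e : R | 0 < e /\ exists y, A y /\ ball x e y] `|` [set 1]).
Proof.
split; first by exists 1; right.
by exists 0 => e [[/ltW]|->].
Qed.

Lemma tdist_ge0 A x : 0 <= tdist A x.
Proof.
by apply: lb_le_inf; [exact: (tdist_set A x).1|move=> e [[/ltW]|->]].
Qed.

Lemma tdist_le1 A x : tdist A x <= 1.
Proof. by apply: ge_inf; [exact: (tdist_set A x).2|right]. Qed.

Lemma tdist_le A x y (e : R) : 0 < e -> A y -> ball x e y -> tdist A x <= e.
Proof.
move=> e0 Ay xy; apply: ge_inf; first exact: (tdist_set A x).2.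
by left; split=> //; exists y.
Qed.

Lemma tdist0 A x : A x -> tdist A x = 0.
Proof.
move=> Ax; apply/eqP; rewrite eq_le tdist_ge0 andbT.
apply/ler_addgt0Pr => e e0; rewrite add0r.
by apply: (tdist_le e0 Ax); exact: ballxx.
Qed.

Lemma tdist_ge A x (r : R) : r <= 1 -> (forall y, A y -> ~ ball x r y) -> r <= tdist A x.
Proof.
move=> r1 h; apply: lb_le_inf; first exact: (tdist_set A x).1.
move=> e [[e0 [y [Ay xy]]]|->//]; rewrite leNgt; apply/negP => er.
by apply: (h y Ay); apply: le_ball xy; exact: ltW.
Qed.

Lemma tdist_lip A x y (e : R) : 0 < e -> ball x e y -> tdist A x <= e + tdist A y.
Proof.
move=> e0 xy; rewrite -lerBlDl; apply: lb_le_inf; first exact: (tdist_set A y).1.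
move=> d [[d0 [w [Aw yw]]]|->].
  rewrite lerBlDl; apply: (tdist_le _ Aw); first exact: addr_gt0.
  exact: ball_triangle yw.
by rewrite lerBlDl (le_trans (tdist_le1 A x))// lerDr ltW.
Qed.

Lemma tdist_bcont A : bcont (tdist A).
Proof.
split; last by exists 1 => x; rewrite ger0_norm ?tdist_ge0// tdist_le1.
move=> x; apply/cvgrPdist_le => e e0; near=> y.
have xy : ball x e y by near: y; exact: nbhsx_ballx.
rewrite ler_distlC lerBlDl (tdist_lip _ e0 xy)//= addrC tdist_lip//.
exact: ball_sym.
Unshelve. all: by end_near. Qed.

Lemma tdist_gt0 A x : closed A -> ~ A x -> 0 < tdist A x.
Proof.
move=> cA nAx; have oA : open (~` A) by exact: closed_openC.
have /nbhs_ballP[r /= r0 rA] : nbhs x (~` A) by exact: open_nbhs_nbhs.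
apply: (@lt_le_trans _ _ (Num.min r 1)); first by rewrite lt_min r0 ltr01.
apply: tdist_ge; first by rewrite ge_min lexx orbT.
move=> y Ay xy; apply: (rA y) => //; apply: le_ball xy.
by rewrite ge_min lexx.
Qed.

(** Take min(1, n d) with d the truncated distance to the complement of [A]: off this closed set d
    is positive, so the value 1 is reached after finitely many steps. *)
Lemma open_approx (A : set T) : open A -> exists h : nat -> T -> R,
  [/\ forall n, bcont (h n), forall n x, 0 <= h n x <= 1,
      forall n m x, (n <= m)%N -> h n x <= h m x,
      forall n x, ~ A x -> h n x = 0 &
      forall x, A x -> \forall n \near \oo, h n x = 1].
Proof.
move=> oA; exists (fun n x => Num.min 1 (n%:R * tdist (~` A) x)); split.
- by move=> n; apply: bcont_min; [exact: bcont_cst|exact/bcontZ/tdist_bcont].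
- move=> n x; rewrite le_min ler01 mulr_ge0 ?tdist_ge0//=.
  by rewrite ge_min lexx.
- move=> n m x nm; rewrite le_min ge_min lexx/= ge_min; apply/orP; right.
  by rewrite ler_wpM2r ?tdist_ge0// ler_nat.
- by move=> n x Ax; rewrite tdist0// mulr0; apply/min_idPr.
- move=> x Ax; have d0 : 0 < tdist (~` A) x.
    by apply: tdist_gt0; [exact: open_closedC|exact].
  near=> n; apply/min_idPl; rewrite -ler_pdivrMr// mul1r.
  by near: n; exact: nbhs_infty_ger.
Unshelve. all: by end_near. Qed.

Lemma bump_exists (x0 : T) (r : R) : 0 < r -> exists h : T -> R,
  [/\ bcont h, forall x, 0 <= h x <= 1, forall x, ball x0 r x -> h x = 1 &
      forall x, 0 < h x -> ball x0 (r + r) x].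
Proof.
(* [tdist] never exceeds 1, so for r > 1 a decay length r would keep the bump positive
   everywhere. *)
move=> r0; pose s := Num.min r 1.
have s0 : 0 < s by rewrite lt_min r0 ltr01.
exists (fun x => Num.max 0 (1 - s^-1 * tdist (ball x0 r) x)); split.
- apply: bcont_max; first exact: bcont_cst.
  apply: bcontB; first exact: bcont_cst.
  exact/bcontZ/tdist_bcont.
- move=> x; rewrite le_max lexx ge_max ler01/= lerBlDr lerDl.
  by rewrite mulr_ge0 ?tdist_ge0// invr_ge0 ltW.
- by move=> x xr; rewrite tdist0// mulr0 subr0; apply/max_idPr.
- move=> x; rewrite lt_max ltxx/= subr_gt0 -ltr_pdivlMl ?invr_gt0// invrK mulr1 => xs.
  apply: contrapT => nx; have : s <= tdist (ball x0 r) x.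
    apply: tdist_ge; first by rewrite ge_min lexx orbT.
    move=> y xy sxy; apply: nx; apply: ball_triangle xy _.
    by apply: ball_sym; apply: le_ball sxy; rewrite ge_min lexx.
  by rewrite leNgt xs.
Qed.

End Tdist.

HB.instance Definition _ (R : realType) (A B : pseudoPMetricType R) :=
  Pointed.on (A * B)%type.

(** * Daniell representation *)

Section Daniell.
Variables (R : realType) (T : pseudoPMetricType R).
Variable L : (T -> R) -> R.
Hypothesis LD : forall f g, bcont f -> bcont g -> L (fun x => f x + g x) = L f + L g.
Hypothesis LZ : forall (c : R) f, bcont f -> L (fun x => c * f x) = c * L f.
Hypothesis L_ge0 : forall f, bcont f -> (forall x, 0 <= f x) -> 0 <= L f.
Hypothesis L1 : L (fun=> 1) = 1.
(** Daniell's condition is the source of countable additivity; it is later verified from tightness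
    through [tight_dini]. *)
Hypothesis L_daniell : forall F : nat -> T -> R, (forall n, bcont (F n)) ->
  (forall n x, 0 <= F n x <= 1) -> (forall n m x, (n <= m)%N -> F m x <= F n x) ->
  (forall x, F n x @[n --> \oo] --> 0) ->
  forall e : R, 0 < e -> exists n, L (F n) <= e.

Local Lemma L_le f g : bcont f -> bcont g -> (forall x, f x <= g x) -> L f <= L g.
Proof.
move=> bf bg fg; rewrite -subr_ge0 -mulN1r -LZ// -LD//; last exact: bcontZ.
apply: L_ge0; first by apply: bcontD => //; exact: bcontZ.
by move=> x; rewrite mulN1r subr_ge0.
Qed.

Local Lemma L_sum (I : Type) (s : seq I) (F : I -> T -> R) : (forall i, bcont (F i)) ->
  L (fun x => \sum_(i <- s) F i x) = \sum_(i <- s) L (F i).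
Proof.
move=> bF; elim: s => [|i s ih].
  rewrite big_nil (_ : (fun _ => _) = fun x : T => 0 * 1); first by rewrite LZ ?mul0r//; exact: bcont_cst.
  by apply/funext => x; rewrite big_nil mul0r.
rewrite (_ : (fun _ => _) = fun x => F i x + \sum_(j <- s) F j x).
  by rewrite LD//; [rewrite ih big_cons|exact: bcont_sum].
by apply/funext => x; rewrite big_cons.
Qed.

(** Riesz-type construction: the supremum [alpha] of [L] over [below G] is the content of an open
    set, and [gamma] extends it to all sets through open supersets. Vanishing off [G] takes the
    place of compact support, as the space need not be locally compact. *)
Let below (G : set T) : set (T -> R) :=
  [set f | [/\ bcont f, forall x, 0 <= f x <= 1 & forall x, ~ G x -> f x = 0]].

Let alpha (G : set T) : R := sup (L @` below G).

Local Lemma below0 G : below G (fun=> 0).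
Proof. by split=> //; [exact: bcont_cst|move=> x; rewrite lexx ler01]. Qed.

Local Lemma below_sup G : has_sup (L @` below G).
Proof.
split; first by exists (L (fun=> 0)); exists (fun=> 0) => //; exact: below0.
exists 1 => _ [f [bf f01 _] <-]; rewrite -[leRHS]L1; apply: L_le => //.
  exact: bcont_cst.
by move=> x; have /andP[] := f01 x.
Qed.

Local Lemma L0 : L (fun=> 0) = 0.
Proof.
rewrite (_ : (fun=> 0) = fun x : T => 0 * 1); first by rewrite LZ ?mul0r//; exact: bcont_cst.
by apply/funext => x; rewrite mul0r.
Qed.

Local Lemma alpha_ub G f : below G f -> L f <= alpha G.
Proof.
move=> h; apply: sup_upper_bound; first exact: below_sup.
by exists f.
Qed.

Local Lemma alpha_adh G (e : R) : 0 < e -> exists2 f, below G f & alpha G - e < L f.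
Proof.
move=> e0; have [_ [f hf <-] h] := sup_adherent e0 (below_sup G).
by exists f.
Qed.

Local Lemma alpha_le G (c : R) : (forall f, below G f -> L f <= c) -> alpha G <= c.
Proof.
move=> h; apply: ge_sup; first exact: (below_sup G).1.
by move=> _ [f hf <-]; exact: h.
Qed.

Local Lemma alpha_ge0 G : 0 <= alpha G.
Proof. by rewrite -L0; apply: alpha_ub; exact: below0. Qed.

Local Lemma alpha_mono G H : G `<=` H -> alpha G <= alpha H.
Proof.
move=> GH; apply: alpha_le => f [bf f01 f0]; apply: alpha_ub; split=> // x nH.
by apply: f0 => /GH.
Qed.

Local Lemma alphaT : alpha setT = 1.
Proof.
apply/eqP; rewrite eq_le; apply/andP; split.
  apply: alpha_le => f [bf f01 _]; rewrite -[leRHS]L1; apply: L_le => //.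
    exact: bcont_cst.
  by move=> x; have /andP[] := f01 x.
rewrite -[leLHS]L1; apply: alpha_ub; split; first exact: bcont_cst.
  by move=> x; rewrite ler01 lexx.
by move=> x [].
Qed.

Local Lemma alpha0 : alpha set0 = 0.
Proof.
apply/eqP; rewrite eq_le alpha_ge0 andbT; apply: alpha_le => f [bf f01 f0].
by rewrite (_ : f = fun=> 0) ?L0//; apply/funext => x; exact: f0.
Qed.

Local Lemma alpha_bigcup (G : nat -> set T) f (e : R) : (forall i, open (G i)) ->
  0 < e -> below (\bigcup_i G i) f -> exists N, L f <= \sum_(0 <= i < N) alpha (G i) + e.
Proof.
move=> oG e0 [bf f01 f0].
have [h hP] := choice (fun i => open_approx (oG i)).
have h1 i := let: And5 x _ _ _ _ := hP i in x.
have h2 i := let: And5 _ x _ _ _ := hP i in x.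
have h3 i := let: And5 _ _ x _ _ := hP i in x.
have h4 i := let: And5 _ _ _ x _ := hP i in x.
have h5 i := let: And5 _ _ _ _ x := hP i in x.
pose s N x := \sum_(0 <= i < N) h i N x.
have bs N : bcont (s N) by apply: bcont_sum => i; exact: h1.
have s0 N x : 0 <= s N x by apply: sumr_ge0 => i _; have /andP[] := h2 i N x.
have sm n m x : (n <= m)%N -> s n x <= s m x.
  move=> nm; rewrite /s (@big_cat_nat _ _ _ n 0 m)//= -[leLHS]addr0 lerD//.
    by apply: ler_sum => i _; exact: h3.
  by apply: sumr_ge0 => i _; have /andP[] := h2 i m x.
pose F N x := Num.max 0 (f x - s N x).
have bF N : bcont (F N) by apply: bcont_max; [exact: bcont_cst|exact: bcontB].
have [|||N LN] := L_daniell bF _ _ _ e0.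
- move=> n x; have /andP[fx0 fx1] := f01 x.
  by rewrite le_max lexx/= ge_max ler01/= lerBlDr (le_trans fx1)// lerDl.
- by move=> n m x nm; rewrite ge_max le_max lexx/= le_max lerB ?sm ?orbT.
- move=> x; have [[i _ Gix]|nG] := pselect ((\bigcup_i G i) x).
    apply: cvg_near_cst; near=> n; apply/max_idPl; rewrite subr_le0.
    have /andP[_ fx1] := f01 x; apply: (le_trans fx1).
    rewrite (_ : 1 = h i n x); last by symmetry; near: n; exact: h5.
    have li : (i < n)%N by near: n; exact: nbhs_infty_gt.
    rewrite /s (bigD1_seq i)/= ?mem_index_iota ?iota_uniq//.
    by rewrite lerDl sumr_ge0// => j _; have /andP[] := h2 j n x.
  apply: cvg_near_cst; near=> n; apply/max_idPl.
  by rewrite f0// sub0r oppr_le0.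
- exists N; have fF x : f x <= F N x + s N x.
    by rewrite -lerBlDr le_max lexx orbT.
  apply: (le_trans (L_le bf (bcontD (bF N) (bs N)) fF)).
  rewrite LD// addrC lerD// L_sum//; apply: ler_sum => i _.
  exact: (alpha_ub (And3 (h1 i N) (h2 i N) (h4 i N))).
Unshelve. all: by end_near. Qed.

Let gammas (M : set T) : set R := [set alpha G | G in [set G | open G /\ M `<=` G]].
Let gamma (M : set T) : R := inf (gammas M).

Local Lemma gammas_inf M : has_inf (gammas M).
Proof.
split; first by exists (alpha setT), setT => //; split=> //; exact: openT.
by exists 0 => _ [G _ <-]; exact: alpha_ge0.
Qed.

Local Lemma gamma_ge0 M : 0 <= gamma M.
Proof.
apply: lb_le_inf; first exact: (gammas_inf M).1.
by move=> _ [G _ <-]; exact: alpha_ge0.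
Qed.

Local Lemma gamma_le M G : open G -> M `<=` G -> gamma M <= alpha G.
Proof.
move=> oG MG; apply: ge_inf; first exact: (gammas_inf M).2.
by exists G.
Qed.

Local Lemma gamma_adh M (e : R) : 0 < e -> exists G, [/\ open G, M `<=` G & alpha G < gamma M + e].
Proof.
move=> e0; have [_ [G [oG MG] <-] h] := inf_adherent e0 (gammas_inf M).
by exists G.
Qed.

Local Lemma gamma_open G : open G -> gamma G = alpha G.
Proof.
move=> oG; apply/eqP; rewrite eq_le gamma_le//=.
apply: lb_le_inf; first exact: (gammas_inf G).1.
by move=> _ [H [oH GH] <-]; exact: alpha_mono.
Qed.

Local Lemma gamma_mono M N : M `<=` N -> gamma M <= gamma N.
Proof.
move=> MN; apply: lb_le_inf; first exact: (gammas_inf N).1.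
by move=> _ [H [oH NH] <-]; apply: gamma_le => //; exact: subset_trans NH.
Qed.

Definition daniell_outer (M : set T) : \bar R := (gamma M)%:E.

Lemma geo_sum (e : R) N : 0 <= e -> \sum_(0 <= i < N) e / 2 ^+ i.+1 <= e.
Proof.
move=> e0; suff -> : \sum_(0 <= i < N) e / 2 ^+ i.+1 = e - e / 2 ^+ N.
  by rewrite lerBlDr lerDl divr_ge0// exprn_ge0.
elim: N => [|N ih]; first by rewrite big_nil expr0 divr1 subrr.
rewrite big_nat_recr//= ih exprS.
have : 2 ^+ N != 0 :> R by rewrite expf_neq0.
by move=> ?; field.
Qed.

Local Lemma gamma_subadd : sigma_subadditive daniell_outer.
Proof.
move=> M; apply/lee_addgt0Pr => e e0.
have e2 : 0 < e / 2 by rewrite divr_gt0.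
have d0 i : 0 < e / 2 / 2 ^+ i.+1 by rewrite divr_gt0// exprn_gt0.
have [G GP] := choice (fun i => gamma_adh (M i) (d0 i)).
have oG i : open (G i) by have [] := GP i.
have h1 : gamma (\bigcup_i M i) <= alpha (\bigcup_i G i).
  apply: gamma_le; first exact: bigcup_open.
  by move=> x [i _ Mx]; exists i => //; have [_ + _] := GP i; apply.
suff h2 f : below (\bigcup_i G i) f ->
    ((L f)%:E <= \sum_(i <oo) daniell_outer (M i) + e%:E)%E.
  have [Sfin|] := boolP ((\sum_(i <oo) daniell_outer (M i))%E \is a fin_num).
    rewrite -(fineK Sfin) -EFinD lee_fin (le_trans h1)//; apply: alpha_le => f bf.
    by rewrite -lee_fin EFinD fineK//; exact: h2.
  rewrite ge0_fin_numE; last by apply: nneseries_ge0 => i _ _; rewrite lee_fin gamma_ge0.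
  by rewrite -leNgt leye_eq => /eqP ->; rewrite leey.
move=> bf; have [N LN] := alpha_bigcup oG e2 bf.
apply: (@le_trans _ _ (\sum_(0 <= i < N) daniell_outer (M i) + e%:E)%E).
  rewrite sumEFin -EFinD lee_fin (le_trans LN)//.
  apply: (@le_trans _ _ (\sum_(0 <= i < N) (gamma (M i) + e / 2 / 2 ^+ i.+1) + e / 2)).
    by rewrite lerD2r; apply: ler_sum => i _; apply/ltW; have [_ _] := GP i.
  rewrite big_split/= -addrA lerD2l [leRHS](_ : e = e / 2 + e / 2); last by field.
  by rewrite lerD2r geo_sum// ltW.
by apply: leeD2r; apply: nneseries_lim_ge => i _ _; rewrite lee_fin gamma_ge0.
Qed.

Local Lemma daniell_outer0 : daniell_outer set0 = 0%E.
Proof. by rewrite /daniell_outer gamma_open ?alpha0//; exact: open0. Qed.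

Local Lemma daniell_outer_ge0 M : (0 <= daniell_outer M)%E.
Proof. by rewrite lee_fin gamma_ge0. Qed.

Local Lemma daniell_outer_mono : {homo daniell_outer : A B / A `<=` B >-> (A <= B)%E}.
Proof. by move=> A B AB; rewrite lee_fin gamma_mono. Qed.

HB.instance Definition _ := isOuterMeasure.Build R T daniell_outer
  daniell_outer0 daniell_outer_ge0 daniell_outer_mono gamma_subadd.

(** Take [f] almost optimal for the part of [W] in [G], then [h] almost optimal for the part [V] of
    [W] where f < e / 4, which contains [X] minus [G]. After lowering [f] by e / 4 the two functions
    are never both nonzero, so their sum is allowed for [W]. Each of the four approximations costs e
    / 4. *)
Local Lemma open_caratheodory G : open G -> daniell_outer.-caratheodory G.
Proof.
move=> oG; apply: le_caratheodory_measurable => X /=.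
rewrite /daniell_outer -EFinD lee_fin; apply/ler_addgt0Pr => e e0.
have d0 : 0 < e / 4 by rewrite divr_gt0.
have [W [oW XW hW]] := gamma_adh X d0.
have [f [bf f01 f0] hf] := alpha_adh (W `&` G) d0.
pose V := W `&` [set x | f x < e / 4].
have oV : open V.
  apply: openI => //; apply: (@open_comp _ _ f [set y : R | y < e / 4]); last exact: open_lt.
  by move=> x _; exact: bf.1.
have [h [bh h01 h0] hh] := alpha_adh V d0.
have le1 : gamma (X `&` G) <= alpha (W `&` G).
  by apply: gamma_le; [exact: openI|exact: setSI].
have le2 : gamma (X `&` ~` G) <= alpha V.
  apply: gamma_le => // x [Xx nG]; split; first exact: XW.
  by rewrite /= f0 => [//|[]].
pose f' x := Num.max 0 (f x - e / 4).
have bf' : bcont f'.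
  by apply: bcont_max; [exact: bcont_cst|apply: bcontB => //; exact: bcont_cst].
have Lf' : L f <= L f' + e / 4.
  have -> : e / 4 = L (fun=> e / 4 * 1).
    by rewrite LZ ?L1 ?mulr1//; exact: bcont_cst.
  rewrite -LD//; last exact: bcont_cst.
  apply: L_le => //; first by apply: bcontD => //; exact: bcont_cst.
  by move=> x; rewrite mulr1 -lerBlDr le_max lexx orbT.
have le3 : L f' + L h <= alpha W.
  rewrite -LD//; apply: alpha_ub; split; first exact: bcontD.
    move=> x; have /andP[fx0 fx1] := f01 x; have /andP[hx0 hx1] := h01 x.
    rewrite addr_ge0//=; last by rewrite le_max lexx.
    have [xV|nV] := pselect (V x).
      rewrite /f' (_ : Num.max _ _ = 0) ?add0r//; apply/max_idPl.
      by rewrite subr_le0 ltW//; exact: xV.2.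
    by rewrite h0// addr0 ge_max ler01/= lerBlDr (le_trans fx1)// lerDl ltW.
  move=> x nW; rewrite h0 => [|[]//]; rewrite addr0 /f' f0 => [|[]//].
  by apply/max_idPl; rewrite sub0r oppr_le0 ltW.
lra.
Qed.

Definition daniell_measure (A : set (borel T)) : \bar R := daniell_outer A.

Local Lemma borel_caratheodory (A : set T) : measurable (A : set (borel T)) ->
  measurable (A : set (caratheodory_type daniell_outer)).
Proof.
move=> mA; apply: (smallest_sub _ _ mA).
  exact: (sigma_algebra_measurable (caratheodory_type daniell_outer)).
by move=> G oG; exact: open_caratheodory.
Qed.

Local Lemma daniell_measure0 : daniell_measure set0 = 0%E.
Proof. exact: daniell_outer0. Qed.

Local Lemma daniell_measure_ge0 A : (0 <= daniell_measure A)%E.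
Proof. exact: daniell_outer_ge0. Qed.

Local Lemma daniell_measure_sadd : semi_sigma_additive daniell_measure.
Proof.
move=> F mF tF mU; apply: (@caratheodory_measure_sigma_additive R T daniell_outer F).
- by move=> i; exact: borel_caratheodory.
- exact: tF.
- exact: borel_caratheodory.
Qed.

HB.instance Definition _ := isMeasure.Build _ (borel T) R daniell_measure
  daniell_measure0 daniell_measure_ge0 daniell_measure_sadd.

Local Lemma daniell_measureT : daniell_measure setT = 1%E.
Proof. by rewrite /daniell_measure /daniell_outer gamma_open ?alphaT//; exact: openT. Qed.

HB.instance Definition _ := Measure_isProbability.Build _ (borel T) R daniell_measure
  daniell_measureT.

Definition daniell_prob : Pmeas R T := daniell_measure.

(** Layer cake with slices of height 1. Applied to N f, each slice lies below the indicator of a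
    superlevel set, and [staircase_ind] bounds the excess of these indicators by one slice. *)
Lemma staircase (t : R) N : 0 <= t ->
  \sum_(0 <= j < N) Num.max 0 (Num.min 1 (t - j%:R)) = Num.min t N%:R.
Proof.
move=> t0; elim: N => [|N ih]; first by rewrite big_nil; symmetry; apply/min_idPr.
rewrite big_nat_recr//= ih -natr1; have : 0 <= N%:R :> R by [].
move: (N%:R : R) => M M0.
by rewrite !minElt !maxElt; case: (ltP 1 (t - M)) => ?; repeat (case: ltP => ?); lra.
Qed.

Lemma staircase_ind (t : R) N : 0 <= t ->
  \sum_(0 <= j < N) (j%:R < t)%R%:R <= Num.min (t + 1) N%:R.
Proof.
move=> t0; elim: N => [|N ih]; first by rewrite big_nil le_min lexx addr_ge0.
rewrite big_nat_recr//= -natr1; move: ih; have : 0 <= N%:R :> R by [].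
set S := \sum_(_ <= _ < _) _.
move: S (N%:R : R) => S M M0.
by case: (ltP M t) => /= ?; rewrite !minElt; repeat (case: ltP => ?); lra.
Qed.

(** N f is a sum of N slices, each below a superlevel set [G j] whose [alpha] is its measure, and
    the indicators of these sets add up to at most N f + 1. Dividing by N leaves an error 1 / N <
    e. *)
Local Lemma L_le_Ex f : bcont f -> (forall x, 0 <= f x <= 1) -> L f <= Ex daniell_prob f.
Proof.
move=> bf f01; apply/ler_addgt0Pr => e e0.
have [N Ne] : exists N : nat, e^-1 < N%:R.
  by exists (Num.truncn e^-1).+1; rewrite truncnS_gt.
have N0 : 0 < N%:R :> R by rewrite (lt_trans _ Ne)// invr_gt0.
pose fj (j : nat) x := Num.max 0 (Num.min 1 (N%:R * f x - j%:R)).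
have bfj j : bcont (fj j).
  apply: bcont_max; first exact: bcont_cst.
  apply: bcont_min; first exact: bcont_cst.
  by apply: bcontB; [exact: bcontZ|exact: bcont_cst].
pose G (j : nat) := [set x | j%:R < N%:R * f x].
have oG j : open (G j).
  apply: (@open_comp _ _ (fun x => N%:R * f x) [set y : R | j%:R < y]); last exact: open_gt.
  by move=> x _; exact: (bcontZ _ bf).1.
have mG j : measurable (G j : set (borel T)) by exact: sub_sigma_algebra.
have h1 : N%:R * L f = \sum_(0 <= j < N) L (fj j).
  rewrite -LZ// -L_sum//; congr (L _); apply/funext => x.
  have /andP[fx0 fx1] := f01 x.
  by rewrite staircase ?mulr_ge0//; symmetry; apply/min_idPl; rewrite ler_piMr.
have h2 : \sum_(0 <= j < N) L (fj j) <= \sum_(0 <= j < N) Ex daniell_prob (\1_(G j) : T -> R).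
  apply: ler_sum => j _; rewrite Ex_indic//= /daniell_measure /daniell_outer/= gamma_open//.
  apply: alpha_ub; split=> //.
    by move=> x; rewrite le_max lexx ge_max ler01/= ge_min lexx.
  move=> x /negP; rewrite -leNgt => h; apply/max_idPl; rewrite ge_min; apply/orP; right.
  by rewrite subr_le0.
have h3 : \sum_(0 <= j < N) Ex daniell_prob (\1_(G j) : T -> R) <= N%:R * Ex daniell_prob f + 1.
  have bI j : bmeas (\1_(G j) : T -> R) by exact: bmeas_indic.
  rewrite -Ex_sum// -ExZ; last exact: bcont_bmeas.
  rewrite -[X in _ + X](Ex_cst daniell_prob) -ExD; last 2 first.
    exact/bcont_bmeas/bcontZ.
    exact: bmeas_cst.
  apply: Ex_le; first exact: bmeas_sum.
    by apply: bmeasD; [exact/bcont_bmeas/bcontZ|exact: bmeas_cst].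
  move=> x; have /andP[fx0 fx1] := f01 x.
  under eq_bigr do rewrite indicE mem_setE.
  apply: (le_trans (staircase_ind _ _)); first by rewrite mulr_ge0.
  by rewrite ge_min lexx.
rewrite -(ler_pM2l N0) mulrDr h1 (le_trans h2)// (le_trans h3)// lerD2l.
by rewrite -ler_pdivrMr// mul1r ltW.
Qed.

Lemma daniell_representation f : bcont f -> Ex daniell_prob f = L f.
Proof.
have key g : bcont g -> (forall x, 0 <= g x <= 1) -> Ex daniell_prob g = L g.
  move=> bg g01; apply/eqP; rewrite eq_le L_le_Ex// andbT.
  have b1 := bcont_cst T (1 : R).
  (* The one-sided bound for 1 - g is the reverse bound for g, because both functionals are
     normalized. *)
  have := @L_le_Ex (fun x => 1 - g x) (bcontB b1 bg).
  rewrite ExB ?Ex_cst; try exact: bcont_bmeas.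
  rewrite (_ : (fun x => 1 - g x) = fun x => 1 + -1 * g x); last first.
    by apply/funext => x; rewrite mulN1r.
  rewrite LD//; last exact: bcontZ.
  rewrite LZ// L1 mulN1r lerD2l lerN2; apply=> x.
  have /andP[gx0 gx1] := g01 x; rewrite subr_ge0 gx1/=.
  by rewrite lerBlDr lerDl.
move=> bf; have [cf [M fM]] := bf.
pose N := Num.max M 1; have N0 : 0 < N by rewrite lt_max ltr01 orbT.
have fN x : `|f x| <= N by rewrite (le_trans (fM x))// le_max lexx.
pose g x := (2 * N)^-1 * (f x + N).
have bg : bcont g by apply: bcontZ; apply: bcontD => //; exact: bcont_cst.
have -> : f = fun x => 2 * N * g x + - N * 1.
  apply/funext => x; rewrite /g mulrA divff ?mul1r; last by rewrite mulf_neq0// gt_eqF.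
  by rewrite mulr1 addrK.
have bc := bcont_cst T (1 : R).
rewrite ExD; [|exact/bcont_bmeas/bcontZ|exact/bcont_bmeas/bcontZ].
rewrite Ex_cst (ExZ _ _ (bcont_bmeas bg)).
rewrite LD; [|exact: bcontZ|exact: bcontZ].
rewrite (LZ _ bg) (LZ _ bc) L1 key// => x.
have := fN x; rewrite ler_norml => /andP[h1 h2].
have h3 : 0 <= f x + N by lra.
have h4 : f x + N <= 2 * N by lra.
apply/andP; split; first by rewrite /g mulr_ge0 ?invr_ge0// mulr_ge0// ltW.
by rewrite /g ler_pdivrMl ?mulr_gt0// mulr1.
Qed.

End Daniell.

(** * Tight ultrafilters of probability measures converge *)

Section Ultra.
Variable (R : realType).

(** An ultrafilter containing a finite union contains one of its members. This turns a finite cover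
    by small balls into a single small ball in the filter. *)
Lemma ultra_seq (I : Type) (A : eqType) (U : set_system I) (s : seq A) (P : A -> I -> Prop) :
  UltraFilter U -> U [set i | exists2 y, y \in s & P y i] ->
  exists2 y, y \in s & U [set i | P y i].
Proof.
move=> UU; have PU : ProperFilter U by exact: ultra_proper.
elim: s => [|a s ih] h.
  by exfalso; apply: (@filter_not_empty _ U); apply: filterS h => i [].
have [h1|h1] := in_ultra_setVsetC [set i | P a i] UU.
  by exists a => //; rewrite mem_head.
have [|y ys hy] := ih.
  apply: filterS (filterI h h1) => i [[y + Pyi] nP].
  by rewrite inE => /orP[/eqP yx|ys]; [rewrite yx in Pyi|exists y].
by exists y => //; rewrite inE ys orbT.
Qed.

Lemma ultra_lim (I : Type) (U : set_system I) (v : I -> R) (M : R) : UltraFilter U ->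
  (forall i, `|v i| <= M) ->
  exists l, forall e : R, 0 < e -> U [set i | `|v i - l| < e].
Proof.
move=> UU vM; have PU : ProperFilter U by exact: ultra_proper.
(* The limit is the supremum of the levels exceeded on a set of the ultrafilter. *)
pose S := [set r | U [set i | r <= v i]].
have S0 : has_sup S.
  split.
    exists (- M); apply: filterS filterT => i _ /=.
    by have := vM i; rewrite ler_norml => /andP[].
  exists M => r Sr; rewrite leNgt; apply/negP => Mr.
  apply: (@filter_not_empty _ U); apply: filterS Sr => i /= h.
  by have := lt_le_trans Mr h; rewrite ltNge (le_trans (ler_norm _) (vM i)).
exists (sup S) => e e0.
have e2 : 0 < e / 2 by rewrite divr_gt0.
have [r Sr hr] := sup_adherent e2 S0.
have h2 : U [set i | v i < sup S + e / 2].
  have [h|h] := in_ultra_setVsetC [set i | sup S + e / 2 <= v i] UU.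
    by have := sup_upper_bound S0 h; lra.
  by apply: filterS h => i /negP; rewrite -ltNge.
apply: filterS (filterI Sr h2) => i /= [h3 h4].
by rewrite ltr_norml; lra.
Qed.

End Ultra.

Section Complete.
Variables (R : realType).

(** Completeness in terms of filters with arbitrarily small balls, a form that passes from the
    factors to a product and that fits ultrafilters on totally bounded sets. *)
Definition ball_complete (T : pseudoPMetricType R) : Prop :=
  forall F : set_system T, ProperFilter F ->
    (forall d : R, 0 < d -> exists x, F (ball x d)) -> exists x : T, F --> x.

Lemma complete_ball_complete (T : completePseudoMetricType R) : ball_complete T.
Proof.
move=> F PF h; exists (lim F); apply: (@cauchy_cvg T F PF); apply: cauchy_exP.
exact: h.
Qed.

Lemma prod_ball_complete (T U : pseudoPMetricType R) : ball_complete T ->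
  ball_complete U -> ball_complete (T * U)%type.
Proof.
move=> cT cU F PF h.
have [|x Fx] := cT (fst @ F) (fmap_proper_filter _ PF).
  move=> d d0; have [[x y] Fxy] := h d d0; exists x.
  suff : F [set p | ball x d p.1] by [].
  by apply: filterS Fxy => p [].
have [|y Fy] := cU (snd @ F) (fmap_proper_filter _ PF).
  move=> d d0; have [[x' y] Fxy] := h d d0; exists y.
  suff : F [set p | ball y d p.2] by [].
  by apply: filterS Fxy => p [].
exists (x, y) => A [[B C] /= [xB yC] BCA].
have FB : F [set p | B p.1] := Fx _ xB.
have FC : F [set p | C p.2] := Fy _ yC.
suff : F A by [].
by apply: filterS (filterI FB FC) => p BCp; exact: (BCA p).
Qed.

End Complete.

Section Tight.
Variables (R : realType) (T : pseudoPMetricType R).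
Hypothesis cT : ball_complete T.

(* If [u] has a small integral, then finitely many [d]-balls carry most of the mass: tightness without compact sets. *)
Definition tight_witness (d : R) (u : T -> R) : Prop :=
  [/\ bcont u, forall x, 0 <= u x & exists s : seq T,
      forall x, (forall y, y \in s -> ~ ball y d x) -> 1 <= u x].

(** Dini's theorem without a compact set. Where some [u m] with m < N is at least 1, the bound F <=
    1 suffices. If the claim failed elsewhere for every N, bad points [x N] would lie, along an
    ultrafilter of indices, in balls of every radius 1 / (m + 1). Completeness then gives a limit
    [y] where all [F n] are at least [e], against the convergence to 0. *)
Lemma tight_dini (u : nat -> T -> R) (F : nat -> T -> R) (e : R) : 0 < e ->
  (forall m, tight_witness m.+1%:R^-1 (u m)) ->
  (forall n, bcont (F n)) -> (forall n x, F n x <= 1) ->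
  (forall n m x, (n <= m)%N -> F m x <= F n x) ->
  (forall x, F n x @[n --> \oo] --> 0) ->
  exists N, forall x, F N x <= e + \sum_(0 <= m < N) u m x.
Proof.
move=> e0 tu bF F1 Fm F0.
have [s hs] := choice (fun m => let: And3 _ _ x := tu m in x).
have u0 m x : 0 <= u m x by have [_ + _] := tu m; apply.
suff [N hN] : exists N, forall x,
    (forall m, (m < N)%N -> exists2 y, y \in s m & ball y m.+1%:R^-1 x) -> F N x <= e.
  exists N => x; have [h|] := pselect (forall m, (m < N)%N ->
      exists2 y, y \in s m & ball y m.+1%:R^-1 x).
    by rewrite (le_trans (hN x h))// lerDl sumr_ge0.
  move=> /existsNP[m /not_implyP[mN nm]].
  have um : 1 <= u m x.
    by apply: hs => y ys xy; apply: nm; exists y.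
  rewrite (le_trans (F1 N x))// (le_trans um)// (bigD1_seq m)/= ?mem_index_iota ?iota_uniq//.
  by rewrite addrCA lerDl addr_ge0 ?sumr_ge0// ltW.
apply: contrapT => /forallNP h.
have [x hx] := choice (fun N => (iffRL (existsNP _) (h N))).
have hx1 N : forall m, (m < N)%N -> exists2 y, y \in s m & ball y m.+1%:R^-1 (x N).
  by have /not_implyP[] := hx N.
have hx2 N : e < F N (x N).
  by have /not_implyP[_ /negP] := hx N; rewrite -ltNge.
have [U [UU sU]] := @ultraFilterLemma nat \oo _.
have PU : ProperFilter U by exact: ultra_proper.
have [|y xy] := cT (fmap_proper_filter x PU).
  move=> d d0; have [m md] : exists m : nat, m.+1%:R^-1 < d.
    exists (Num.truncn d^-1); rewrite invf_plt ?posrE//; exact: truncnS_gt.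
  have [|y ys hy] := @ultra_seq nat T U (s m) (fun y n => ball y m.+1%:R^-1 (x n)) UU.
    apply: sU; near=> n; apply: hx1; near: n; exact: nbhs_infty_gt.
  exists y; apply: filterS hy => n /=; apply: le_ball; exact: ltW.
have Fy n : e <= F n y.
  rewrite leNgt; apply/negP => lt.
  have : nbhs y [set w | F n w < e].
    by apply: (@cvgr_lt _ _ _ _ (F n)) lt; exact: (bF n).1.
  move=> /xy Uw'; have Uw : U [set N | F n (x N) < e] := Uw'.
  apply: (@filter_not_empty _ U).
  have Un : U [set N | (n <= N)%N] by apply: sU; exact: nbhs_infty_ge.
  apply: filterS (filterI Uw Un) => N [/= h1 h2].
  by have := lt_le_trans (hx2 N) (Fm _ _ (x N) h2); rewrite ltNge ltW.
have : e <= 0 by apply: (cvgr_to_ge (F0 y)); exact: nearW.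
by rewrite leNgt e0.
Unshelve. all: by end_near. Qed.

(** The limit functional consists of the ultrafilter limits of the integrals, which inherit
    linearity and positivity. Tightness enters only in Daniell's condition, with budget e / 2 for
    [tight_dini] and e / 2^(m+2) for the m-th witness. *)
Lemma ultra_tight_cvg (G : set_system (Pmeas R T)) : UltraFilter G ->
  (forall e d : R, 0 < e -> 0 < d -> exists2 u, tight_witness d u &
     G [set q | Ex q u <= e]) ->
  exists q0 : Pmeas R T, forall f, bcont f -> forall e : R, 0 < e ->
    G [set q | `|Ex q f - Ex q0 f| < e].
Proof.
move=> UG tG; have PG : ProperFilter G by exact: ultra_proper.
have [L hL] : exists L : (T -> R) -> R, forall f, bcont f -> forall e : R, 0 < e ->
    G [set q | `|Ex q f - L f| < e].
  suff /choice[L hL] : forall f, exists l, bcont f -> forall e : R, 0 < e ->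
    G [set q | `|Ex q f - l| < e] by exists L.
  move=> f; have [bf|nf] := pselect (bcont f); last by exists 0.
  have [M fM] := bf.2.
  have [l hl] := @ultra_lim R _ G (fun q => Ex q f) M UG
    (fun q => Ex_bnd q (bcont_bmeas bf) fM).
  by exists l => _.
have L_unique f l : bcont f -> (forall e : R, 0 < e -> G [set q | `|Ex q f - l| < e]) -> L f = l.
  move=> bf hl; apply/eqP; rewrite -subr_eq0 -normr_le0; apply/ler_addgt0Pr => e e0.
  have e2 : 0 < e / 2 by rewrite divr_gt0.
  rewrite add0r; apply: contrapT => /negP; rewrite -ltNge => lt.
  apply: (@filter_not_empty _ G); apply: filterS (filterI (hL f bf _ e2) (hl _ e2)) => q /= [].
  move: lt; rewrite ltr_normr !ltr_norml; lra.
have L_le f c : bcont f -> G [set q | Ex q f <= c] -> L f <= c.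
  move=> bf hc; apply/ler_addgt0Pr => e e0; apply: contrapT => /negP; rewrite -ltNge => lt.
  apply: (@filter_not_empty _ G); apply: filterS (filterI (hL f bf _ e0) hc) => q /= [].
  by rewrite ltr_norml; lra.
have LD f g : bcont f -> bcont g -> L (fun x => f x + g x) = L f + L g.
  move=> bf bg; apply: L_unique; first exact: bcontD.
  move=> e e0; have e2 : 0 < e / 2 by rewrite divr_gt0.
  apply: filterS (filterI (hL f bf _ e2) (hL g bg _ e2)) => q /=.
  by rewrite ExD ?ltr_norml; [lra|exact: bcont_bmeas|exact: bcont_bmeas].
have LZ (c : R) f : bcont f -> L (fun x => c * f x) = c * L f.
  move=> bf; apply: L_unique; first exact: bcontZ.
  move=> e e0; have c0 : 0 < `|c| + 1 by rewrite ltr_wpDl.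
  have e2 : 0 < e / (`|c| + 1) by rewrite divr_gt0.
  apply: filterS (hL f bf _ e2) => q /=.
  rewrite ExZ; last exact: bcont_bmeas.
  rewrite -mulrBr normrM ltr_pdivlMr// => h.
  apply: le_lt_trans h; rewrite mulrC ler_wpM2l// lerDl//.
have L_ge0 f : bcont f -> (forall x, 0 <= f x) -> 0 <= L f.
  move=> bf f0; rewrite -oppr_le0 -mulN1r -LZ//; apply: L_le; first exact: bcontZ.
  apply: filterS filterT => q _ /=; rewrite ExZ; last exact: bcont_bmeas.
  by rewrite mulN1r oppr_le0; exact: Ex_ge0.
have L1 : L (fun=> 1) = 1.
  apply: L_unique; first exact: bcont_cst.
  by move=> e e0; apply: filterS filterT => q _ /=; rewrite Ex_cst subrr normr0.
have L_dan (F : nat -> T -> R) : (forall n, bcont (F n)) ->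
  (forall n x, 0 <= F n x <= 1) -> (forall n m x, (n <= m)%N -> F m x <= F n x) ->
  (forall x, F n x @[n --> \oo] --> 0) -> forall e : R, 0 < e -> exists n, L (F n) <= e.
  move=> bF F01 Fm F0 e e0.
  have e2 : 0 < e / 2 by rewrite divr_gt0.
  have dP m : 0 < m.+1%:R^-1 :> R by rewrite invr_gt0.
  have eP m : 0 < e / 2 / 2 ^+ m.+1 by rewrite divr_gt0// exprn_gt0.
  have [u hu] := choice (fun m => let: ex_intro2 u a b := tG _ _ (eP m) (dP m) in
     ex_intro (fun u => tight_witness m.+1%:R^-1 u /\ G [set q | Ex q u <= e / 2 / 2 ^+ m.+1]) u (conj a b)).
  have bu m : bcont (u m) by have [[]] := hu m.
  have [|N hN] := @tight_dini u F _ e2 (fun m => (hu m).1) bF _ Fm F0.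
    by move=> n x; have /andP[] := F01 n x.
  exists N; apply: L_le => //.
  have : G [set q | forall m : 'I_N, Ex q (u m) <= e / 2 / 2 ^+ m.+1].
    by apply: filter_forall => m; exact: (hu m).2.
  apply: filterS => q /= h.
  have bS : bcont (fun x => \sum_(0 <= m < N) u m x) by exact: bcont_sum.
  apply: (le_trans (Ex_le q (bcont_bmeas (bF N)) (bcont_bmeas (bcontD (bcont_cst _ _) bS)) hN)).
  rewrite ExD; [|exact/bcont_bmeas/bcont_cst|exact: bcont_bmeas].
  rewrite Ex_cst Ex_sum; last by move=> i; exact: bcont_bmeas.
  rewrite [leRHS](_ : e = e / 2 + e / 2); last by field.
  rewrite lerD2l (le_trans _ (geo_sum N (ltW e2)))// !big_mkord.
  exact: ler_sum.
exists (daniell_prob LD LZ L_ge0 L1 L_dan) => f bf e e0.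
by rewrite daniell_representation//; exact: hL.
Qed.

End Tight.

Section NarrowUltra.
Variables (R : realType) (T : ptopologicalType).

Lemma narrow_distE (q q' : Pmeas R T) (f : T -> R) (e : R) : bcont f ->
  (`| pint q' f - pint q f | < e%:E)%E = (`|Ex q' f - Ex q f| < e).
Proof. by move=> bf; rewrite !pintE; [|exact: bcont_bmeas..]. Qed.

Lemma ultra_narrow_open (G : set_system (Pmeas R T)) (q0 : Pmeas R T) V : Filter G ->
  (forall f, bcont f -> forall e : R, 0 < e -> G [set q | `|Ex q f - Ex q0 f| < e]) ->
  narrow_open V -> V q0 -> G V.
Proof.
move=> FG h oV Vq; have [m [f [e [e0 [bf sV]]]]] := oV _ Vq.
apply: filterS sV _.
have : G [set q | forall j : 'I_m, `|Ex q (f j) - Ex q0 (f j)| < e].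
  by apply: filter_forall => j; exact: h.
by apply: filterS => q /= hq j; rewrite narrow_distE.
Qed.

Lemma narrow_open_gt (f : T -> R) (b : R) : bcont f ->
  narrow_open [set q : Pmeas R T | b < Ex q f].
Proof.
move=> bf q /= qb; exists 1%N, (fun=> f), (Ex q f - b).
split; first by rewrite subr_gt0.
split=> // q' /= /(_ ord0); rewrite narrow_distE// ltr_norml; lra.
Qed.

End NarrowUltra.

(** * Approximation by bounded continuous functions *)

Section LimSup.
Variable (R : realType).
Implicit Types (u : nat -> R).

(** Real-valued, hence meaningful only for bounded sequences: every rule below takes a bound [M]. *)
Definition rlimsup u : R := limn_sup (u : (R^o)^nat).

Local Lemma rlimsupE u (M : R) : (forall n, `|u n| <= M) ->
  rlimsup u = inf (range (sups u)).
Proof.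
move=> uM; rewrite /rlimsup limn_supE//; exists M; split; first exact: num_real.
by move=> x Mx n _; exact: le_trans (uM n) (ltW Mx).
Qed.

Local Lemma sups_set u n (M : R) : (forall n, `|u n| <= M) -> has_sup (sdrop u n).
Proof.
move=> uM; split; first by exists (u n), n => /=.
by exists M => _ [k _ <-]; rewrite (le_trans (ler_norm _))//.
Qed.

Local Lemma sups_inf u (M : R) : (forall n, `|u n| <= M) -> has_inf (range (sups u)).
Proof.
move=> uM; split; first by exists (sups u 0%N), 0%N.
exists (- M) => _ [n _ <-]; apply: (@le_trans _ _ (u n)).
  by have := uM n; rewrite ler_norml => /andP[].
by apply: sup_upper_bound; [exact: sups_set uM|exists n => /=].
Qed.

Lemma rlimsup_le u (M r : R) : (forall n, `|u n| <= M) ->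
  (\forall n \near \oo, u n <= r) -> rlimsup u <= r.
Proof.
move=> uM [N _ hN]; rewrite (rlimsupE uM); apply: (@le_trans _ _ (sups u N)).
  by apply: ge_inf; [exact: (sups_inf uM).2|exists N].
apply: ge_sup; first exact: (sups_set N uM).1.
by move=> _ [k /= Nk <-]; exact: hN.
Qed.

Lemma rlimsup_near u (M e : R) : (forall n, `|u n| <= M) -> 0 < e ->
  \forall n \near \oo, u n <= rlimsup u + e.
Proof.
move=> uM e0; have [_ [N _ <-] h] := inf_adherent e0 (sups_inf uM).
rewrite (rlimsupE uM); near=> n.
rewrite ltW// (le_lt_trans _ h)//.
apply: sup_upper_bound; first exact: (sups_set N uM).
by exists n => //=; near: n; exact: nbhs_infty_ge.
Unshelve. all: by end_near. Qed.

Lemma rlimsup_ge u (M r : R) : (forall n, `|u n| <= M) ->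
  (\forall n \near \oo, r <= u n) -> r <= rlimsup u.
Proof.
move=> uM h; apply/ler_addgt0Pr => e e0.
have h2 := rlimsup_near uM e0.
near \oo => n; apply: (@le_trans _ _ (u n)).
  by near: n; exact: h.
by near: n; exact: h2.
Unshelve. all: by end_near. Qed.

Lemma rlimsup_bnd u (M : R) : (forall n, `|u n| <= M) -> `|rlimsup u| <= M.
Proof.
move=> uM; rewrite ler_norml; apply/andP; split.
  by apply: (rlimsup_ge uM); apply: nearW => n; have := uM n; rewrite ler_norml => /andP[].
by apply: (rlimsup_le uM); apply: nearW => n; rewrite (le_trans (ler_norm _)).
Qed.

Lemma bmeas_rlimsup (T : ptopologicalType) (F : nat -> T -> R) (M : R) :
  (forall n, bmeas (F n)) -> (forall n x, `|F n x| <= M) ->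
  bmeas (fun x => rlimsup (fun n => F n x)).
Proof.
move=> bF FM; split; last by exists M => x; exact: rlimsup_bnd.
apply: (@measurable_fun_limn_sup _ (borel T) R setT (fun n => F n : borel T -> R)).
- by move=> t _; exists M => _ [n _ <-]; rewrite (le_trans (ler_norm _)).
- move=> t _; exists (- M) => _ [n _ <-].
  by have := FM n t; rewrite ler_norml => /andP[].
- by move=> n; exact: (bF n).1.
Qed.

End LimSup.

Section Fatou.
Variables (R : realType) (T : ptopologicalType).

(** max(F n, g) converges boundedly to g. The hypothesis is one-sided and eventual at each point,
    the form in which large deviation upper bounds come. *)
Lemma reverse_fatou (q : Pmeas R T) (F : nat -> T -> R) (g : T -> R) (M : R) :
  (forall n, bmeas (F n)) -> (forall n x, `|F n x| <= M) -> bmeas g ->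
  (forall x (e : R), 0 < e -> \forall n \near \oo, F n x <= g x + e) ->
  forall e : R, 0 < e -> \forall n \near \oo, Ex q (F n) <= Ex q g + e.
Proof.
move=> bF FM bg Fg e e0.
have [N gN] := bg.2.
have bH n : bmeas (fun x => Num.max (F n x) (g x)) by exact: bmeas_max.
have [||_ h] := @Ex_cvg R T q (fun n x => Num.max (F n x) (g x)) g (Num.max M N) bH.
- move=> n x; rewrite le_max; case: (leP (F n x) (g x)) => _.
    by rewrite gN orbT.
  by rewrite FM.
- move=> x; apply/cvgrPdist_le => d d0; near=> n.
  have Fn : F n x <= g x + d by near: n; exact: Fg.
  rewrite distrC ger0_norm ?subr_ge0 ?le_max ?lexx ?orbT//.
  by rewrite lerBlDr ge_max addrC Fn lerDl ltW.
have h2 : \forall n \near \oo, Ex q (fun x => Num.max (F n x) (g x)) <= Ex q g + e.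
  by apply: cvgr_le h _ _; rewrite ltrDl.
near=> n; apply: (@le_trans _ _ (Ex q (fun x => Num.max (F n x) (g x)))).
  by apply: Ex_le => // x; rewrite le_max lexx.
by near: n.
Unshelve. all: by end_near. Qed.

End Fatou.

Section Pushforward.
Variables (R : realType) (T U : ptopologicalType).

Lemma Ex_marginal (q : Pmeas R T) (mu : Pmeas R U) (phi : T -> U) (h : U -> R) :
  continuous phi -> bmeas h ->
  (forall A : set U, measurable (A : set (borel U)) -> q (phi @^-1` A) = mu A) ->
  Ex q (fun x => h (phi x)) = Ex mu h.
Proof.
move=> cphi bh qmu; congr fine; rewrite /pint.
have mphi := measurable_continuous cphi.
have := @integral_pushforward _ _ (borel T) (borel U) R phi mphi q setT (EFin \o h).
move=> /(_ _ _ measurableT) <-.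
- by apply: eq_measure_integral => A mA _; exact: qmu.
- by apply/measurable_EFinP; exact: bh.1.
- exact: (bmeas_integrable q (bmeas_comp cphi bh)).
Qed.

End Pushforward.

Section MeasureDetermining.
Variables (R : realType) (T : pseudoPMetricType R).
Implicit Types (p q : Pmeas R T).

Lemma Ex_open_cvg q (A : set T) : open A -> exists h : nat -> T -> R,
  [/\ forall n, bcont (h n), forall n x, 0 <= h n x <= 1,
      forall x, h n x @[n --> \oo] --> (\1_A x : R) &
      Ex q (h n) @[n --> \oo] --> Ex q (\1_A : T -> R)].
Proof.
move=> oA; have [h [h1 h2 _ h4 h5]] := open_approx oA; exists h.
have c x : h n x @[n --> \oo] --> (\1_A x : R).
  apply: cvg_near_cst; have [Ax|nA] := pselect (A x).
    by rewrite indicE mem_set//; exact: h5.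
  by rewrite indicE memNset//; apply: nearW => n; rewrite h4.
split=> //; apply: (@Ex_cvg _ _ q h _ 1 _ _ c).2.
  by move=> n; exact: bcont_bmeas.
by move=> n x; have /andP[h0 h1'] := h2 n x; rewrite ger0_norm.
Qed.

Lemma bcont_determining p q : (forall f, bcont f -> Ex p f = Ex q f) ->
  forall A : set T, measurable (A : set (borel T)) -> p A = q A.
Proof.
move=> pq; have fin (r : Pmeas R T) (A : set T) : measurable (A : set (borel T)) -> (r A) \is a fin_num.
  by move=> mA; exact: (fin_num_measure r A mA).
apply: (@g_sigma_algebra_measure_unique _ R (borel T) (@open T) _ (fun=> setT)).
- by move=> A oA; exact: sub_sigma_algebra.
- by move=> _; exact: openT.
- by rewrite bigcup_const//; exists 0%N.
- by move=> A B; exact: openI.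
- move=> A oA; have mA : measurable (A : set (borel T)) by exact: sub_sigma_algebra.
  apply: (eq_trans (esym (fineK (fin p A mA)))).
  apply: (eq_trans _ (fineK (fin q A mA))); congr EFin.
  rewrite -(Ex_indic p mA) -(Ex_indic q mA).
  have [h [h1 h2 hA _]] := Ex_open_cvg p oA.
  have c (r : Pmeas R T) : Ex r (h n) @[n --> \oo] --> Ex r (\1_A : T -> R).
    apply: (@Ex_cvg _ _ r h _ 1 _ _ hA).2.
      by move=> n; exact: bcont_bmeas.
    by move=> n x; have /andP[h0 h1'] := h2 n x; rewrite ger0_norm.
  apply: (cvg_unique _ (c p)) => //.
  rewrite /= (_ : (fun n => Ex p (h n)) = fun n => Ex q (h n)); first exact: c.
  by apply/funext => n; exact: pq.
- by move=> _; apply: (@le_lt_trans _ _ 1%E); [rewrite le_eqVlt; apply/orP; left; apply/eqP; exact: (probability_setT p)|exact: ltry].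
Qed.

End MeasureDetermining.

Section BmeasInd.
Variables (R : realType) (T : ptopologicalType) (C : (T -> R) -> Prop).
Hypothesis Cindic : forall A : set T, measurable (A : set (borel T)) -> C (\1_A : T -> R).
Hypothesis Clin : forall (F G : T -> R) (c : R), bmeas F -> bmeas G -> C F -> C G ->
  C (fun x => F x + c * G x).
Hypothesis Clim : forall (F : nat -> T -> R) (h : T -> R) (M : R), (forall n, bmeas (F n)) ->
  (forall n x, `|F n x| <= M) -> (forall x, F n x @[n --> \oo] --> h x) ->
  (forall n, C (F n)) -> C h.

Local Lemma Ccst (c : R) : C (fun=> c).
Proof.
rewrite (_ : (fun=> c) = fun x : T => \1_set0 x + c * \1_setT x).
  apply: Clin; [exact/bmeas_indic/measurable0|exact/bmeas_indic/measurableT| |].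
    exact/Cindic/measurable0.
  exact/Cindic/measurableT.
by apply/funext => x; rewrite indic0 indicT add0r mulr1.
Qed.

(** A function g with values in [0, 1] is uniformly within 1 / N of the average of the indicators of
    {j < N g} over j < N; affine rescaling then covers all bounded functions. *)
Lemma bmeas_ind (h : T -> R) : bmeas h -> C h.
Proof.
have key g : bmeas g -> (forall x, 0 <= g x <= 1) -> C g.
  move=> bg g01.
  pose F (N : nat) x := \sum_(0 <= j < N) N%:R^-1 * (\1_[set y | j%:R < N%:R * g y] x : R).
  have mG (N j : nat) : measurable ([set y | j%:R < N%:R * g y] : set (borel T)).
    rewrite -[X in measurable X]setTI.
    have [mf _] := bmeasZ N%:R bg.
    by have := mf measurableT _ (measurable_itv `]j%:R, +oo[); rewrite setTI/= set_itvoy setTI.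
  have bG (N j : nat) := bmeas_indic R (mG N j).
  have FE N x : F N x = N%:R^-1 * \sum_(0 <= j < N) (j%:R < N%:R * g x)%R%:R.
    by rewrite mulr_sumr; apply: eq_bigr => j _; rewrite indicE mem_setE.
  have FA N : forall n, C (fun x => \sum_(0 <= j < n) N%:R^-1 * (\1_[set y | j%:R < N%:R * g y] x : R)).
    elim=> [|n ih].
      rewrite (_ : (fun _ => _) = fun=> 0); first exact: Ccst.
      by apply/funext => x; rewrite big_nil.
    rewrite (_ : (fun _ => _) = fun x => \sum_(0 <= j < n) N%:R^-1 * (\1_[set y | j%:R < N%:R * g y] x : R) + N%:R^-1 * (\1_[set y | n%:R < N%:R * g y] x : R)).
      apply: Clin => //; last exact: Cindic.
      by apply: bmeas_sum => i; exact: bmeasZ.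
    by apply/funext => x; rewrite big_nat_recr.
  have lo (t : R) N : 0 <= t -> Num.min t N%:R <= \sum_(0 <= j < N) (j%:R < t)%R%:R.
    move=> t0; rewrite -staircase//; apply: ler_sum => j _.
    by case: (ltP j%:R t) => /= ht; rewrite ge_max ?ler01 ?lexx ge_min ?lexx//= subr_le0 ht orbT.
  have near N x : (0 < N)%N -> `|F N x - g x| <= N%:R^-1.
    move=> N0; have /andP[g0 g1] := g01 x.
    have Np : 0 < N%:R :> R by rewrite ltr0n.
    have Ng : 0 <= N%:R * g x by rewrite mulr_ge0.
    have Ng1 : N%:R * g x <= N%:R by rewrite ler_piMr// ltW.
    have h1 := lo _ N Ng; rewrite (min_idPl Ng1) in h1.
    have h2 := staircase_ind N Ng.
    have h3 : \sum_(0 <= j < N) (j%:R < N%:R * g x)%R%:R <= N%:R * g x + 1.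
      by rewrite (le_trans h2)// ge_min lexx.
    rewrite FE [X in _ - X](_ : g x = N%:R^-1 * (N%:R * g x)); last first.
      by rewrite mulrA mulVf ?mul1r// gt_eqF.
    have Ni : 0 <= N%:R^-1 :> R by rewrite invr_ge0 ltW.
    rewrite -mulrBr normrM (ger0_norm Ni); apply: ler_piMr => //.
    by rewrite ler_norml; lra.
  apply: (@Clim (fun N => F N.+1) _ (1 + 1)).
  - by move=> n; apply: bmeas_sum => i; exact: bmeasZ.
  - move=> n x; rewrite -(subrK (g x) (F n.+1 x)) (le_trans (ler_normD _ _))// lerD//.
      by rewrite (le_trans (near n.+1 x isT))// invf_le1// ler1n.
    by have /andP[g0 g1] := g01 x; rewrite ger0_norm.
  - move=> x; apply/cvgrPdist_le => e e0; near=> n; rewrite distrC.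
    rewrite (le_trans (near n.+1 x isT))// invf_ple ?posrE// (@le_trans _ _ n%:R)//.
      by near: n; exact: nbhs_infty_ger.
    by rewrite ler_nat.
  - by move=> n; exact: FA.
move=> bh; have [mh [M hM]] := bh.
pose N := Num.max M 1; have N0 : 0 < N by rewrite lt_max ltr01 orbT.
have hN x : `|h x| <= N by rewrite (le_trans (hM x))// le_max lexx.
pose g x := (2 * N)^-1 * (h x + N).
have bg : bmeas g by apply: bmeasZ; apply: bmeasD => //; exact: bmeas_cst.
have -> : h = fun x => - N + 2 * N * g x.
  apply/funext => x; rewrite /g mulrA divff ?mul1r; last by rewrite mulf_neq0// gt_eqF.
  by rewrite addrC addrK.
apply: Clin => //; [exact: bmeas_cst|exact: Ccst|].
apply: key => // x; have := hN x; rewrite ler_norml => /andP[h1 h2].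
have h3 : 0 <= h x + N by lra.
have h4 : h x + N <= 2 * N by lra.
apply/andP; split; first by rewrite /g mulr_ge0 ?invr_ge0// mulr_ge0// ltW.
by rewrite /g ler_pdivrMl ?mulr_gt0// mulr1.
Unshelve. all: by end_near. Qed.

End BmeasInd.

Section L1dense.
Variables (R : realType) (T : pseudoPMetricType R) (mu : Pmeas R T).

Let approximable (h : T -> R) : Prop :=
  forall e : R, 0 < e -> exists l, bcont l /\ Ex mu (fun x => `|h x - l x|) <= e.

Local Lemma bd (f g : T -> R) : bmeas f -> bmeas g -> bmeas (fun x => `|f x - g x|).
Proof. by move=> bf bg; exact/bmeas_norm/bmeasB. Qed.

Local Lemma approximable_lim (F : nat -> T -> R) h (M : R) : (forall n, bmeas (F n)) ->
  (forall n x, `|F n x| <= M) -> (forall x, F n x @[n --> \oo] --> h x) ->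
  (forall n, approximable (F n)) -> approximable h.
Proof.
move=> bF FM cF aF e e0; have e2 : 0 < e / 2 by rewrite divr_gt0.
have [bh _] := Ex_cvg mu bF FM cF.
have [||_ c] := @Ex_cvg _ _ mu (fun n x => `|h x - F n x|) (fun=> 0) (M + M) (fun n => bd bh (bF n)).
- move=> n x; rewrite normr_id (le_trans (ler_normB _ _))// lerD//.
  by apply: (cvgr_to_le (cvg_norm (cF x))); exact: nearW.
- move=> x; rewrite -[X in _ --> X](normr0 R) -(subrr (h x)); apply: cvg_norm.
  by apply: cvgB => //; exact: cvg_cst.
rewrite Ex_cst in c.
have [N _ hN] := cvgr_le _ c _ e2.
have [l [bl hl]] := aF N _ e2.
exists l; split=> //; have bl' := bcont_bmeas bl.
apply: (@le_trans _ _ (Ex mu (fun x => `|h x - F N x| + `|F N x - l x|))).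
  apply: Ex_le; [exact: bd|by apply: bmeasD; exact: bd|].
  by move=> x; exact: ler_distD.
rewrite ExD; [|exact: bd..].
have := hN N (leqnn N); rewrite /=; lra.
Qed.

Local Lemma approximable_lin (F G : T -> R) (c : R) : bmeas F -> bmeas G -> approximable F ->
  approximable G -> approximable (fun x => F x + c * G x).
Proof.
move=> bF bG aF aG e e0; have e2 : 0 < e / 2 by rewrite divr_gt0.
have c0 : 0 < `|c| + 1 by rewrite ltr_wpDl.
have e3 : 0 < e / 2 / (`|c| + 1) by rewrite divr_gt0.
have [l [bl hl]] := aF _ e2; have [k [bk hk]] := aG _ e3.
exists (fun x => l x + c * k x); split; first by apply: bcontD => //; exact: bcontZ.
have bl' := bcont_bmeas bl; have bk' := bcont_bmeas bk.
apply: (@le_trans _ _ (Ex mu (fun x => `|F x - l x| + (`|c| + 1) * `|G x - k x|))).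
  apply: Ex_le.
  - by apply: bd; [apply: bmeasD => //; exact: bmeasZ|apply: bmeasD => //; exact: bmeasZ].
  - by apply: bmeasD; [exact: bd|apply: bmeasZ; exact: bd].
  - move=> x; rewrite opprD addrACA -mulrBr (le_trans (ler_normD _ _))// lerD2l normrM.
    by rewrite ler_wpM2r// lerDl.
rewrite ExD; [|exact: bd|by apply: bmeasZ; exact: bd].
rewrite ExZ; last exact: bd.
have : (`|c| + 1) * Ex mu (fun x => `|G x - k x|) <= (`|c| + 1) * (e / 2 / (`|c| + 1)).
  by rewrite ler_wpM2l// ltW.
rewrite mulrCA divff ?gt_eqF// mulr1; lra.
Qed.

Local Lemma approximable_bcont f : bcont f -> approximable f.
Proof.
move=> bf e e0; exists f; split=> //.
rewrite (_ : (fun x => _) = fun=> 0) ?Ex_cst ?ltW//.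
by apply/funext => x; rewrite subrr normr0.
Qed.

(** The sets with approximable indicator contain the open sets and form a sigma-algebra: the minimum
    of two approximants serves an intersection, since the minimum moves by at most the sum of the
    two errors, and countable unions are complements of decreasing limits. *)
Local Lemma approximable_indic (A : set T) : measurable (A : set (borel T)) ->
  approximable (\1_A : T -> R).
Proof.
move=> mA.
suff [] : measurable (A : set (borel T)) /\ approximable (\1_A : T -> R) by [].
pose D := [set B : set T | measurable (B : set (borel T)) /\ approximable (\1_B : T -> R)].
suff : <<s @open T >> `<=` D by apply.
have DC B : D B -> D (~` B).
  move=> [mB aB]; split; first exact: (@measurableC _ (borel T)).
  rewrite (_ : \1_(~` B) = fun x => 1 + -1 * (\1_B x : R)).
    apply: approximable_lin => //; [exact: bmeas_cst|exact: bmeas_indic|].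
    exact/approximable_bcont/bcont_cst.
  by apply/funext => x; rewrite !indicE in_setC mulN1r; case: (x \in B); rewrite ?subrr ?subr0.
have D0 : D set0.
  split; first exact: measurable0.
  rewrite indic0; exact/approximable_bcont/bcont_cst.
have DI B C : D B -> D C -> D (B `&` C).
  move=> [mB aB] [mC aC]; split; first exact: (@measurableI _ (borel T)).
  move=> e e0; have e2 : 0 < e / 2 by rewrite divr_gt0.
  have [l [bl hl]] := aB _ e2; have [k [bk hk]] := aC _ e2.
  exists (fun x => Num.min (l x) (k x)); split; first exact: bcont_min.
  have bl' := bcont_bmeas bl; have bk' := bcont_bmeas bk.
  have bB := bmeas_indic R mB; have bC := bmeas_indic R mC.
  have bBC := bmeas_indic R (@measurableI _ (borel T) _ _ mB mC).
  apply: (@le_trans _ _ (Ex mu (fun x => `|\1_B x - l x| + `|\1_C x - k x|))).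
    apply: Ex_le; [by apply: bd => //; exact: bmeas_min|by apply: bmeasD; exact: bd|].
    move=> x; rewrite (_ : \1_(B `&` C) x = Num.min (\1_B x : R) (\1_C x)).
      move: (\1_B x : R) (\1_C x : R) (l x) (k x) => a b c d.
      have := ler_norm (a - c); have := ler_norm (c - a); rewrite (distrC c a).
      have := ler_norm (b - d); have := ler_norm (d - b); rewrite (distrC d b).
      by rewrite ler_norml; case: (leP a b) => ?; case: (leP c d) => ? *; lra.
    rewrite !indicE in_setI; case: (x \in B); case: (x \in C) => /=; symmetry.
    - exact/min_idPl.
    - by apply/min_idPr; rewrite ler01.
    - by apply/min_idPl; rewrite ler01.
    - exact/min_idPl.
  by rewrite ExD; [lra|exact: bd..].
apply: smallest_sub; last first.
  move=> B oB; split; first exact: sub_sigma_algebra.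
  have [h [h1 h2 h3 _]] := Ex_open_cvg mu oB.
  apply: (@approximable_lim h _ 1) => //.
  - by move=> n; exact: bcont_bmeas.
  - by move=> n x; have /andP[h0 h1'] := h2 n x; rewrite ger0_norm.
  - by move=> n; exact: approximable_bcont.
split=> //; first by move=> B DB; rewrite setTD; exact: DC.
move=> F DF.
have DN n : D (\bigcap_(i < n) ~` F i).
  elim: n => [|n ih].
    by rewrite bigcap_mkord big_ord0 -setC0; exact: DC.
  rewrite (_ : \bigcap_(i < n.+1) ~` F i = (\bigcap_(i < n) ~` F i) `&` ~` F n).
    by apply: DI => //; exact: DC.
  apply/seteqP; split=> [x h|x [h1 h2] i /=].
    by split=> [i /= it|]; apply: h => //=; exact: leqW.
  by rewrite ltnS leq_eqVlt => /orP[/eqP->//|]; exact: h1.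
rewrite -[X in D X]setCK; apply: (DC _ _); rewrite setC_bigcup.
split.
  by apply: (@bigcapT_measurable _ (borel T)) => n; exact: (DC _ (DF n)).1.
apply: (@approximable_lim (fun n => \1_(\bigcap_(i < n) ~` F i) : T -> R) _ 1).
- by move=> n; apply: bmeas_indic; exact: (DN n).1.
- by move=> n x; rewrite indicE; case: (_ \in _) => /=; rewrite ?normr1 ?normr0.
- move=> x; apply: cvg_near_cst; have [h|] := pselect ((\bigcap_i ~` F i) x).
    by apply: nearW => n; rewrite !indicE !mem_set// => i _; exact: h.
  move=> h; have [i Fi] : exists i, F i x.
    by apply: contrapT => /forallNP nF; apply: h => i _; exact: nF.
  near=> n; rewrite !indicE !memNset// => /(_ i); apply => //=.
  by near: n; exact: nbhs_infty_gt.
- by move=> n; exact: (DN n).2.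
Unshelve. all: by end_near. Qed.

(** Used to make two kinds of merely measurable functions continuous: the upper limits [lam g] and
    the Radon-Nikodym densities of a coupling. *)
Lemma bcont_L1_dense (h : T -> R) : bmeas h -> forall e : R, 0 < e ->
  exists l, bcont l /\ Ex mu (fun x => `|h x - l x|) <= e.
Proof.
apply: (@bmeas_ind R T approximable).
- exact: approximable_indic.
- exact: approximable_lin.
- exact: approximable_lim.
Qed.

End L1dense.

Section DenseSeq.
Variables (R : realType) (T : pseudoPMetricType R).

Lemma separable_dense_seq : separable_space T -> exists d : nat -> T,
  forall x (e : R), 0 < e -> exists i, ball (d i) e x.
Proof.
move=> [D [/pcard_injP[f finj] clD]].
(* Integers that code no point of [D] get the default [point], which does not harm density. *)
exists (fun n => xget point [set x | D x /\ f x = n]) => x e e0.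
have : closure D x by rewrite clD.
move=> /(_ (ball x e) (nbhsx_ballx _ _ e0)) [y [Dy xy]].
exists (f y); case: xgetP => [z _ [Dz fz]|/(_ y)[]//].
by rewrite (_ : z = y); [exact: ball_sym|apply: finj => //; exact: mem_set].
Qed.

End DenseSeq.

(** * Large deviations and admissible tests *)

Section Elimsup.
Variable (R : realType).
Implicit Types (u : nat -> \bar R) (c : \bar R).

Lemma esup_le u c : (\forall n \near \oo, (u n <= c)%E) -> (limn_esup u <= c)%E.
Proof.
move=> h; rewrite /limn_esup limf_esupE.
apply: (@le_trans _ _ (ereal_sup (u @` [set n | (u n <= c)%E]))).
  by apply: ereal_inf_lbound; exists [set n | (u n <= c)%E].
by apply: ge_ereal_sup => _ [n /= hn <-].
Qed.

Lemma esup_near u c : (limn_esup u < c)%E -> \forall n \near \oo, (u n < c)%E.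
Proof.
rewrite /limn_esup limf_esupE => /ereal_inf_lt[_ [V hV <-] h].
apply: filterS hV => n Vn; apply: le_lt_trans h.
by apply: ereal_sup_ubound; exists n.
Qed.

Lemma einf_ge u c : (\forall n \near \oo, (c <= u n)%E) -> (c <= limn_einf u)%E.
Proof.
move=> h; rewrite /limn_einf leeNr; apply: esup_le.
by apply: filterS h => n; rewrite leeN2.
Qed.

Lemma einf_near u c : (c < limn_einf u)%E -> \forall n \near \oo, (c < u n)%E.
Proof.
rewrite /limn_einf lteNr => /esup_near; apply: filterS => n.
by rewrite lteN2.
Qed.

Lemma le_esup u v : (\forall n \near \oo, (u n <= v n)%E) -> (limn_esup u <= limn_esup v)%E.
Proof.
move=> h; rewrite [leRHS]/limn_esup limf_esupE; apply: le_ereal_inf_tmp => _ [V hV <-].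
apply: esup_le; apply: filterS (filterI h hV) => n [uv Vn].
by apply: (le_trans uv); apply: ereal_sup_ubound; exists n.
Qed.

Lemma elog_gt (p : \bar R) (k : nat) (b : R) : (0 <= p)%E -> (p <= 1)%E ->
  (b%:E < ((k.+1%:R)^-1)%:E * elog p)%E -> expR (k.+1%:R * b) <= fine p.
Proof.
case: p => [p| |]// p0 p1; rewrite /elog /=; case: ifP => [pp|_].
  rewrite -EFinM lte_fin ltr_pdivlMl// => h.
  by rewrite -[leRHS]lnK ?posrE// ler_expR ltW.
by rewrite gt0_muleNy ?lte_fin ?invr_gt0// ltNge leNye.
Qed.

Lemma elog_lt (p : \bar R) (k : nat) (b : R) : (0 <= p)%E -> (p <= 1)%E ->
  (((k.+1%:R)^-1)%:E * elog p < b%:E)%E -> fine p <= expR (k.+1%:R * b).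
Proof.
case: p => [p| |]// p0 p1; rewrite /elog /=; case: ifP => [pp|/negbT].
  rewrite -EFinM lte_fin ltr_pdivrMl// => h.
  by rewrite -[leLHS]lnK ?posrE// ler_expR ltW.
by rewrite -leNgt => h _; rewrite (le_trans h)// expR_ge0.
Qed.

Lemma elog_le (p : \bar R) (m : nat) (b : R) : (0 <= p)%E -> (p <= 1)%E -> (0 < m)%N ->
  fine p <= expR (m%:R * b) -> (((m%:R)^-1)%:E * elog p <= b%:E)%E.
Proof.
case: p => [p| |]// p0 p1 m0 /=; case: ifP => [pp|/negbT _ _].
  rewrite -EFinM lee_fin ler_pdivrMl ?ltr0n// => h.
  by rewrite -ler_expR lnK ?posrE.
by rewrite gt0_muleNy ?lte_fin ?invr_gt0 ?ltr0n// leNye.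
Qed.

Lemma elog_ge (p : \bar R) (m : nat) (b : R) : (0 <= p)%E -> (p <= 1)%E -> (0 < m)%N ->
  expR (m%:R * b) <= fine p -> (b%:E <= ((m%:R)^-1)%:E * elog p)%E.
Proof.
case: p => [p| |]// p0 p1 m0 /= h.
have pp : 0 < p by apply: lt_le_trans h; exact: expR_gt0.
by rewrite pp -EFinM lee_fin ler_pdivlMl ?ltr0n// -ler_expR lnK ?posrE.
Qed.

End Elimsup.

Section Ldp.
Variables (R : realType) (X : ptopologicalType) (P : nat -> Pmeas R X) (J : X -> \bar R).
Hypothesis ldp : kLDP P J.

Let P01 k (A : set X) : measurable (A : set (borel X)) -> (0 <= P k A)%E /\ (P k A <= 1)%E.
Proof.
move=> mA; split; first exact: (measure_ge0 (P k) A).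
exact: (probability_le1 (P k) mA).
Qed.

Lemma ldp_open (U : set X) x (j e : R) : open U -> U x -> (J x <= j%:E)%E -> 0 < e ->
  \forall k \near \oo, expR (k.+1%:R * (- j - e)) <= fine (P k.+1 U).
Proof.
move=> oU Ux Jx e0; have mU : measurable (U : set (borel X)) by exact: sub_sigma_algebra.
have [_ /(_ U mU)/= [lo _]] := ldp.
have : ((- j - e)%:E < limn_einf (fun k : nat => ((k.+1%:R)^-1)%:E * elog (P k.+1 U)))%E.
  apply: lt_le_trans lo; rewrite lteNr -EFinN; apply: (@le_lt_trans _ _ j%:E).
    apply: le_trans Jx; apply: ereal_inf_lbound; exists x => //.
    exact: open_nbhs_nbhs.
  by rewrite lte_fin; lra.
move=> /einf_near; apply: filterS => k.
by apply: elog_gt; have [] := P01 k.+1 mU.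
Qed.

Lemma ldp_closed (D : set X) (b e : R) : closed D -> (forall x, D x -> (b%:E <= J x)%E) -> 0 < e ->
  \forall k \near \oo, fine (P k.+1 D) <= expR (k.+1%:R * (- b + e)).
Proof.
move=> cD Jx e0.
have mD : measurable (D : set (borel X)).
  rewrite -[D]setCK; apply: (@measurableC _ (borel X)).
  by apply: sub_sigma_algebra; exact: closed_openC.
have [_ /(_ D mD)/= [_ [_ up]]] := ldp.
have : (limn_esup (fun k : nat => ((k.+1%:R)^-1)%:E * elog (P k.+1 D)) < (- b + e)%:E)%E.
  apply: (le_lt_trans up); rewrite lteNl -EFinN; apply: (@lt_le_trans _ _ b%:E).
    by rewrite lte_fin; lra.
  apply: le_ereal_inf_tmp => _ [x + <-]; rewrite -(closure_id D).1//; exact: Jx.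
move=> /esup_near; apply: filterS => k.
by apply: elog_lt; have [] := P01 k.+1 mD.
Qed.

End Ldp.

(** * Log-Laplace transforms and their upper limits *)

Section LogLaplace.
Variables (R : realType) (X : ptopologicalType).
Implicit Types (q : Pmeas R X) (g : X -> R).

Definition llap q (k : nat) g : R :=
  (k.+1%:R)^-1 * ln (Ex q (fun x => expR (k.+1%:R * g x))).

Lemma bcont_exp (c : R) g : bcont g -> bcont (fun x => expR (c * g x)).
Proof.
move=> bg; have bc := bcontZ c bg; split.
  by move=> x; apply: continuous_comp; [exact: bc.1|exact: continuous_expR].
have [M hM] := bc.2; exists (expR M) => x.
by rewrite ger0_norm ?expR_ge0// ler_expR (le_trans (ler_norm _)).
Qed.

Lemma bmeas_exp (c : R) g : bmeas g -> bmeas (fun x => expR (c * g x)).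
Proof.
move=> bg; have bc := bmeasZ c bg; split.
  by apply: (@measurableT_comp _ _ _ (borel X) R R expR); [exact: measurable_expR|exact: bc.1].
have [M hM] := bc.2; exists (expR M) => x.
by rewrite ger0_norm ?expR_ge0// ler_expR (le_trans (ler_norm _)).
Qed.

Lemma Ex_exp_bnd q (k : nat) g (M : R) : bmeas g -> (forall x, `|g x| <= M) ->
  expR (k.+1%:R * - M) <= Ex q (fun x => expR (k.+1%:R * g x)) <= expR (k.+1%:R * M).
Proof.
move=> bg gM; rewrite -[X in X <= _ <= _](Ex_cst q) -[X in _ <= _ <= X](Ex_cst q).
have bc c : bmeas (fun _ : X => expR c) by exact: bmeas_cst.
have be := bmeas_exp k.+1%:R bg.
apply/andP; split; apply: Ex_le => // x; rewrite ler_expR ler_wpM2l//.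
  by have := gM x; rewrite ler_norml => /andP[].
by rewrite (le_trans (ler_norm _)).
Qed.

Lemma Ex_exp_gt0 q (k : nat) g : bmeas g -> 0 < Ex q (fun x => expR (k.+1%:R * g x)).
Proof.
move=> bg; have [M gM] := bg.2.
have /andP[h _] := Ex_exp_bnd q k bg gM.
by apply: lt_le_trans h; exact: expR_gt0.
Qed.

Lemma llapE q k g : bmeas g ->
  Ex q (fun x => expR (k.+1%:R * g x)) = expR (k.+1%:R * llap q k g).
Proof.
move=> bg; rewrite /llap mulrA divff ?mul1r ?pnatr_eq0// lnK// posrE.
exact: Ex_exp_gt0.
Qed.

Lemma llap_bnd q k g (M : R) : bmeas g -> (forall x, `|g x| <= M) -> `|llap q k g| <= M.
Proof.
move=> bg gM; have := Ex_exp_bnd q k bg gM; rewrite llapE// !ler_expR.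
by rewrite !ler_pM2l// ler_norml.
Qed.

End LogLaplace.

Section Tests.
Variables (R : realType) (Z X : ptopologicalType).
Variables (P : nat -> Z -> Pmeas R X) (J : Z -> X -> \bar R).
Hypothesis Hfeller : forall k : nat, (0 < k)%N -> feller (P k).
Hypothesis HLDP : forall z0 : Z, kLDP (fun k => P k z0) (J z0).

Definition lam (g : X -> R) (z : Z) : R := rlimsup (fun k => llap (P k.+1 z) k g).

Lemma llap_continuous k g : bcont g -> continuous (fun z => llap (P k.+1 z) k g).
Proof.
move=> bg z; apply: cvgM; first exact: cvg_cst.
have c1 : continuous (fun z => Ex (P k.+1 z) (fun x => expR (k.+1%:R * g x))).
  exact: (Hfeller (ltn0Sn k) (bcont_exp _ bg)).
have c2 := continuous_ln (Ex_exp_gt0 (P k.+1 z) k (bcont_bmeas bg)).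
exact: (cvg_comp _ _ (c1 z) c2).
Qed.

Lemma bmeas_lam g : bcont g -> bmeas (lam g).
Proof.
move=> bg; have [M gM] := bg.2; apply: (@bmeas_rlimsup _ _ _ M).
  move=> n; apply: bcont_bmeas; split; first exact: llap_continuous.
  by exists M => z; apply: llap_bnd => //; exact: bcont_bmeas.
by move=> n z; apply: llap_bnd => //; exact: bcont_bmeas.
Qed.

Lemma lam_bnd g (M : R) z : bcont g -> (forall x, `|g x| <= M) -> `|lam g z| <= M.
Proof.
by move=> bg gM; apply: rlimsup_bnd => n; apply: llap_bnd => //; exact: bcont_bmeas.
Qed.

(** Lower half of Varadhan's lemma: the Laplace integral is at least exp(k (g x - e / 2)) times the
    probability of the open set where g exceeds g x - e / 2, and the LDP bounds this probability
    below by exp(- k (J z x + e / 2)). *)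
Lemma lam_lower g z x : bcont g -> ((g x - lam g z)%:E <= J z x)%E.
Proof.
move=> bg; have [M gM] := bg.2.
have J0 : (0 <= J z x)%E by have [[+ _] _] := HLDP z; apply.
case Jx : (J z x) J0 => [j| |]// _; last exact: leey.
rewrite lee_fin lerBlDl -lerBlDr; apply/ler_addgt0Pr => e e0.
have e2 : 0 < e / 2 by rewrite divr_gt0.
rewrite -lerBlDr; apply: (@rlimsup_ge _ _ M).
  by move=> n; apply: llap_bnd => //; exact: bcont_bmeas.
pose U := [set y | g x - e / 2 < g y].
have oU : open U.
  apply: (@open_comp _ _ g [set y : R | g x - e / 2 < y]); last exact: open_gt.
  by move=> y _; exact: bg.1.
have Ux : U x by rewrite /U /=; lra.
have mU : measurable (U : set (borel X)) by exact: sub_sigma_algebra.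
have Jj : (J z x <= j%:E)%E by rewrite Jx.
apply: filterS (ldp_open (HLDP z) oU Ux Jj e2) => k hk.
have h2 : expR (k.+1%:R * (g x - e / 2)) * fine (P k.+1 z U) <=
    Ex (P k.+1 z) (fun x => expR (k.+1%:R * g x)).
  rewrite -(Ex_indic _ mU) -ExZ; last exact: bmeas_indic.
  apply: Ex_le; first by apply: bmeasZ; exact: bmeas_indic.
    by apply: bmeas_exp; exact: bcont_bmeas.
  move=> y; rewrite indicE; case: (boolP (y \in U)) => /= [|_]; last by rewrite mulr0 expR_ge0.
  by rewrite inE /U /= mulr1 => h; rewrite ler_expR ler_pM2l// ltW.
have := le_trans _ h2; move=> /(_ _ (ler_wpM2l (expR_ge0 _) hk)).
rewrite -expRD llapE ?ler_expR -?mulrDr ?ler_pM2l//; last exact: bcont_bmeas.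
by apply: le_trans; lra.
Qed.

(** The Laplace integral is at most 1 + exp(k c) P(D), with P(D) at most about exp(- k b). The
    factor 2 from bounding this sum costs ln 2 / k, absorbed in e / 2. The case of interest is c <=
    b, where [lam g z] is at most 0. *)
Lemma lam_upper g (D : set X) (b c : R) z : bcont g -> closed D ->
  (forall x, 0 <= g x <= c) -> (forall x, ~ D x -> g x = 0) ->
  (forall x, D x -> (b%:E <= J z x)%E) -> 0 <= c -> lam g z <= Num.max 0 (c - b).
Proof.
move=> bg cD g0c gD Jb c0; set m := Num.max 0 (c - b).
have [M gM] := bg.2; have bg' := bcont_bmeas bg.
apply/ler_addgt0Pr => e e0; have e2 : 0 < e / 2 by rewrite divr_gt0.
have mD : measurable (D : set (borel X)).
  rewrite -[D]setCK; apply: (@measurableC _ (borel X)).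
  by apply: sub_sigma_algebra; exact: closed_openC.
apply: (@rlimsup_le _ _ M); first by move=> n; apply: llap_bnd.
near=> k.
have hk : fine (P k.+1 z D) <= expR (k.+1%:R * (- b + e / 2)).
  by near: k; exact: (ldp_closed (HLDP z) cD Jb e2).
have hk2 : ln 2 <= k.+1%:R * (e / 2).
  rewrite -ler_pdivrMr//; apply: (@le_trans _ _ k%:R); last by rewrite ler_nat.
  by near: k; exact: nbhs_infty_ger.
have bI := bmeas_indic R mD.
have h1 : Ex (P k.+1 z) (fun x => expR (k.+1%:R * g x)) <=
    1 + expR (k.+1%:R * c) * fine (P k.+1 z D).
  rewrite -(Ex_indic _ mD) -ExZ// -[X in X + _](Ex_cst (P k.+1 z)) -ExD; last 2 first.
  - exact: bmeas_cst.
  - exact: bmeasZ.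
  apply: Ex_le; first exact: bmeas_exp.
    by apply: bmeasD; [exact: bmeas_cst|exact: bmeasZ].
  move=> x; rewrite indicE; case: (boolP (x \in D)) => /= [_|].
    rewrite mulr1 ler_wpDl// ler_expR ler_pM2l//.
    by have /andP[] := g0c x.
  by rewrite notin_setE => /gD ->; rewrite !mulr0 addr0 expR0.
have h2 : 1 + expR (k.+1%:R * c) * fine (P k.+1 z D) <= 2 * expR (k.+1%:R * (m + e / 2)).
  have h3 : 1 <= expR (k.+1%:R * (m + e / 2)).
    have m0 : 0 <= m by rewrite le_max lexx.
    by rewrite -[leLHS]expR0 ler_expR; apply: mulr_ge0 => //; lra.
  have h4 : expR (k.+1%:R * c) * fine (P k.+1 z D) <= expR (k.+1%:R * (m + e / 2)).
    rewrite (le_trans (ler_wpM2l (expR_ge0 _) hk))// -expRD ler_expR -mulrDr ler_pM2l//.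
    by rewrite addrA lerD2r le_max lexx orbT.
  lra.
have e2E : 2 = expR (ln 2) :> R by rewrite lnK// posrE.
have := le_trans h1 h2; rewrite llapE// [X in _ <= X * _]e2E -expRD ler_expR => h5.
rewrite -(@ler_pM2l _ k.+1%:R)// (le_trans h5)//.
have -> : k.+1%:R * (m + e) = k.+1%:R * (e / 2) + k.+1%:R * (m + e / 2) by field.
by rewrite lerD2r.
Unshelve. all: by end_near. Qed.

Lemma lam0 z : lam (fun=> 0) z = 0.
Proof.
apply/eqP; rewrite -normr_le0; apply: lam_bnd; first exact: bcont_cst.
by move=> x; rewrite normr0.
Qed.

(* [F(z, .) - L z] minorizes [J z], and the scaled log-Laplace transforms of [F(z, .)] are controlled by [L]: such a pair
   provides both a half-space containing the sublevel sets of the rate and an exponential estimate for its complement. *)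
Definition admissible (F : Z * X -> R) (L : Z -> R) : Prop :=
  [/\ bcont (F : (Z * X)%type -> R), bmeas L, forall z x, ((F (z, x) - L z)%:E <= J z x)%E &
   exists (H : nat -> Z -> R) (C : R),
   [/\ forall k z, `|H k z| <= C, forall k, continuous (H k),
      forall k z, Ex (P k.+1 z) (fun x => expR (k.+1%:R * F (z, x))) <= expR (k.+1%:R * H k z) &
      forall z (e : R), 0 < e -> \forall k \near \oo, H k z <= L z + e]].

Lemma bcont_fst (l : Z -> R) : bcont l -> bcont (fun p : Z * X => l p.1 : R).
Proof. by apply: bcont_comp => p; exact: cvg_fst. Qed.

Lemma bcont_snd (g : X -> R) : bcont g -> bcont (fun p : Z * X => g p.2 : R).
Proof. by apply: bcont_comp => p; exact: cvg_snd. Qed.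

Lemma bcont_section (F : Z * X -> R) z : bcont (F : (Z * X)%type -> R) ->
  bcont (fun x => F (z, x)).
Proof.
apply: (@bcont_comp R X (Z * X)%type (fun x => (z, x))) => x.
by apply: cvg_pair => /=; [exact: cvg_cst|exact: cvg_id].
Qed.

(** The shift by [l] cancels in [F] minus [L]. Taken close to [lam g], it makes [L] small in L1(mu);
    combined with g = 0, it tests the marginal on [Z] alone. *)
Lemma admissible_base g l : bcont g -> bcont l ->
  admissible (fun p => g p.2 - l p.1) (fun z => lam g z - l z).
Proof.
move=> bg bl; have [M gM] := bg.2; have [N lN] := bl.2; have bg' := bcont_bmeas bg.
split.
- by apply: bcontB; [exact: bcont_snd|exact: bcont_fst].
- by apply: bmeasB; [exact: bmeas_lam|exact: bcont_bmeas].
- by move=> z x /=; rewrite opprB addrA subrK; exact: lam_lower.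
exists (fun k z => llap (P k.+1 z) k g - l z), (M + N); split.
- by move=> k z; rewrite (le_trans (ler_normB _ _))// lerD// llap_bnd.
- by move=> k z; apply: cvgB; [exact: llap_continuous|exact: bl.1].
- move=> k z /=; rewrite mulrBr expRD -llapE// mulrC -ExZ; last exact: bmeas_exp.
  rewrite le_eqVlt; apply/orP; left; apply/eqP; congr Ex; apply/funext => x.
  by rewrite -expRD mulrBr addrC.
- move=> z e e0.
  have := @rlimsup_near _ (fun k => llap (P k.+1 z) k g) M e _ e0.
  move=> /(_ (fun n => llap_bnd _ _ bg' gM)); apply: filterS => k; rewrite -/(lam g z); lra.
Qed.

(** The exponential of a maximum is at most the sum of the exponentials, hence the extra ln 2 / (k +
    1) in the new bound, which vanishes in the limit. *)
Lemma admissible_max F L F' L' : admissible F L -> admissible F' L' ->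
  admissible (fun p => Num.max (F p) (F' p)) (fun z => Num.max (L z) (L' z)).
Proof.
move=> [bF bL FL [H [C [HC cH EH HL]]]] [bF' bL' FL' [H' [C' [HC' cH' EH' HL']]]].
have Fmax (a b c d : R) (j : \bar R) : ((a - c)%:E <= j)%E -> ((b - d)%:E <= j)%E ->
    ((Num.max a b - Num.max c d)%:E <= j)%E.
  move=> h1 h2; case: (leP a b) => hab; [apply: le_trans h2|apply: le_trans h1].
    by rewrite lee_fin lerD2l lerN2 le_max lexx orbT.
  by rewrite lee_fin lerD2l lerN2 le_max lexx.
split; [exact: bcont_max|exact: bmeas_max|by move=> z x; exact: Fmax|].
have ln2 : 0 <= ln 2 :> R by rewrite ln_ge0// ler1n.
exists (fun k z => Num.max (H k z) (H' k z) + (k.+1%:R)^-1 * ln 2), (Num.max C C' + ln 2); split.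
- move=> k z; rewrite (le_trans (ler_normD _ _))// lerD//.
    rewrite le_max; case: (leP (H k z) (H' k z)) => _; first by rewrite HC' orbT.
    by rewrite HC.
  by rewrite ger0_norm ?mulr_ge0// ler_piMl// invf_le1// ler1n.
- move=> k z; apply: cvgD; last exact: cvg_cst.
  by apply: (@continuous_max _ _ (H k) (H' k)); [exact: cH|exact: cH'].
- move=> k z.
  have b1 := bcont_bmeas (bcont_exp k.+1%:R (bcont_section z bF)).
  have b2 := bcont_bmeas (bcont_exp k.+1%:R (bcont_section z bF')).
  apply: (@le_trans _ _ (Ex (P k.+1 z) (fun x => expR (k.+1%:R * F (z, x)) + expR (k.+1%:R * F' (z, x))))).
    apply: Ex_le; [|exact: bmeasD|].
      by apply: bmeas_exp; apply: bmeas_max; apply: bcont_bmeas; exact: bcont_section.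
    move=> x; case: (leP (F (z, x)) (F' (z, x))) => _.
      by rewrite lerDr expR_ge0.
    by rewrite lerDl expR_ge0.
  rewrite ExD// mulrDr mulrA divff ?pnatr_eq0// mul1r expRD lnK ?posrE//.
  rewrite mulrDr mulr1 lerD//.
    by rewrite (le_trans (EH k z))// ler_expR ler_pM2l// le_max lexx.
  by rewrite (le_trans (EH' k z))// ler_expR ler_pM2l// le_max lexx orbT.
- move=> z e e0; have e2 : 0 < e / 2 by rewrite divr_gt0.
  near=> k.
  have h1 : H k z <= L z + e / 2 by near: k; exact: HL.
  have h2 : H' k z <= L' z + e / 2 by near: k; exact: HL'.
  have h3 : (k.+1%:R)^-1 * ln 2 <= e / 2.
    rewrite ler_pdivrMl// -ler_pdivrMr//; apply: (@le_trans _ _ k%:R); last by rewrite ler_nat.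
    by near: k; exact: nbhs_infty_ger.
  have h4 : Num.max (H k z) (H' k z) <= Num.max (L z) (L' z) + e / 2.
    rewrite ge_max; apply/andP; split.
      by rewrite (le_trans h1)// lerD2r le_max lexx.
    by rewrite (le_trans h2)// lerD2r le_max lexx orbT.
  by apply: (le_trans (lerD h4 h3)); rewrite -addrA -splitr.
Unshelve. all: by end_near. Qed.

End Tests.

(** * The rate function as a supremum of tests *)

Section Marginal.
Variables (R : realType) (T U : ptopologicalType) (q : Pmeas R T) (phi : T -> U).
Hypothesis cphi : continuous phi.

Definition marginal_measure (A : set (borel U)) : \bar R := q (phi @^-1` A).

Let pre_measurable (A : set (borel U)) : measurable A ->
  measurable (phi @^-1` A : set (borel T)).
Proof. by move=> mA; rewrite -[X in measurable X]setTI; exact: (measurable_continuous cphi). Qed.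

Local Lemma marginal0 : marginal_measure set0 = 0%E.
Proof. by rewrite /marginal_measure preimage_set0; exact: (measure0 q). Qed.

Local Lemma marginal_ge0 A : (0 <= marginal_measure A)%E.
Proof. exact: (measure_ge0 q). Qed.

Local Lemma marginal_sadd : semi_sigma_additive marginal_measure.
Proof.
move=> F mF tF mUF; rewrite /marginal_measure preimage_bigcup.
apply: (@measure_semi_sigma_additive _ _ _ q (fun n => phi @^-1` F n)).
- by move=> n; exact: pre_measurable.
- apply/trivIsetP => /= i j _ _ ij; rewrite -preimage_setI.
  by move/trivIsetP : tF => /(_ _ _ _ _ ij) ->//; rewrite preimage_set0.
- by rewrite -preimage_bigcup; exact: pre_measurable.
Qed.

HB.instance Definition _ := isMeasure.Build _ (borel U) R marginal_measure
  marginal0 marginal_ge0 marginal_sadd.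

Local Lemma marginalT : marginal_measure setT = 1%E.
Proof. by rewrite /marginal_measure preimage_setT; exact: (probability_setT q). Qed.

HB.instance Definition _ := Measure_isProbability.Build _ (borel U) R marginal_measure
  marginalT.

Definition marginal : Pmeas R U := marginal_measure.

End Marginal.

Lemma marginal_determining (R : realType) (T : ptopologicalType) (U : pseudoPMetricType R)
    (q : Pmeas R T) (mu : Pmeas R U) (phi : T -> U) : continuous phi ->
  (forall f, bcont f -> Ex q (fun x => f (phi x)) = Ex mu f) ->
  forall A : set U, measurable (A : set (borel U)) -> q (phi @^-1` A) = mu A.
Proof.
move=> cphi h A mA.
apply: (@bcont_determining R U (marginal q cphi) mu _ A mA) => f bf.
by rewrite -h//; symmetry; apply: Ex_marginal => //; exact: bcont_bmeas.
Qed.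

Section CoverFun.
Variables (R : realType) (T : pseudoPMetricType R) (d : nat -> T) (r : R).
Hypotheses (r0 : 0 < r) (r1 : r <= 1).

Definition cover_set (N : nat) : set T := [set x | exists2 i, (i < N)%N & ball (d i) (r / 2) x].

(** A penalty for leaving a totally bounded set: the slope 2 / r makes it reach 1 between the balls
    of radius r / 2, where it vanishes, and the concentric balls of radius r. *)
Definition cover_fun (N : nat) (x : T) : R := Num.min 1 (2 / r * tdist (cover_set N) x).

Lemma cover_fun_bcont N : bcont (cover_fun N).
Proof. by apply: bcont_min; [exact: bcont_cst|exact/bcontZ/tdist_bcont]. Qed.

Lemma cover_fun01 N x : 0 <= cover_fun N x <= 1.
Proof.
rewrite le_min ler01 ge_min lexx/= andbT.
by rewrite mulr_ge0 ?tdist_ge0// divr_ge0// ltW.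
Qed.

Lemma cover_fun0 N x : cover_set N x -> cover_fun N x = 0.
Proof. by move=> h; rewrite /cover_fun tdist0// mulr0; apply/min_idPr. Qed.

Lemma cover_fun1 N x : (forall i, (i < N)%N -> ~ ball (d i) r x) -> cover_fun N x = 1.
Proof.
move=> h; apply/min_idPl; rewrite mulrC -ler_pdivrMr ?divr_gt0// mul1r invf_div.
apply: tdist_ge; first by rewrite (le_trans _ r1)// ler_pdivrMr// ler_peMr// ?ler1n// ltW.
move=> y [i iN iy] xy; apply: (h i iN); rewrite [r]splitr.
by apply: ball_triangle iy _; exact: ball_sym.
Qed.

Hypothesis dd : forall x (e : R), 0 < e -> exists i, ball (d i) e x.

Lemma cover_set_interior x : exists i, forall N, (i < N)%N -> interior (cover_set N) x.
Proof.
have r4 : 0 < r / 2 / 2 by rewrite !divr_gt0.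
have [i hi] := dd x r4; exists i => N iN.
apply/nbhs_ballP; exists (r / 2 / 2) => //= y xy; exists i => //.
rewrite [r / 2]splitr; exact: ball_triangle xy.
Qed.

Lemma cover_fun_cvg x : cover_fun N x @[N --> \oo] --> (0 : R).
Proof.
have [i hi] := cover_set_interior x; apply: cvg_near_cst; near=> N.
apply: cover_fun0; apply: interior_subset; apply: hi; near: N.
exact: nbhs_infty_gt.
Unshelve. all: by end_near. Qed.

Lemma cover_compact (K : set T) : compact K ->
  exists N0, forall N, (N0 <= N)%N -> K `<=` interior (cover_set N).
Proof.
rewrite compact_cover => cK.
have [||D _ hD] := cK nat setT (fun N => interior (cover_set N)).
- by move=> N _; exact: open_interior.
- by move=> x _; have [i hi] := cover_set_interior x; exists i.+1 => //; exact: hi.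
exists (\max_(i <- finmap.enum_fset D) i)%N => N hN x /hD[i iD].
apply: interiorS => y [j ji]; exists j => //.
rewrite (leq_trans ji)// (leq_trans _ hN)//.
exact: (@leq_bigmax_seq _ (finmap.enum_fset D) xpredT (fun i => i)).
Qed.

End CoverFun.

Section RateTests.
Variables (R : realType) (Z X : completePseudoMetricType R).
Hypotheses (sepZ : separable_space Z) (sepX : separable_space X).
Variable (mu : Pmeas R Z).
Variables (P : nat -> Z -> Pmeas R X) (J : Z -> X -> \bar R).
Hypothesis Hfeller : forall k : nat, (0 < k)%N -> feller (P k).
Hypothesis HLDP : forall z0 : Z, kLDP (fun k => P k z0) (J z0).
Implicit Types (q : Pmeas R (Z * X)%type).

Definition passes (a : R) q : Prop :=
  forall F L, admissible P J F L -> Ex q F <= a + Ex mu L.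

Local Lemma cfst : continuous (fst : (Z * X)%type -> Z).
Proof. by move=> p; exact: cvg_fst. Qed.

Local Lemma csnd : continuous (snd : (Z * X)%type -> X).
Proof. by move=> p; exact: cvg_snd. Qed.

Local Lemma J_ge0 z x : (0 <= J z x)%E.
Proof. by have [[+ _] _] := HLDP z; apply. Qed.

(** The family consists of bumps at dense points, with rational radii and heights. If b < c < J z x,
    closedness of the sublevel set keeps [J z] above c near x; a bump supported there with height t
    in [b, c] has [lam] at most 0 by [lam_upper], so its value t at x survives. The zero function
    settles b < 0 and makes running maxima nonnegative. *)
Lemma rate_sup_seq : exists g : nat -> X -> R, [/\ forall n, bcont (g n), g 0%N = (fun=> 0) &
  forall z x (b : R), (b%:E < J z x)%E -> exists n, b <= g n x - lam P (g n) z].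
Proof.
have [d dd] := separable_dense_seq sepX.
have m0 (m : nat) : 0 < m.+1%:R^-1 :> R by rewrite invr_gt0.
have [h hP] := choice (fun im : nat * nat => bump_exists (d im.1) (m0 im.2)).
pose G (c : nat * nat * nat * nat) x : R := let: (i, m, a, b) := c in
  a%:R / b.+1%:R * h (i, m) x.
pose g n := if n is n'.+1 then
  (if unpickle n' is Some c then G c else fun=> 0) else fun=> 0.
have bG c : bcont (G c).
  by case: c => [[[i m] a] b]; apply: bcontZ; have [] := hP (i, m).
exists g; split=> //.
  by case=> [|n] /=; [exact: bcont_cst|case: unpickle => [c|] //=; exact: bcont_cst].
move=> z x b bJ.
have [b0|b0] := ltP b 0.
  by exists 0%N; rewrite lam0// subr0 ltW.
have [c [bc cJ]] : exists c : R, b < c /\ (c%:E < J z x)%E.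
  move: bJ; have := J_ge0 z x; case: (J z x) => [j| |]//.
    by rewrite lte_fin => _ bj; exists ((b + j) / 2); rewrite lte_fin; split; lra.
  by move=> _ _; exists (b + 1); rewrite ltry; split=> //; lra.
have cl : closed [set y | (J z y <= c%:E)%E] by have [[_ /(_ c)[? ?]] _] := HLDP z.
have /nbhs_ballP[r /= r0 rJ] : nbhs x (~` [set y | (J z y <= c%:E)%E]).
  apply: open_nbhs_nbhs; split; first exact: closed_openC.
  by apply/negP; rewrite -ltNge.
(* Four radii: one from [x] to the centre, two across the support of the bump, one for its
   closure. *)
have [m hm] : exists m : nat, m.+1%:R^-1 < r / 4.
  exists (Num.truncn (r / 4)^-1); rewrite invf_plt ?posrE ?divr_gt0//; exact: truncnS_gt.
pose s : R := m.+1%:R^-1.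
have [i hi] := dd x s (m0 m).
have [bh h01 h1 h0] := hP (i, m); rewrite /= -/s in h1 h0.
have [N hN] : exists N : nat, N.+1%:R^-1 < c - b.
  exists (Num.truncn (c - b)^-1); rewrite invf_plt ?posrE ?subr_gt0//; exact: truncnS_gt.
(* The first multiple of 1 / (N + 1) beyond [b]; the mesh is below c - b, so it does not pass
   [c]. *)
pose a := (Num.truncn (b * N.+1%:R)).+1.
pose t : R := a%:R / N.+1%:R.
have bt : b <= t.
  by rewrite /t ler_pdivlMr// ltW//; exact: truncnS_gt.
have tc : t <= c.
  have : a%:R <= b * N.+1%:R + 1 by rewrite /a -natr1 lerD2r truncn_le// mulr_ge0.
  rewrite -(@ler_pM2r _ N.+1%:R^-1) ?invr_gt0// mulrDl -mulrA divff ?pnatr_eq0// mulr1 mul1r.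
  by move=> ht; apply: (le_trans ht); rewrite -lerBrDl ltW.
exists (pickle (i, m, a, N)).+1; rewrite /= pickleK /= -/t.
have t0 : 0 <= t by exact: le_trans bt.
pose D : set X := closure [set y | 0 < h (i, m) y].
have bth : bcont (fun x => t * h (i, m) x) by exact: bcontZ.
have up : lam P (fun x => t * h (i, m) x) z <= Num.max 0 (t - c).
  apply: (@lam_upper R Z X P J HLDP _ D c t z) => //.
  - exact: closed_closure.
  - by move=> y; have /andP[y0 y1] := h01 y; rewrite mulr_ge0// ler_piMr.
  - move=> y nD; have /andP[y0 y1] := h01 y.
    suff -> : h (i, m) y = 0 by rewrite mulr0.
    apply/eqP; rewrite eq_le y0 andbT leNgt; apply/negP => y2; apply: nD.
    exact: subset_closure.
  - move=> y Dy; rewrite leNgt; apply/negP => Jy.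
    have [w [hw yw]] := Dy _ (nbhsx_ballx y _ (m0 m)).
    apply: (rJ y); last exact: ltW.
    have dw := h0 _ hw; apply: (@le_ball _ _ x (s + (s + s) + s)).
      by move: hm; rewrite -/s; lra.
    apply: ball_triangle (ball_sym yw).
    by apply: ball_triangle dw; exact: ball_sym.
rewrite (max_idPl _) in up; last by rewrite subr_le0.
by rewrite (h1 x hi) mulr1; lra.
Qed.

Fixpoint maxseq (T : Type) (f : nat -> T -> R) (n : nat) (x : T) : R :=
  if n is n'.+1 then Num.max (maxseq f n' x) (f n x) else f 0%N x.

Lemma maxseq_ge (T : Type) (f : nat -> T -> R) n j x : (j <= n)%N -> f j x <= maxseq f n x.
Proof.
elim: n => [|n ih]; first by rewrite leqn0 => /eqP ->.
rewrite leq_eqVlt => /orP[/eqP ->|jn] /=; rewrite le_max ?lexx ?orbT//.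
by rewrite ih.
Qed.

Lemma maxseq_mono (T : Type) (f : nat -> T -> R) n m x : (n <= m)%N -> maxseq f n x <= maxseq f m x.
Proof.
elim: m => [|m ih]; first by rewrite leqn0 => /eqP ->.
rewrite leq_eqVlt => /orP[/eqP ->|nm] //=; rewrite le_max.
by rewrite ih.
Qed.

Lemma maxseq_bmeas (T : ptopologicalType) (f : nat -> T -> R) n : (forall j, bmeas (f j)) -> bmeas (maxseq f n).
Proof. by move=> h; elim: n => [|n ih] /=; [exact: h|exact: bmeas_max]. Qed.

Lemma maxseq_admissible F L n : (forall j, admissible P J (F j) (L j)) ->
  admissible P J (maxseq F n) (maxseq L n).
Proof. by move=> h; elim: n => [|n ih] /=; [exact: h|exact: admissible_max]. Qed.

(** The delicate clause is the last: [f j] contains the possibly discontinuous [lam P (g j)], so the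
    tests use continuous [l j] at L1(mu)-distance e / 2 / (n + 1). The total error [S] depends on
    [z] only, so its [q]-integral is its [mu]-integral; it is paid once through [L] and once through
    [F]. *)
Lemma rate_monotone_approx : exists M : nat -> Z * X -> R,
  [/\ forall n, bmeas (M n : (Z * X)%type -> R), forall n p, 0 <= M n p,
      forall n m p, (n <= m)%N -> M n p <= M m p,
      forall p, ((M n p)%:E @[n --> \oo] --> J p.1 p.2) &
      forall a q, (forall A : set Z, measurable (A : set (borel Z)) -> q (fst @^-1` A) = mu A) ->
        passes a q -> forall n, Ex q (M n) <= a].
Proof.
have [g [bg g0 gJ]] := rate_sup_seq.
pose f j (p : Z * X) := g j p.2 - lam P (g j) p.1.
have bl j := bmeas_lam Hfeller (bg j).
have bf j : bmeas (f j : (Z * X)%type -> R).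
  by apply: bmeasB; [exact: (bmeas_comp csnd (bcont_bmeas (bg j)))|exact: (bmeas_comp cfst (bl j))].
have fJ j p : ((f j p)%:E <= J p.1 p.2)%E by exact: lam_lower.
exists (maxseq f); split.
- by move=> n; exact: maxseq_bmeas.
- move=> n p; apply: le_trans (maxseq_ge f p (leq0n n)).
  by rewrite /f g0 lam0 subr0.
- by move=> n m p; exact: maxseq_mono.
- move=> p; have MJ n : ((maxseq f n p)%:E <= J p.1 p.2)%E.
    by elim: n => [|n ih] //=; rewrite EFin_max ge_max ih fJ.
  case Jp : (J p.1 p.2) (J_ge0 p.1 p.2) MJ => [j| |]// _ MJ.
    apply: cvg_EFin; first exact: nearW.
    apply/cvgrPdist_le => e e0.
    have : ((j - e)%:E < J p.1 p.2)%E by rewrite Jp lte_fin; lra.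
    move=> /gJ[N hN]; near=> n.
    have h1 : f N p <= maxseq f n p by apply: maxseq_ge; near: n; exact: nbhs_infty_ge.
    have := MJ n; rewrite lee_fin => h2.
    have h3 : j - e <= f N p by [].
    by rewrite /= ger0_norm ?subr_ge0// lerBlDl -lerBlDr (le_trans h3).
  apply/cvgeyPge => A; have : (A%:E < J p.1 p.2)%E by rewrite Jp ltry.
  move=> /gJ[N hN]; near=> n; rewrite lee_fin (le_trans (hN : A <= f N p))//.
  by apply: maxseq_ge; near: n; exact: nbhs_infty_ge.
- move=> a q qmu pq n; apply/ler_addgt0Pr => e e0.
  have e2 : 0 < e / 2 / n.+1%:R by rewrite !divr_gt0.
  have [l hl] := choice (fun j => bcont_L1_dense mu (bl j) e2).
  have bcl j : bcont (l j) by have [] := hl j.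
  have adm := maxseq_admissible n (fun j => admissible_base Hfeller HLDP (bg j) (bcl j)).
  have := pq _ _ adm.
  set Fn := maxseq _ n; set Ln := maxseq _ n => h.
  pose S z : R := \sum_(0 <= j < n.+1) `|lam P (g j) z - l j z|.
  have bd j : bmeas (fun z => `|lam P (g j) z - l j z|).
    by apply/bmeas_norm/bmeasB => //; exact: bcont_bmeas.
  have bS : bmeas S by exact: bmeas_sum.
  have ES : Ex mu S <= e / 2.
    rewrite Ex_sum//; apply: (@le_trans _ _ (\sum_(0 <= j < n.+1) e / 2 / n.+1%:R)).
      by apply: ler_sum => j _; have [_] := hl j.
    by rewrite sumr_const_nat subn0 -[leLHS]mulr_natr divfK ?pnatr_eq0.
  have Sj j z : (j <= n)%N -> `|lam P (g j) z - l j z| <= S z.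
    move=> jn; rewrite /S big_mkord (bigD1 (Ordinal (jn : (j < n.+1)%N)))//=.
    by rewrite lerDl sumr_ge0.
  have bLn : bmeas Ln by have [] := adm.
  have bFn : bmeas (Fn : (Z * X)%type -> R) by have [/bcont_bmeas] := adm.
  have LS : Ex mu Ln <= Ex mu S.
    apply: Ex_le => // z; rewrite /Ln.
    have : forall m, (m <= n)%N -> maxseq (fun j z => lam P (g j) z - l j z) m z <= S z.
      elim=> [|m ih] mn /=; first by rewrite (le_trans (ler_norm _))// Sj.
      by rewrite ge_max ih ?(ltnW mn)//= (le_trans (ler_norm _))// Sj.
    exact.
  have fFS (p : Z * X) : maxseq f n p <= Fn p + S p.1.
    have : forall m, (m <= n)%N -> maxseq f m p <= maxseq (fun j (p : Z * X) => g j p.2 - l j p.1) m p + S p.1.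
      have key j : (j <= n)%N -> f j p <= g j p.2 - l j p.1 + S p.1.
        move=> jn; have := le_trans (ler_norm _) (Sj j p.1 jn).
        have := ler_norm (l j p.1 - lam P (g j) p.1); rewrite distrC.
        have := Sj j p.1 jn; rewrite /f; lra.
      elim=> [|m ih] mn /=; first exact: key.
      rewrite ge_max (le_trans (ih (ltnW mn))) ?lerD2r ?le_max ?lexx//=.
      by rewrite (le_trans (key _ mn))// lerD2r le_max lexx orbT.
    exact.
  have bSq := bmeas_comp cfst bS.
  have : Ex q (maxseq f n) <= Ex q Fn + Ex q (fun p => S p.1).
    rewrite -ExD//; apply: Ex_le => //; first exact: maxseq_bmeas.
    exact: bmeasD.
  rewrite (Ex_marginal cfst bS qmu); lra.
Unshelve. all: by end_near. Qed.

(** Joint measurability is not a hypothesis on [J]; it is inherited from the approximating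
    functions. *)
Lemma measurable_rate : measurable_fun setT ((fun p => J p.1 p.2) : borel (Z * X)%type -> \bar R).
Proof.
have [M [bM _ _ cM _]] := rate_monotone_approx.
apply: (@emeasurable_fun_cvg _ (borel (Z * X)%type) R setT (fun n => EFin \o M n)).
  by move=> n; apply/measurable_EFinP; exact: (bM n).1.
by move=> p _; exact: cM.
Qed.

Lemma le_Ex_rate q (f : Z * X -> R) : bmeas (f : (Z * X)%type -> R) ->
  (forall p, ((f p)%:E <= J p.1 p.2)%E) -> ((Ex q f)%:E <= \int[q]_p J p.1 p.2)%E.
Proof.
move=> bf fJ; have b0 : bmeas (fun p : (Z * X)%type => Num.max 0 (f p)).
  by apply: bmeas_max => //; exact: bmeas_cst.
apply: (@le_trans _ _ (Ex q (fun p => Num.max 0 (f p)))%:E).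
  by rewrite lee_fin; apply: Ex_le => // p; rewrite le_max lexx orbT.
rewrite -pintE//; apply: ge0_le_integral => //.
- by move=> p _; rewrite lee_fin le_max lexx.
- by apply/measurable_EFinP; exact: b0.1.
- exact: measurable_rate.
- by move=> p _; rewrite EFin_max ge_max fJ J_ge0.
Qed.

Lemma rate_passes a q : (rate_i mu J q <= a%:E)%E -> passes a q.
Proof.
rewrite /rate_i; case: asboolP => // qmu Ja F L [bF bL FL _].
have bLq := bmeas_comp cfst bL; have bF' := bcont_bmeas bF.
rewrite -(Ex_marginal cfst bL qmu) -lerBlDr -ExB// -lee_fin (le_trans _ Ja)//.
by apply: le_Ex_rate => [|[z x]]; [exact: bmeasB|exact: FL].
Qed.

(** Since [lam] of the zero function is 0, every multiple c f of a continuous function of [z] is a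
    test, and c (int f dq - int f dmu) <= a for all real c forces equality. *)
Lemma passes_marginal a q : passes a q ->
  forall A : set Z, measurable (A : set (borel Z)) -> q (fst @^-1` A) = mu A.
Proof.
move=> pq; apply: (marginal_determining cfst) => f bf.
have b1 := bmeas_comp cfst (bcont_bmeas bf).
have key (c : R) : c * (Ex q (fun p => f p.1) - Ex mu f) <= a.
  have adm := admissible_base Hfeller HLDP (bcont_cst X 0) (bcontZ (- c) bf).
  have := pq _ _ adm.
  rewrite (_ : (fun p : Z * X => _) = (fun p => c * f p.1)); last first.
    by apply/funext => p; rewrite sub0r mulNr opprK.
  rewrite (_ : (fun z : Z => lam _ _ _ - _) = (fun z => c * f z)); last first.
    by apply/funext => z; rewrite lam0 sub0r mulNr opprK.
  by rewrite !ExZ//; [lra|exact: bcont_bmeas].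
set t := Ex q _ - _ in key.
suff : t = 0 by move=> /eqP; rewrite subr_eq0 => /eqP.
apply: contrapT => /eqP t0; have := key ((`|a| + 1) / t).
rewrite divfK//; have := ler_norm a; lra.
Qed.

Lemma passes_rate a q : passes a q -> (rate_i mu J q <= a%:E)%E.
Proof.
move=> pq; have qmu := passes_marginal pq.
rewrite /rate_i; case: asboolP => // _.
have [M [bM M0 Mm cM Ma]] := rate_monotone_approx.
have := @cvg_monotone_convergence _ (borel (Z * X)%type) R q setT measurableT
  (fun n => EFin \o M n).
rewrite (_ : (fun x => limn _) = (fun p => J p.1 p.2)); last first.
  by apply/funext => p; apply/cvg_lim => //; exact: cM.
move=> h; apply: (@cvge_to_le _ _ _ _ _ _ _ (h _ _ _)).
- by move=> n; apply/measurable_EFinP; exact: (bM n).1.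
- by move=> n p _; rewrite lee_fin.
- by move=> p _ n m nm; rewrite lee_fin Mm.
- by apply: nearW => n; rewrite -/(pint q (M n)) pintE// lee_fin; exact: Ma.
Qed.

(* Tightness comes from testing with large multiples of [cover_fun], whose [lam] tends to 0 because [J z] is good. *)
Lemma passes_ultra (G : set_system (Pmeas R (Z * X)%type)) (a : R) : UltraFilter G ->
  (forall F L, admissible P J F L -> G [set q | Ex q F <= a + Ex mu L]) ->
  exists q0 : Pmeas R (Z * X)%type, passes a q0 /\
    forall f : Z * X -> R, bcont (f : (Z * X)%type -> R) -> forall e : R, 0 < e ->
    G [set q | `|Ex q f - Ex q0 f| < e].
Proof.
move=> UG hG; have PG : ProperFilter G by exact: ultra_proper.
have cZX := prod_ball_complete (@complete_ball_complete R Z) (@complete_ball_complete R X).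
have [dZ ddZ] := separable_dense_seq sepZ.
have [dX ddX] := separable_dense_seq sepX.
have [|q0 hq0] := ultra_tight_cvg cZX UG.
  move=> e d e0 d0; pose r := Num.min d 1.
  have r0 : 0 < r by rewrite lt_min d0 ltr01.
  have r1 : r <= 1 by rewrite ge_min lexx orbT.
  have rd : r <= d by rewrite ge_min lexx.
  (* Chosen so that (|a| + 1) / c = e / 4: dividing a passed test by [c] leaves a constant of at
     most e / 4. *)
  pose c := 4 * (`|a| + 1) / e.
  have c0 : 0 < c by rewrite divr_gt0// mulr_gt0// ltr_wpDl.
  have [N1 hN1] : exists N, Ex mu (cover_fun dZ r N) <= e / 4.
    have [|||_ h] := @Ex_cvg _ _ mu (cover_fun dZ r) (fun=> 0) 1.
    - by move=> n; apply: bcont_bmeas; exact: cover_fun_bcont.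
    - by move=> n x; have /andP[h0 h1] := cover_fun01 dZ r0 n x; rewrite ger0_norm.
    - by move=> x; exact: cover_fun_cvg.
    rewrite Ex_cst in h; have e4 : 0 < e / 4 by rewrite divr_gt0.
    by have [N _ hN] := cvgr_le _ h _ e4; exists N; exact: (hN N (leqnn N)).
  pose gX N x := c * cover_fun dX r N x.
  have bgX N : bcont (gX N) by apply: bcontZ; exact: cover_fun_bcont.
  have [N2 hN2] : exists N, Ex mu (lam P (gX N)) <= 1.
    have gXc N x : 0 <= gX N x <= c.
      have /andP[h0 h1] := cover_fun01 dX r0 N x.
      by rewrite mulr_ge0 ?(ltW c0)//= ler_piMr// ltW.
    (* At each point [z]: once the compact set {J z <= c} is covered, [gX N] is nonzero only where J
       z >= c, and as its height is at most [c], [lam_upper] bounds [lam] by 0. *)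
    have [||||N _ hN] := @reverse_fatou R Z mu (fun N => lam P (gX N)) (fun=> 0) c _ _ _ _ 1 ltr01.
    - by move=> N; exact: bmeas_lam.
    - move=> N z; apply: lam_bnd => // x; have /andP[h0 h1] := gXc N x.
      by rewrite ger0_norm.
    - exact: bmeas_cst.
    - move=> z s s0.
      have cK : compact [set x | (J z x <= c%:E)%E] by have [[_ /(_ c)[? ?]] _] := HLDP z.
      have [N0 hN0] := cover_compact r0 ddX cK.
      near=> N; rewrite add0r.
      apply: (@le_trans _ _ (Num.max 0 (c - c))); last by rewrite subrr maxxx ltW.
      apply: (@lam_upper R Z X P J HLDP _ (~` interior (cover_set dX r N))) => //.
      + exact/open_closedC/open_interior.
      + by move=> x /contrapT/interior_subset h; rewrite /gX cover_fun0// mulr0.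
      + move=> x nx; rewrite leNgt; apply/negP => Jx; apply: nx.
        by apply: (hN0 N _ x) => /=; [near: N; exact: nbhs_infty_ge|exact: ltW].
      + exact: ltW.
    by exists N; have := hN N (leqnn N); rewrite /= Ex_cst add0r.
  exists (fun p : Z * X => cover_fun dZ r N1 p.1 + cover_fun dX r N2 p.2).
    split.
    - by apply: bcontD; [apply: bcont_fst|apply: bcont_snd]; exact: cover_fun_bcont.
    - move=> p; have /andP[h0 _] := cover_fun01 dZ r0 N1 p.1.
      by have /andP[h1 _] := cover_fun01 dX r0 N2 p.2; rewrite addr_ge0.
    - exists [seq (dZ i, dX j) | i <- iota 0 N1, j <- iota 0 N2] => -[z x] hs /=.
      have [hz|/existsNP[i /not_implyP[iN /contrapT hi]]] := pselect (forall i, (i < N1)%N -> ~ ball (dZ i) r z).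
        rewrite (cover_fun1 r0 r1 hz) lerDl.
        by have /andP[] := cover_fun01 dX r0 N2 x.
      have [hx|/existsNP[j /not_implyP[jN /contrapT hj]]] := pselect (forall i, (i < N2)%N -> ~ ball (dX i) r x).
        rewrite (cover_fun1 r0 r1 hx) lerDr.
        by have /andP[] := cover_fun01 dZ r0 N1 z.
      exfalso; apply: (hs (dZ i, dX j)).
        by apply/allpairsP; exists (i, j); rewrite !mem_iota.
      by split; apply: le_ball rd _ _.
  have bZ := cover_fun_bcont dZ r N1; have bX := cover_fun_bcont dX r N2.
  have a1 := admissible_base Hfeller HLDP (bcont_cst X 0) (bcontZ (- c) bZ).
  have a2 := admissible_base Hfeller HLDP (bgX N2) (bcont_cst Z 0).
  apply: filterS (filterI (hG _ _ a1) (hG _ _ a2)) => q [].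
  have bZ' := bmeas_comp cfst (bcont_bmeas bZ).
  have bX' := bmeas_comp csnd (bcont_bmeas bX).
  rewrite /= (_ : (fun p : Z * X => 0 - _) = (fun p => c * cover_fun dZ r N1 p.1)); last first.
    by apply/funext => p; rewrite sub0r mulNr opprK.
  rewrite (_ : (fun z : Z => lam _ (fun=> 0) _ - _) = (fun z => c * cover_fun dZ r N1 z)); last first.
    by apply/funext => z; rewrite lam0 sub0r mulNr opprK.
  rewrite (_ : (fun p : Z * X => gX N2 _ - 0) = (fun p => c * cover_fun dX r N2 p.2)); last first.
    by apply/funext => p; rewrite subr0.
  rewrite (_ : (fun z : Z => lam _ (gX N2) _ - _) = lam P (gX N2)); last first.
    by apply/funext => z; rewrite subr0.
  rewrite !ExZ//; last exact: bcont_bmeas.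
  rewrite ExD// => h1 h2.
  have ca : `|a| + 1 = c * (e / 4) by rewrite /c; field; rewrite gt_eqF.
  have an := ler_norm a.
  have : c * Ex q (fun p => cover_fun dZ r N1 p.1) <= c * (e / 2).
    have : c * Ex mu (cover_fun dZ r N1) <= c * (e / 4) by rewrite ler_pM2l.
    lra.
  have : c * Ex q (fun p => cover_fun dX r N2 p.2) <= c * (e / 4) by lra.
  rewrite !ler_pM2l//; lra.
exists q0; split=> // F L adm; have [bF bL _ _] := adm.
apply/ler_addgt0Pr => e e0; apply: contrapT => /negP; rewrite -ltNge => lt.
apply: (@filter_not_empty _ G); apply: filterS (filterI (hG _ _ adm) (hq0 F bF e e0)) => q /= [].
rewrite ltr_norml; lra.
Unshelve. all: by end_near. Qed.

(** Failing a test is an open condition, hence closedness. If no finite subfamily covered a sublevel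
    set, the parts left uncovered by finite subfamilies would generate a filter. An ultrafilter
    above it converges, by [passes_ultra], inside the sublevel set, and would contain both a member
    of the cover around the limit and its complement. *)
Lemma rate_good : narrow_good_rate (rate_i mu J).
Proof.
split.
  move=> q; rewrite /rate_i; case: asboolP => // _; apply: integral_ge0 => p _; exact: J_ge0.
move=> a; split.
  move=> q hq; apply: passes_rate => F L adm; have [bF _ _ _] := adm.
  rewrite leNgt; apply/negP => lt.
  have [q' [h1 h2]] := hq _ (narrow_open_gt (b := a + Ex mu L) bF) lt.
  by have := rate_passes h2 adm; rewrite leNgt h1.
move=> I V oV AV; apply: contrapT => nfin.
pose A := [set q | (rate_i mu J q <= a%:E)%E].
pose F : set_system (Pmeas R (Z * X)%type) := [set B | exists m (g : 'I_m -> I),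
  A `\` \bigcup_j V (g j) `<=` B].
have PF : ProperFilter F.
  apply: Build_ProperFilter_ex.
    move=> B [m [g hB]]; apply: contrapT => nB; apply: nfin; exists m, g => q Aq.
    by apply: contrapT => nq; apply: nB; exists q; apply: hB.
  split.
  - by exists 0%N, (fun i : 'I_0 => match (ltac:(by case: i) : False) with end).
  - move=> B C [m [g hB]] [n [h hC]].
    exists (m + n)%N, (fun j => match fintype.split j with inl i => g i | inr i => h i end).
    move=> q [Aq nq]; split.
      apply: hB; split=> // -[i _ Vi]; apply: nq; exists (lshift n i) => //.
      by rewrite (unsplitK (inl i)).
    apply: hC; split=> // -[i _ Vi]; apply: nq; exists (rshift m i) => //.
    by rewrite (unsplitK (inr i)).
  - by move=> B C BC [m [g hB]]; exists m, g; exact: subset_trans BC.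
have [G [UG FG]] := ultraFilterLemma PF.
have PG : ProperFilter G by exact: ultra_proper.
have GA : G A.
  by apply: FG; exists 0%N, (fun i : 'I_0 => match (ltac:(by case: i) : False) with end) => q [].
have [|q0 [pq0 hq0]] := @passes_ultra G a UG.
  by move=> F' L adm; apply: filterS GA => q hq; exact: rate_passes hq _ _ adm.
have [i _ Vi] := AV q0 (passes_rate pq0).
have FG' : Filter G by exact: filter_filter.
have GV := @ultra_narrow_open _ _ G q0 _ FG' hq0 (oV i) Vi.
have GN : G (~` V i).
  apply: FG; exists 1%N, (fun=> i) => q [_ nV] Vq; apply: nV.
  by exists ord0.
by have [q [? ?]] := @filter_ex _ G PG _ (filterI GV GN).
Qed.

(* Otherwise an ultrafilter on [B] along which every admissible test is passed would converge to a point of the closure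
   of rate at most [a]. *)
Lemma test_cover (B : set (Pmeas R (Z * X)%type)) (a : R) :
  (forall q, narrow_closure B q -> (a%:E < rate_i mu J q)%E) ->
  exists s : seq ((Z * X -> R) * (Z -> R)),
    (forall FL, List.In FL s -> admissible P J FL.1 FL.2) /\
    (forall q, B q -> exists2 FL, List.In FL s & a + Ex mu FL.2 < Ex q FL.1).
Proof.
move=> ha; apply: contrapT => /forallNP nfin.
pose F : set_system (Pmeas R (Z * X)%type) := [set C | exists s : seq ((Z * X -> R) * (Z -> R)),
  (forall FL, List.In FL s -> admissible P J FL.1 FL.2) /\
  (B `&` [set q | forall FL, List.In FL s -> Ex q FL.1 <= a + Ex mu FL.2] `<=` C)].
have PF : ProperFilter F.
  apply: Build_ProperFilter_ex.
    move=> C [s [hs hC]]; apply: contrapT => nC; apply: (nfin s); split=> // q Bq.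
    apply: contrapT => nq; apply: nC; exists q; apply: hC; split=> // FL hFL.
    by rewrite leNgt; apply/negP => lt; apply: nq; exists FL.
  split.
  - by exists [::]; split.
  - move=> C D [s [hs hC]] [t [ht hD]]; exists (s ++ t); split.
      by move=> FL /List.in_app_iff[/hs|/ht].
    move=> q [Bq h]; split; [apply: hC|apply: hD]; split=> // FL hFL; apply: h.
      by apply/List.in_app_iff; left.
    by apply/List.in_app_iff; right.
  - by move=> C D CD [s [hs hC]]; exists s; split=> //; exact: subset_trans CD.
have [G [UG FG]] := ultraFilterLemma PF.
have PG : ProperFilter G by exact: ultra_proper.
have GB : G B by apply: FG; exists [::]; split=> // q [].
have [|q0 [pq0 hq0]] := @passes_ultra G a UG.
  move=> F' L adm; apply: FG; exists [:: (F', L)]; split.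
    by move=> FL [<-|[]].
  by move=> q [_ h]; apply: (h (F', L)); left.
have : narrow_closure B q0.
  move=> V oV Vq; have FG' : Filter G by exact: filter_filter.
  have GV := @ultra_narrow_open _ _ G q0 _ FG' hq0 oV Vq.
  by have [q [Bq Vq']] := filter_ex (filterI GB GV); exists q.
by move=> /ha; rewrite ltNge (passes_rate pq0).
Qed.

End RateTests.

(** * Empirical measures and Chernoff bounds *)

Lemma mem_In (T : eqType) (s : seq T) x : x \in s -> List.In x s.
Proof. by elim: s => // y s ih; rewrite inE => /orP[/eqP ->|/ih]; [left|right]. Qed.

Section ProbReal.
Variables (R : realType) (dO : measure_display) (Om : measurableType dO) (Pr : probability Om R).
Implicit Types (A B : set Om).

Definition pr A : R := fine (Pr A).

Lemma pr_fin A : measurable A -> Pr A = (pr A)%:E.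
Proof. by move=> mA; rewrite /pr fineK//; exact: (fin_num_measure Pr). Qed.

Lemma pr_le A B : measurable A -> measurable B -> A `<=` B -> pr A <= pr B.
Proof.
by move=> mA mB AB; rewrite -lee_fin -!pr_fin//; apply: le_measure => //; rewrite inE.
Qed.

Lemma pr_cover (I : Type) (s : seq I) (A : I -> set Om) B : measurable B ->
  (forall i, List.In i s -> measurable (A i)) ->
  (forall w, B w -> exists2 i, List.In i s & A i w) ->
  pr B <= \sum_(i <- s) pr (A i).
Proof.
elim: s B => [|i s ih] B mB mA hB.
  rewrite big_nil (_ : B = set0); first by rewrite /pr measure0.
  by apply/seteqP; split=> // w /hB[].
have mAi : measurable (A i) by apply: mA; left.
rewrite big_cons; apply: (@le_trans _ _ (pr (A i) + pr (B `\` A i))).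
  have mD := measurableD mB mAi.
  rewrite -lee_fin EFinD -!pr_fin//.
  apply: (@le_trans _ _ (Pr (A i `|` (B `\` A i)))).
    apply: le_measure; rewrite ?inE//; first exact: measurableU.
    by move=> w Bw; have [Aw|nA] := pselect (A i w); [left|right].
  exact: measureU2.
rewrite lerD2l; apply: ih; first exact: measurableD.
  by move=> j js; apply: mA; right.
by move=> w [/hB[j [<-//|js] Aj] nAi]; exists j.
Qed.

End ProbReal.

Section Empirical.
Variables (R : realType) (T : ptopologicalType) (n : nat) (pts : nat -> T).

Definition emp_weight : {nonneg R} := NngNum (ltac:(by rewrite invr_ge0) : 0 <= (n.+1%:R)^-1 :> R).

Definition emp_measure : set (borel T) -> \bar R :=
  mscale emp_weight (msum (fun k => \d_(pts k : borel T) : {measure set (borel T) -> \bar R}) n.+1).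

HB.instance Definition _ := Measure.on emp_measure.

Lemma emp_measureE (A : set (borel T)) :
  emp_measure A = ((n.+1%:R)^-1 * \sum_(i < n.+1) \1_A (pts i))%:E.
Proof.
rewrite /emp_measure /mscale /msum/= EFinM; congr (_ * _)%E.
by rewrite -sumEFin; apply: eq_bigr => i _.
Qed.

Lemma emp_measureT : emp_measure setT = 1%E.
Proof.
rewrite emp_measureE; congr EFin.
under eq_bigr do rewrite indicE in_setT/=.
by rewrite sumr_const card_ord mulVf// pnatr_eq0.
Qed.

HB.instance Definition _ := Measure_isProbability.Build _ (borel T) R emp_measure emp_measureT.

Definition emp : Pmeas R T := emp_measure.

Lemma emp_is_empirical : is_empirical (fun i : 'I_n.+1 => pts i) emp.
Proof. by move=> A mA; exact: emp_measureE. Qed.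

Lemma Ex_emp f : bmeas f -> Ex emp f = (n.+1%:R)^-1 * \sum_(i < n.+1) f (pts i).
Proof.
have key g : bmeas g -> (forall x, 0 <= g x) -> Ex emp g = (n.+1%:R)^-1 * \sum_(i < n.+1) g (pts i).
  move=> [mg _] g0; have mg' : measurable_fun setT (EFin \o g : borel T -> \bar R) by exact/measurable_EFinP.
  have g0' x : [set: borel T] x -> (0 <= (g x)%:E)%E by rewrite lee_fin.
  rewrite /Ex /pint /emp /emp_measure/= ge0_integral_mscale//=.
  rewrite (@ge0_integral_measure_sum _ _ _ _ setT)//.
  rewrite (eq_bigr (fun i : 'I_n.+1 => (g (pts i))%:E)).
    by rewrite sumEFin -EFinM.
  by move=> i _; rewrite integral_dirac// diracT mul1e.
move=> bf; have [mf [M fM]] := bf.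
(* Adding the bound [M] reduces to the nonnegative case. *)
have b1 := bmeas_cst T M; have bfM := bmeasD bf b1.
have := key _ bfM; rewrite ExD// Ex_cst => h.
have {h}/(canRL (addrK M)) -> := h (fun x => ltac:(by rewrite addrC -lerBlDl sub0r; have := fM x; rewrite ler_norml => /andP[])).
by rewrite big_split/= mulrDr sumr_const card_ord -[M *+ _]mulr_natl mulrA mulVf ?pnatr_eq0// mul1r addrK.
Qed.

End Empirical.

Section Saturated.
Variables (R : realType) (T : ptopologicalType).
Implicit Types (q : Pmeas R T).

Definition agree q q' := forall A : set T, measurable (A : set (borel T)) -> q A = q' A.

Lemma agree_pint q q' f : agree q q' -> pint q f = pint q' f.
Proof. by move=> h; apply: eq_measure_integral => A mA _; exact: h. Qed.

(** A [Pmeas] gives values to all sets, so two of them may agree on Borel sets without being equal.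
    Narrow events do not see the difference, whichever representative of the empirical measure is
    chosen. *)
Lemma narrow_measurable_saturated (B : set (Pmeas R T)) : narrow_measurable B ->
  forall q q', agree q q' -> B q -> B q'.
Proof.
move=> mB; pose D := [set B : set (Pmeas R T) | forall q q', agree q q' -> B q -> B q'].
have sym q q' : agree q q' -> agree q' q by move=> h A mA; rewrite h.
suff : <<s @narrow_open R T >> `<=` D by move=> /(_ _ mB).
apply: smallest_sub; last first.
  move=> U oU q q' qq' Uq; have [m [f [e [e0 [bf sU]]]]] := oU _ Uq.
  apply: sU => j /=; rewrite -(agree_pint _ qq') narrow_distE//.
  by rewrite subrr normr0.
split.
- by move=> q q' _ [].
- move=> C DC q q' qq' [_ nC]; split=> // Cq'; apply: nC.
  by apply: DC Cq'; exact: sym.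
- move=> F DF q q' qq' [i _ Fi]; exists i => //.
  exact: DF Fi.
Qed.

End Saturated.

Section EmpMeasurable.
Variables (R : realType) (Z X : completePseudoMetricType R).
Hypothesis sepX : separable_space X.
Variables (dO : measure_display) (Om : measurableType dO).
Variables (n : nat) (zz : nat -> Z) (Y : nat -> Om -> X).
Hypothesis mY : forall i, (i < n.+1)%N -> measurable_fun setT (Y i : Om -> borel X).

Definition emp_of w : Pmeas R (Z * X)%type := emp R n (fun i => (zz i, Y i w) : (Z * X)%type).

(** A narrowly open set may be an uncountable union of basic neighbourhoods. With the [zz i] fixed,
    separability of [X] writes the event as the countable union of those boxes of n + 1 small balls
    around dense points that lie inside it. *)
Lemma emp_preimage_open (U : set (Pmeas R (Z * X)%type)) : narrow_open U ->
  measurable [set w | U (emp_of w)].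
Proof.
move=> oU; have [d dd] := separable_dense_seq sepX.
pose box (c : seq nat * nat) : set Om := [set w | forall i : 'I_n.+1,
   interior (ball (d (nth 0%N c.1 i)) (c.2.+1%:R^-1)) (Y i w)].
have mbox c : measurable (box c).
  rewrite (_ : box c = \bigcap_(i in [set: 'I_n.+1]) (Y i @^-1` interior (ball (d (nth 0%N c.1 i)) (c.2.+1%:R^-1)))).
    apply: fin_bigcap_measurable => // i _; rewrite -[X in measurable X]setTI; apply: mY => //.
    by apply: sub_sigma_algebra; exact: open_interior.
  by apply/seteqP; split=> w h i; [move=> _; exact: h|exact: (h i I)].
pose good (k : nat) : set Om := if unpickle k is Some c then
  (if `[< box c `<=` [set w | U (emp_of w)] >] then box c else set0) else set0.
suff -> : [set w | U (emp_of w)] = \bigcup_k good k.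
  apply: bigcupT_measurable => k; rewrite /good; case: unpickle => [c|]; last exact: measurable0.
  by case: ifP => _; [exact: mbox|exact: measurable0].
apply/seteqP; split; last first.
  move=> w [k _]; rewrite /good; case: unpickle => // c; case: ifP => // /asboolP; exact.
move=> w Uw; have [m [f [e [e0 [bf sU]]]]] := oU _ Uw.
have [r r0 hr] : exists2 r : R, 0 < r & forall x : 'I_n.+1 -> X, (forall i : 'I_n.+1, ball (Y i w) r (x i)) ->
    forall (j : 'I_m) (i : 'I_n.+1), `|f j (zz i, x i) - f j (zz i, Y i w)| < e.
  have h (ji : 'I_m * 'I_n.+1) : exists r : R, 0 < r /\ forall x, ball (Y ji.2 w) r x ->
      `|f ji.1 (zz ji.2, x) - f ji.1 (zz ji.2, Y ji.2 w)| < e.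
    have c1 := (bcont_section (zz ji.2) (bf ji.1)).1 (Y ji.2 w).
    move: c1 => /cvgrPdist_lt/(_ _ e0)/nbhs_ballP[r /= r0 hr].
    by exists r; split=> // x /hr; rewrite /= distrC.
  have [rr hrr] := choice h.
  exists (\big[Num.min/1]_ji rr ji).
    by apply: lt_bigmin => // ji _; have [] := hrr ji.
  move=> x hx j i; have [_] := hrr (j, i); apply; apply: le_ball (hx i).
  exact: (@bigmin_le_cond _ _ _ 1 (j, i) xpredT rr).
have [l hl] : exists l : nat, l.+1%:R^-1 < r / 2.
  exists (Num.truncn (r / 2)^-1); rewrite invf_plt ?posrE ?divr_gt0//; exact: truncnS_gt.
have s0 : 0 < l.+1%:R^-1 / 2 :> R by rewrite divr_gt0.
have [g hg] := choice (fun i => dd (Y i w) _ s0).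
pose c := (mkseq g n.+1, l).
have cE (i : 'I_n.+1) : nth 0%N c.1 i = g i by rewrite nth_mkseq.
exists (pickle c) => //; rewrite /good pickleK.
case: ifPn => [_|/asboolPn[]].
  move=> i; rewrite cE; apply/nbhs_ballP; exists (l.+1%:R^-1 / 2) => //= y xy.
  by rewrite [_.+1%:R^-1]splitr; exact: ball_triangle xy.
move=> w' hw'; apply: sU => j /=; rewrite narrow_distE//.
rewrite !Ex_emp; [|exact: bcont_bmeas..].
rewrite -mulrBr -sumrB normrM ger0_norm// ltr_pdivrMl//.
apply: (@le_lt_trans _ _ (\sum_(i < n.+1) `|f j (zz i, Y i w') - f j (zz i, Y i w)|)).
  exact: ler_norm_sum.
have dist (i : 'I_n.+1) : `|f j (zz i, Y i w') - f j (zz i, Y i w)| < e.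
  apply: (hr (fun i => Y i w')) => {}i.
  have h1 := interior_subset (hw' i); rewrite cE in h1.
  have h2 := hg i.
  apply: (@le_ball _ _ _ (l.+1%:R^-1 / 2 + l.+1%:R^-1)).
    have : l.+1%:R^-1 / 2 <= l.+1%:R^-1 :> R.
      by rewrite ler_pdivrMr// ler_peMr// ler1n.
    by move: hl; move: (l.+1%:R^-1 : R) => s *; lra.
  by apply: ball_triangle h1; exact: ball_sym.
rewrite (@lt_le_trans _ _ (\sum_(i < n.+1) e))//; last by rewrite sumr_const card_ord mulr_natl.
by apply: ltr_sum => //; apply/hasP; exists ord0; rewrite ?mem_index_enum.
Qed.

Lemma emp_preimage (B : set (Pmeas R (Z * X)%type)) : narrow_measurable B ->
  measurable [set w | B (emp_of w)].
Proof.
move=> mB; pose D := [set B : set (Pmeas R (Z * X)%type) | measurable [set w | B (emp_of w)]].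
suff : <<s @narrow_open R (Z * X)%type >> `<=` D by move=> /(_ _ mB).
apply: smallest_sub; last by move=> U; exact: emp_preimage_open.
split.
- exact: measurable0.
- move=> A DA; rewrite /D /= (_ : [set w | _] = ~` [set w | A (emp_of w)]).
    exact: measurableC.
  by apply/seteqP; split=> w //= [].
- move=> F DF; rewrite /D /= (_ : [set w | _] = \bigcup_i [set w | F i (emp_of w)]).
    exact: bigcupT_measurable.
  by apply/seteqP; split=> w [i _ Fi]; exists i.
Qed.

Lemma emp_preimageE (B : set (Pmeas R (Z * X)%type)) : narrow_measurable B ->
  [set w | exists q, B q /\ is_empirical (fun i : 'I_n.+1 => (zz i, Y i w)) q] =
  [set w | B (emp_of w)].
Proof.
move=> mB; apply/seteqP; split=> w /=.
  move=> [q [Bq eq]]; apply: (narrow_measurable_saturated mB _ Bq) => A mA.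
  rewrite eq//; symmetry; exact: emp_is_empirical.
by move=> h; exists (emp_of w); split=> //; exact: emp_is_empirical.
Qed.

Lemma measurable_avg (F : nat -> X -> R) : (forall i, bmeas (F i)) ->
  measurable_fun setT (fun w => \sum_(i < n.+1) F i (Y i w)).
Proof.
move=> bF; rewrite (_ : (fun _ => _) = fun w => \sum_(i <- index_enum 'I_n.+1) (F i \o Y i) w)//.
apply: (@measurable_sum _ Om R setT 'I_n.+1 (index_enum 'I_n.+1) (fun i : 'I_n.+1 => F i \o Y i)) => i.
by apply: (@measurableT_comp _ _ _ Om (borel X) R); [exact: (bF i).1|exact: mY].
Qed.

End EmpMeasurable.

Section Chernoff.
Variables (R : realType) (X : ptopologicalType).
Variables (dO : measure_display) (Om : measurableType dO) (Pr : probability Om R).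
Variables (n : nat) (Y : 'I_n -> Om -> X) (Q : 'I_n -> Pmeas R X).
Hypothesis mY : forall i, measurable_fun setT (Y i : Om -> borel X).
Hypothesis lawY : forall i (A : set X), measurable (A : set (borel X)) -> Pr (Y i @^-1` A) = Q i A.
Hypothesis indY : mutually_independent Pr Y.

Let mpre i (A : set X) : measurable (A : set (borel X)) -> measurable (Y i @^-1` A).
Proof. by move=> mA; rewrite -[X in measurable X]setTI; exact: mY. Qed.

Lemma pr_independent (A : 'I_n -> set X) : (forall i, measurable (A i : set (borel X))) ->
  measurable (\bigcap_i (Y i @^-1` A i)) /\
  pr Pr (\bigcap_i (Y i @^-1` A i)) = \prod_(i < n) fine (Q i (A i)).
Proof.
move=> mA; split.
  by apply: fin_bigcap_measurable => // i _; exact: mpre.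
rewrite /pr indY// (eq_bigr (fun i => (fine (Q i (A i)))%:E)); first by rewrite prodEFin.
move=> i _; rewrite -lawY// fineK//; apply: (fin_num_measure Pr); exact: mpre.
Qed.

(* Markov's inequality is replaced by slicing the values of each [F i] into cells of width [d], so that only
   probabilities of rectangles are needed; this costs the term [n * d]. *)
Lemma chernoff (F : 'I_n -> X -> R) (k d t : R) : (forall i, bmeas (F i)) -> 0 < k -> 0 < d ->
  measurable [set w | t < \sum_(i < n) F i (Y i w)] ->
  pr Pr [set w | t < \sum_(i < n) F i (Y i w)] <=
    expR (- (k * (t - n%:R * d))) * \prod_(i < n) Ex (Q i) (fun x => expR (k * F i x)).
Proof.
move=> bF k0 d0 mE.
have [M [M0 FM]] : exists M, 0 <= M /\ forall i x, `|F i x| <= M.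
  have [M hM] := choice (fun i => (bF i).2).
  exists (\sum_i `|M i|); split; first exact: sumr_ge0.
  move=> i x; rewrite (le_trans (hM i x))// (le_trans (ler_norm _))// (bigD1 i)//=.
  by rewrite lerDl sumr_ge0.
pose N := (Num.truncn (2 * M / d)).+1.
pose A (i : 'I_n) (l : nat) : set X := [set x | l%:R * d <= F i x + M < l.+1%:R * d].
(* The upper end of cell [l]: on the cell it dominates [F i] and exceeds it by at most [d]. *)
pose c (l : nat) : R := l.+1%:R * d - M.
have mA i l : measurable (A i l : set (borel X)).
  have bFM := bmeasD (bF i) (bmeas_cst X M).
  rewrite -[X in measurable X]setTI.
  have := bFM.1 measurableT _ (measurable_itv `[l%:R * d, l.+1%:R * d[).
  by congr (measurable _); apply/seteqP; split=> x /= [_]; rewrite in_itv.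
have layer i x : exists2 l, (l < N)%N & A i l x.
  have Fx : 0 <= F i x + M by have := FM i x; rewrite ler_norml; lra.
  have Fx2 : F i x + M <= 2 * M by have := FM i x; rewrite ler_norml; lra.
  exists (Num.truncn ((F i x + M) / d)).
    by rewrite ltnS le_truncn// ler_pM2r// invr_gt0.
  rewrite /A /= -ler_pdivlMr// -ltr_pdivrMr//.
  by rewrite truncn_le ?divr_ge0// ?(ltW d0)//= truncnS_gt.
have uniq_layer i x l l' : A i l x -> A i l' x -> l = l'.
  wlog ll' : l l' / (l < l')%N.
    by move=> h Al Al'; case: (ltngtP l l') => // ll'; [|symmetry]; exact: h.
  move=> /andP[_ h1] /andP[h2 _]; exfalso.
  have := lt_le_trans (le_lt_trans h2 h1) _; move=> /(_ (l'%:R * d)).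
  by rewrite ltxx ler_pM2r// ler_nat => /(_ ll').
pose a i l := fine (Q i (A i l)).
have a0 i l : 0 <= a i l by rewrite fine_ge0.
pose phis := [seq phi : {ffun 'I_n -> 'I_N} <- enum {: {ffun 'I_n -> 'I_N}} | t < \sum_i c (phi i)].
pose C (phi : {ffun 'I_n -> 'I_N}) := \bigcap_i (Y i @^-1` A i (phi i)).
apply: (@le_trans _ _ (\sum_(phi <- phis) pr Pr (C phi))).
  apply: pr_cover => //.
    by move=> phi _; have [] := pr_independent (fun i => mA i (phi i)).
  move=> w /= tw.
  have hl i : exists l : 'I_N, A i l (Y i w).
    by have [l lN Al] := layer i (Y i w); exists (Ordinal lN).
  have [l hl'] := choice hl.
  exists [ffun i => l i]; last by move=> i _ /=; rewrite ffunE.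
  apply: mem_In => //; rewrite mem_filter mem_enum andbT (lt_le_trans tw)//.
  apply: ler_sum => i _; rewrite ffunE /c.
  by have /andP[_ /ltW h] := hl' i; rewrite lerBrDr.
rewrite big_filter.
(* A selected assignment has exp(k (sum of c - t)) at least 1; inserting this factor lets the sum
   run over all assignments. *)
apply: (@le_trans _ _ (\sum_(phi : {ffun 'I_n -> 'I_N}) expR (- (k * t)) * \prod_i (expR (k * c (phi i)) * a i (phi i)))).
  rewrite big_enum_cond big_mkcond; apply: ler_sum => phi _.
  case: ifPn => [/andP[_ /= tc]|_]; last first.
    by rewrite mulr_ge0 ?expR_ge0// prodr_ge0// => i _; rewrite mulr_ge0 ?expR_ge0.
  rewrite /C (pr_independent (fun i => mA i (phi i))).2 big_split/= mulrA ler_peMl//.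
    by apply: prodr_ge0 => i _; exact: a0.
  rewrite -expR_sum -expRD -[leLHS]expR0 ler_expR -mulr_sumr addrC -mulrBr.
  by rewrite mulr_ge0// ?subr_ge0 ltW.
(* Distributivity turns the sum over assignments into a product with one sum over cells per
   index. *)
rewrite -big_distrr/= -(bigA_distr_bigA (fun i (l : 'I_N) => expR (k * c l) * a i l))/=.
have key i : \sum_(l < N) expR (k * c l) * a i l <= expR (k * d) * Ex (Q i) (fun x => expR (k * F i x)).
  have bI (l : nat) := bmeas_indic R (mA i l).
  under eq_bigr do rewrite /a -(Ex_indic _ (mA _ _)) -ExZ//.
  have bexp := bmeas_exp k (bF i).
  rewrite -Ex_sum; last by move=> l; exact: bmeasZ.
  rewrite -ExZ//; apply: Ex_le; first by apply: bmeas_sum => l; exact: bmeasZ.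
    exact: bmeasZ.
  move=> x; have [l lN Al] := layer i x.
  rewrite (bigD1 (Ordinal lN))//= big1 ?addr0 => [|l' ll']; last first.
    rewrite indicE memNset ?mulr0// => Al'.
    by move/eqP : ll'; apply; apply/val_inj => /=; exact: uniq_layer Al' Al.
  rewrite indicE mem_set// mulr1 -expRD ler_expR -mulrDr ler_pM2l//.
  move: Al => /andP[h _]; rewrite /c -natr1 mulrDl mul1r; lra.
have prodle : \prod_(i < n) \sum_(l < N) expR (k * c l) * a i l <=
    \prod_(i < n) (expR (k * d) * Ex (Q i) (fun x => expR (k * F i x))).
  apply: ler_prod => i _; rewrite key andbT sumr_ge0// => l _.
  by rewrite mulr_ge0 ?expR_ge0.
apply: (le_trans (ler_wpM2l (expR_ge0 _) prodle)).
rewrite big_split/= prodr_const card_ord -expRM_natl [leLHS]mulrA -expRD.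
rewrite (_ : - (k * t) + n%:R * (k * d) = - (k * (t - n%:R * d)))//.
by ring.
Qed.

End Chernoff.

(** * Discretizing a coupling *)

Section SubMarginal.
Variables (R : realType) (T U : ptopologicalType) (q : Pmeas R T) (mu : Pmeas R U).
Variables (phi : T -> U) (V : set T).
Hypothesis cphi : continuous phi.
Hypothesis qmu : forall A : set U, measurable (A : set (borel U)) -> q (phi @^-1` A) = mu A.
Hypothesis mV : measurable (V : set (borel T)).

Let pre_measurable (A : set (borel U)) : measurable A ->
  measurable (phi @^-1` A : set (borel T)).
Proof. by move=> mA; rewrite -[X in measurable X]setTI; exact: (measurable_continuous cphi). Qed.

Let preV_measurable (A : set (borel U)) : measurable A ->
  measurable (V `&` phi @^-1` A : set (borel T)).
Proof. by move=> mA; apply: (@measurableI _ (borel T)) => //; exact: pre_measurable. Qed.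

Definition sub_marginal (A : set (borel U)) : \bar R := q (V `&` phi @^-1` A).

Local Lemma sub_marginal0 : sub_marginal set0 = 0%E.
Proof. by rewrite /sub_marginal preimage_set0 setI0; exact: (measure0 q). Qed.

Local Lemma sub_marginal_ge0 A : (0 <= sub_marginal A)%E.
Proof. exact: (measure_ge0 q). Qed.

Local Lemma sub_marginal_sadd : semi_sigma_additive sub_marginal.
Proof.
move=> F mF tF mUF; rewrite /sub_marginal preimage_bigcup setI_bigcupr.
apply: (@measure_semi_sigma_additive _ _ _ q (fun n => V `&` phi @^-1` F n)).
- by move=> n; exact: preV_measurable.
- apply/trivIsetP => /= i j _ _ ij; apply/seteqP; split=> // x [[_ Fi] [_ Fj]].
  move/trivIsetP : tF => /(_ i j I I ij) Fij.
  suff : (F i `&` F j) (phi x) by rewrite Fij.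
  by split.
- by rewrite -setI_bigcupr -preimage_bigcup; exact: preV_measurable.
Qed.

HB.instance Definition _ := isMeasure.Build _ (borel U) R sub_marginal
  sub_marginal0 sub_marginal_ge0 sub_marginal_sadd.

Local Lemma sub_marginal_fin : fin_num_fun sub_marginal.
Proof. by move=> A mA; apply: (fin_num_measure q); exact: preV_measurable. Qed.

HB.instance Definition _ := @Measure_isFinite.Build _ (borel U) R sub_marginal
  sub_marginal_fin.

Local Lemma sub_marginal_le (A : set (borel U)) : measurable A -> (sub_marginal A <= mu A)%E.
Proof.
move=> mA; rewrite -qmu//; have h := @le_measure _ _ _ q (V `&` phi @^-1` A) (phi @^-1` A).
apply: h.
- by rewrite inE; exact: preV_measurable.
- by rewrite inE; exact: pre_measurable.
- by move=> x [].
Qed.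

(** The restricted marginal is dominated by [mu], so its Radon-Nikodym density is at most 1 almost
    everywhere, and truncation at 1 makes the bound hold everywhere. *)
Lemma sub_marginal_density : exists f : U -> R, [/\ bmeas f, forall x, 0 <= f x <= 1 &
  forall g, bmeas g -> Ex mu (fun x => f x * g x) = Ex q (fun x => \1_V x * g (phi x))].
Proof.
have dom : sub_marginal `<< mu.
  apply/null_content_dominatesP => A mA muA0.
  by apply/eqP; rewrite eq_le measure_ge0 andbT -[X in (_ <= X)%E]muA0; exact: sub_marginal_le.
have [f0 [f00 f0fin f0int f0E]] := @radon_nikodym_sigma_finite _ (borel U) R mu sub_marginal dom.
have mf0 : measurable_fun setT f0 by exact: measurable_int f0int.
(* On [B m] domination gives (1 + 1 / (m + 1)) mu(B m) <= mu(B m), so these sets are null, and they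
   exhaust {f0 > 1}. *)
pose B (m : nat) : set (borel U) := [set x | ((1 + m.+1%:R^-1)%:E <= f0 x)%E].
have mB m : measurable (B m).
  rewrite -[X in measurable X]setTI; exact: emeasurable_fun_c_infty.
have muB m : mu (B m) = 0%E.
  have h1 : ((1 + m.+1%:R^-1)%:E * mu (B m) <= mu (B m))%E.
    apply: (le_trans _ (sub_marginal_le (mB m))).
    rewrite f0E// -integral_cst//; apply: ge0_le_integral => //.
    - by move=> x _; rewrite lee_fin addr_ge0// invr_ge0.
    - exact: measurable_funTS.
  have muf : mu (B m) \is a fin_num by exact: (fin_num_measure mu).
  move: h1; rewrite -(fineK muf) -EFinM lee_fin mulrDl mul1r gerDl pmulr_rle0 ?invr_gt0//.
  move=> h; congr EFin; apply/eqP; rewrite eq_le h fine_ge0//.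
pose f x := Num.min (fine (f0 x)) 1.
have mf : measurable_fun setT (f : borel U -> R).
  apply: measurable_minr => //; exact: (measurableT_comp (@fine_measurable R setT measurableT)).
have f01 x : 0 <= f x <= 1 by rewrite le_min ler01 fine_ge0//= ge_min lexx orbT.
have bf : bmeas f.
  by split=> //; exists 1 => x; have /andP[h0 h1] := f01 x; rewrite ger0_norm.
exists f; split=> //.
apply: bmeas_ind.
- move=> A mA; have bI := bmeas_indic R mA.
  have -> : (fun x => \1_V x * \1_A (phi x)) = \1_(V `&` phi @^-1` A) :> (T -> R).
    by apply/funext => x; rewrite indicI.
  rewrite Ex_indic; last exact: preV_measurable.
  rewrite -[q _]/(sub_marginal A) f0E// /Ex /pint; congr fine.
  rewrite (_ : (fun x => (f x * \1_A x)%:E) = ((EFin \o f) \_ A)); last first.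
    by apply/funext => x; rewrite /= patchE indicE; case: ifPn => /= _; rewrite ?mulr1 ?mulr0.
  rewrite -integral_mkcond; apply: ae_eq_integral => //.
  + by apply/measurable_funTS/measurable_EFinP.
  + exact: measurable_funTS.
  apply: (@negligibleS _ _ _ mu (\bigcup_m B m)); last first.
    apply: negligible_bigcup => m; exists (B m).
    by split; [exact: mB|exact: muB|exact: subset_refl].
  move=> x /= /not_implyP[_ fx].
  have lt1 : 1 < fine (f0 x).
    rewrite ltNge; apply/negP => h; apply: fx; rewrite /f (min_idPl h).
    by rewrite /= fineK.
  exists (Num.truncn (fine (f0 x) - 1)^-1) => //.
  rewrite /B /= -[leRHS]fineK// lee_fin -lerBrDl invf_ple ?posrE ?subr_gt0//.
  by rewrite ltW// truncnS_gt.
- move=> F G c bF bG hF hG.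
  have bV := bmeas_indic R mV.
  have bFp := bmeas_comp cphi bF; have bGp := bmeas_comp cphi bG.
  rewrite (_ : (fun x => _) = fun x => f x * F x + c * (f x * G x)); last first.
    by apply/funext => x; rewrite mulrDr mulrCA.
  rewrite [in RHS](_ : (fun x => _) = fun x => \1_V x * F (phi x) + c * (\1_V x * G (phi x))); last first.
    by apply/funext => x; rewrite mulrDr mulrCA.
  rewrite !ExD ?ExZ ?hF ?hG//; repeat (exact: bmeasM || apply: bmeasZ).
- move=> F h M bF FM cF hF.
  have bV := bmeas_indic R mV.
  have c1 : Ex mu (fun x => f x * F n x) @[n --> \oo] --> Ex mu (fun x => f x * h x).
    apply: (@Ex_cvg _ _ mu _ _ M _ _ _).2.
    + by move=> n; exact: bmeasM.
    + move=> n x; have /andP[h0 h1] := f01 x; rewrite normrM (ger0_norm h0).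
      by rewrite (le_trans _ (FM n x))// ler_piMl.
    + by move=> x; apply: cvgM => //; exact: cvg_cst.
  have c2 : Ex q (fun x => \1_V x * F n (phi x)) @[n --> \oo] --> Ex q (fun x => \1_V x * h (phi x)).
    apply: (@Ex_cvg _ _ q _ _ M _ _ _).2.
    + by move=> n; apply: bmeasM => //; exact: bmeas_comp.
    + move=> n x; rewrite normrM indicE; case: (_ \in _) => /=; rewrite ?normr1 ?mul1r//.
      by rewrite normr0 mul0r (le_trans _ (FM n (phi x))).
    + by move=> x; apply: cvgM; [exact: cvg_cst|exact: cF].
  rewrite (_ : (fun n => _) = fun n => Ex q (fun x => \1_V x * F n (phi x))) in c1; last first.
    by apply/funext => n; exact: hF.
  by apply: (cvg_unique _ c1) => //; exact: c2.
Qed.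

End SubMarginal.

Lemma bcont_div (R : realType) (T : ptopologicalType) (u s : T -> R) : bcont u -> bcont s ->
  (forall x, 1 <= s x) -> bcont (fun x => u x / s x).
Proof.
move=> [cu [M uM]] [cs _] s1; have s0 x : 0 < s x by exact: lt_le_trans (s1 x).
split.
  by move=> x; apply: cvgM; [exact: cu|apply: cvgV; [rewrite gt_eqF|exact: cs]].
exists M => x; rewrite normrM normfV (gtr0_norm (s0 x)).
by rewrite (le_trans _ (uM x))// ler_pdivrMr// ler_peMr.
Qed.

Lemma sum_indic_le1 (R : realType) (T : Type) (V : nat -> set T) N x :
  (forall l l', V l x -> V l' x -> l = l') -> \sum_(l < N) (\1_(V l) x : R) <= 1.
Proof.
move=> dV; elim: N => [|N ih]; first by rewrite big_ord0.
rewrite big_ord_recr/=; have [VN|nV] := pselect (V N x); last first.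
  by rewrite [\1_(V N) x]indicE memNset// addr0.
rewrite big1 ?add0r => [|l _]; first by rewrite indicE; case: (_ \in _); rewrite ?lexx ?ler01.
rewrite indicE memNset// => Vl; have lN := ltn_ord l.
by rewrite (dV _ _ Vl VN) ltnn in lN.
Qed.

Lemma sum_indic_in (R : realType) (T : Type) (V : nat -> set T) N (l : 'I_N) x (f : nat -> R) :
  (forall l l', V l x -> V l' x -> l = l') -> V l x ->
  \sum_(l' < N) \1_(V l') x * f l' = f l.
Proof.
move=> dV Vl; rewrite (bigD1 l)//= big1 ?addr0 => [|l' l'l]; first by rewrite indicE mem_set// mul1r.
rewrite indicE memNset ?mul0r// => Vl'; move/eqP: l'l; apply.
exact/val_inj/dV.
Qed.

Lemma sum_indic_out (R : realType) (T : Type) (V : nat -> set T) N x (f : nat -> R) :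
  (~ exists l : 'I_N, V l x) -> \sum_(l < N) \1_(V l) x * f l = 0.
Proof.
move=> nV; rewrite big1// => l _; rewrite indicE memNset ?mul0r// => Vl.
by apply: nV; exists l.
Qed.

Section Weights.
Variables (R : realType) (T : ptopologicalType) (Z : pseudoPMetricType R).
Variables (q : Pmeas R T) (mu : Pmeas R Z) (phi : T -> Z).
Hypothesis cphi : continuous phi.
Hypothesis qmu : forall A : set Z, measurable (A : set (borel Z)) -> q (phi @^-1` A) = mu A.

(** The densities [f l] are approximated in L1 by [v l]. The factor [eta l] localizes without
    increasing the error, since [f l] vanishes almost everywhere where eta l < 1. Division by [s]
    brings the sum below 1 and moves each weight by at most s - 1, which the errors |u i - f i|
    control in mean because the densities of the disjoint [V l] sum to at most 1 almost
    everywhere. *)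
Lemma continuous_weights (N : nat) (V : nat -> set T) (eta : nat -> Z -> R) (e : R) :
  (forall l, measurable (V l : set (borel T))) ->
  (forall l l' x, V l x -> V l' x -> l = l') ->
  (forall l, bcont (eta l)) -> (forall l z, 0 <= eta l z <= 1) ->
  (forall l x, V l x -> eta l (phi x) = 1) -> 0 < e ->
  exists w : nat -> Z -> R, [/\ forall l, bcont (w l), forall l z, 0 <= w l z,
    forall l z, w l z != 0 -> 0 < eta l z,
    forall z, \sum_(l < N) w l z <= 1 &
    forall l (C : R) g, (l < N)%N -> bmeas g -> (forall z, `|g z| <= C) ->
      `|Ex mu (fun z => w l z * g z) - Ex q (fun x => \1_(V l) x * g (phi x))| <= C * e].
Proof.
move=> mV dV beta eta01 etaV e0.
have [f hf] := choice (fun l => sub_marginal_density cphi qmu (mV l)).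
have bf l : bmeas (f l) by have [] := hf l.
have f01 l z : 0 <= f l z <= 1 by have [] := hf l.
have fE l g : bmeas g -> Ex mu (fun x => f l x * g x) = Ex q (fun x => \1_(V l) x * g (phi x)).
  by have [_ _] := hf l; apply.
(* N + 1 errors add up: the weight's own and the N entering the normalization. *)
pose e1 := e / N.+1%:R; have e10 : 0 < e1 by rewrite divr_gt0.
have [v hv] := choice (fun l => bcont_L1_dense mu (bf l) e10).
pose u l z := Num.max 0 (v l z) * eta l z.
have bu l : bcont (u l).
  by apply: bcontM => //; apply: bcont_max; [exact: bcont_cst|have [] := hv l].
have u0 l z : 0 <= u l z.
  by have /andP[h0 _] := eta01 l z; rewrite mulr_ge0// le_max lexx.
have bu' l := bcont_bmeas (bu l).
have bd l : bmeas (fun z => `|u l z - f l z|) by exact/bmeas_norm/bmeasB.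
have uf l : Ex mu (fun z => `|u l z - f l z|) <= e1.
  have [bv hvl] := hv l; have bv' := bcont_bmeas bv; have be' := bcont_bmeas (beta l).
  have b1 : bmeas (fun z => `|f l z - v l z|) by exact/bmeas_norm/bmeasB.
  have bc1 := bmeas_cst Z (1 : R).
  have b2 : bmeas (fun z => f l z * (1 - eta l z)) by apply: bmeasM => //; exact: bmeasB.
  have E0 : Ex mu (fun z => f l z * (1 - eta l z)) = 0.
    rewrite fE; last exact: bmeasB.
    rewrite (_ : (fun x => _) = fun=> 0) ?Ex_cst//; apply/funext => x.
    rewrite indicE; case: (boolP (x \in V l)) => [|_]; last by rewrite mul0r.
    by rewrite inE => /etaV ->; rewrite subrr mulr0.
  rewrite (le_trans _ hvl)// -[leRHS]addr0 -E0 -ExD//; apply: Ex_le => //; first exact: bmeasD.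
  move=> z; have /andP[h0 h1] := eta01 l z; have /andP[h2 h3] := f01 l z.
  rewrite /u (_ : _ - f l z = (Num.max 0 (v l z) - f l z) * eta l z - f l z * (1 - eta l z)); last by ring.
  rewrite (le_trans (ler_normB _ _))// [X in _ + X]ger0_norm ?mulr_ge0 ?subr_ge0// lerD2r.
  rewrite normrM (ger0_norm h0) (@le_trans _ _ `|Num.max 0 (v l z) - f l z|)//.
    by rewrite ler_piMr.
  case: (leP 0 (v l z)) => hv0; first by rewrite distrC.
  by rewrite sub0r normrN ger0_norm// ger0_norm; lra.
pose s z := Num.max 1 (\sum_(l < N) u l z).
have bs : bcont s by apply: bcont_max; [exact: bcont_cst|exact: bcont_sum].
have s1 z : 1 <= s z by rewrite le_max lexx.
have s0 z : 0 < s z by exact: lt_le_trans (s1 z).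
have bw l : bcont (fun z => u l z / s z) by exact: bcont_div.
exists (fun l z => u l z / s z); split=> //.
- by move=> l z; rewrite divr_ge0// ltW.
- move=> l z; apply: contraNT; rewrite -leNgt => h.
  have /andP[h0 _] := eta01 l z.
  by rewrite /u (_ : eta l z = 0) ?mulr0 ?mul0r//; apply/eqP; rewrite eq_le h h0.
- move=> z; rewrite -mulr_suml ler_pdivrMr// mul1r.
  by rewrite le_max lexx orbT.
- move=> l C g lN bg gC; rewrite -fE//.
  have bwl := bcont_bmeas (bw l).
  have bwf : bmeas (fun z => `|u l z / s z - f l z|) by exact/bmeas_norm/bmeasB.
  have C0 : 0 <= C by rewrite (le_trans _ (gC point)).
  rewrite -ExB; [|exact: bmeasM|exact: bmeasM].
  apply: (@le_trans _ _ (Ex mu (fun z => C * `|u l z / s z - f l z|))).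
    apply: (le_trans (Ex_norm _ _)); first by apply: bmeasB; exact: bmeasM.
    apply: Ex_le; [by apply: bmeas_norm; apply: bmeasB; exact: bmeasM|exact: bmeasZ|].
    by move=> z; rewrite -mulrBl normrM mulrC ler_wpM2r.
  rewrite ExZ// ler_wpM2l//.
  pose G z := Num.max 0 (\sum_(l < N) f l z - 1).
  have bF : bmeas (fun z => \sum_(l < N) f l z) by exact: bmeas_sum.
  have bc1 := bmeas_cst Z (1 : R).
  have bG : bmeas G by apply: bmeas_max; [exact: bmeas_cst|exact: bmeasB].
  have EG : Ex mu G <= 0.
    pose A := [set z | 1 < \sum_(l < N) f l z].
    have mA : measurable (A : set (borel Z)).
      rewrite -[X in measurable X]setTI.
      by have := bF.1 measurableT _ (measurable_itv `]1, +oo[); rewrite set_itvoy.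
    have bA := bmeas_indic R mA.
    have -> : G = fun z => \sum_(l < N) f l z * \1_A z - \1_A z.
      apply/funext => z; rewrite /G indicE; case: (boolP (z \in A)) => /=.
        rewrite inE => /ltW h; rewrite -mulr_suml mulr1.
        by apply/max_idPr; rewrite subr_ge0.
      rewrite notin_setE => /negP; rewrite -leNgt => h.
      rewrite [X in _ = X - _]big1 ?subr0 => [|i _]; last by rewrite mulr0.
      by apply/max_idPl; rewrite subr_le0.
    rewrite ExB//; last by apply: bmeas_sum => i; exact: bmeasM.
    rewrite Ex_sum; last by move=> i; exact: bmeasM.
    rewrite subr_le0 -(Ex_marginal cphi bA qmu).
    under eq_bigr do rewrite fE//.
    have bI i := bmeas_indic R (mV i).
    have bAp := bmeas_comp cphi bA.
    rewrite -Ex_sum; last by move=> i; exact: bmeasM.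
    apply: Ex_le => //; first by apply: bmeas_sum => i; exact: bmeasM.
    move=> x; rewrite -mulr_suml ler_piMl//.
    by apply: sum_indic_le1 => i i'; exact: dV.
  apply: (@le_trans _ _ (Ex mu (fun z => (`|u l z - f l z| + \sum_(i < N) `|u i z - f i z|) + G z))).
    have bS : bmeas (fun z => \sum_(i < N) `|u i z - f i z|) by exact: bmeas_sum.
    apply: Ex_le => //; first by apply: bmeasD => //; exact: bmeasD.
    move=> z; have ul : u l z <= s z.
      rewrite le_max; apply/orP; right; rewrite (bigD1 (Ordinal lN))//= lerDl.
      by rewrite sumr_ge0.
    have h1 : `|u l z / s z - u l z| <= s z - 1.
      rewrite distrC ger0_norm; last first.
        by rewrite subr_ge0 ler_pdivrMr// ler_peMr.
      rewrite (_ : u l z - u l z / s z = (u l z / s z) * (s z - 1)); last first.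
        by rewrite mulrBr mulr1 divfK// gt_eqF.
      by rewrite ler_piMl ?subr_ge0// ler_pdivrMr// mul1r.
    have h2 : s z - 1 <= \sum_(i < N) `|u i z - f i z| + G z.
      have h3 : \sum_(i < N) u i z <= \sum_(i < N) `|u i z - f i z| + \sum_(i < N) f i z.
        rewrite -big_split/=; apply: ler_sum => i _.
        by rewrite -lerBlDr ler_norm.
      have h4 : \sum_(i < N) f i z - 1 <= G z by rewrite le_max lexx orbT.
      have h5 : 0 <= G z by rewrite le_max lexx.
      have h6 : 0 <= \sum_(i < N) `|u i z - f i z| by rewrite sumr_ge0.
      rewrite lerBlDr ge_max; apply/andP; split; lra.
    rewrite (le_trans (ler_distD (u l z) _ _))// addrC -addrA lerD2l.
    exact: le_trans h2.
  have bS : bmeas (fun z => \sum_(i < N) `|u i z - f i z|) by exact: bmeas_sum.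
  rewrite !ExD//; last exact: bmeasD.
  rewrite Ex_sum//.
  have : \sum_(i < N) Ex mu (fun z => `|u i z - f i z|) <= N%:R * e1.
    apply: (@le_trans _ _ (\sum_(i < N) e1)); first by apply: ler_sum => i _; exact: uf.
    by rewrite sumr_const card_ord mulr_natl.
  have : e = e1 + N%:R * e1.
    by rewrite /e1 -[X in X + _]mul1r -mulrDl nat1r mulrCA divff ?mulr1// pnatr_eq0.
  have := uf l; lra.
Qed.

End Weights.

Section RectCover.
Variables (R : realType) (Z X : pseudoPMetricType R).
Hypotheses (sepZ : separable_space Z) (sepX : separable_space X).
Variables (q : Pmeas R (Z * X)%type) (m : nat) (f : 'I_m -> Z * X -> R) (M e : R).
Hypothesis bf : forall j, bcont (f j : (Z * X)%type -> R).
Hypothesis fM : forall j p, `|f j p| <= M.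
Hypotheses (M0 : 0 <= M) (e0 : 0 < e).

(** Products of balls around dense points are coded by integers; a code with too large an
    oscillation gets empty sets and zero functions, so all codes can be kept. By continuity the good
    rectangles cover the product, [seqDU] makes them disjoint, and finitely many carry mass 1 -
    e. *)
Lemma rectangle_cover : exists (N : nat) (eta : nat -> Z -> R) (h : nat -> X -> R)
    (U : nat -> set X) (V : nat -> set (Z * X)) (c : nat -> 'I_m -> R),
  [/\ [/\ forall l, bcont (eta l), forall l z, 0 <= eta l z <= 1,
        forall l, bcont (h l) & forall l x, 0 <= h l x <= 1],
      [/\ forall l, open (U l), forall l x, U l x -> h l x = 1,
        forall l, measurable (V l : set (borel (Z * X)%type)),
        forall l l' p, V l p -> V l' p -> l = l' &
        forall l p, V l p -> eta l p.1 = 1 /\ U l p.2],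
      forall l j z x, 0 < eta l z -> 0 < h l x -> `|f j (z, x) - c l j| <= e,
      forall l j, `|c l j| <= M &
      1 - e <= \sum_(l < N) Ex q (\1_(V l) : Z * X -> R)].
Proof.
have [dZ ddZ] := separable_dense_seq sepZ.
have [dX ddX] := separable_dense_seq sepX.
have r0 (k : nat) : 0 < k.+1%:R^-1 :> R by rewrite invr_gt0.
have [bZ hbZ] := choice (fun ik : nat * nat => bump_exists (dZ ik.1) (r0 ik.2)).
have [bX hbX] := choice (fun ik : nat * nat => bump_exists (dX ik.1) (r0 ik.2)).
(* Radii are doubled because a bump may be positive up to twice its radius. *)
pose osc (t : nat * nat * nat) (c : 'I_m -> R) := let: (i, j, k) := t in
  (forall a, `|c a| <= M) /\ forall a z x, ball (dZ i) (k.+1%:R^-1 + k.+1%:R^-1) z ->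
    ball (dX j) (k.+1%:R^-1 + k.+1%:R^-1) x -> `|f a (z, x) - c a| <= e.
have data (l : nat) : exists ehUWc : (Z -> R) * (X -> R) * set X * set Z * ('I_m -> R),
    let: (eta, h, U, W, c) := ehUWc in
    [/\ [/\ bcont eta, forall z, 0 <= eta z <= 1, bcont h & forall x, 0 <= h x <= 1],
      [/\ open U, forall x, U x -> h x = 1, open W & forall z, W z -> eta z = 1],
      forall j z x, 0 < eta z -> 0 < h x -> `|f j (z, x) - c j| <= e,
      forall j, `|c j| <= M &
      forall i j k c', unpickle l = Some (i, j, k) -> osc (i, j, k) c' ->
        W = interior (ball (dZ i) k.+1%:R^-1) /\ U = interior (ball (dX j) k.+1%:R^-1)].
  have [[[[i j] k] ul]|nul] := pselect (exists t : nat * nat * nat, unpickle l = Some t).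
    have [[c [cM ce]]|nc] := pselect (exists c, osc (i, j, k) c).
      have [h1 h2 h3 h4] := hbZ (i, k); have [g1 g2 g3 g4] := hbX (j, k).
      exists (bZ (i, k), bX (j, k), interior (ball (dX j) k.+1%:R^-1),
        interior (ball (dZ i) k.+1%:R^-1), c); split=> //.
      - split; [exact: open_interior|by move=> x /interior_subset; exact: g3|
          exact: open_interior|by move=> x /interior_subset; exact: h3].
      - by move=> a z x /h4 hz /g4 hx; exact: ce.
      - by move=> i' j' k' c'; rewrite ul => -[<- <- <-].
    exists (fun=> 0, fun=> 0, set0, set0, fun=> 0); split=> //.
    - by split=> //; [exact: bcont_cst|move=> z; rewrite lexx ler01|exact: bcont_cst|move=> z; rewrite lexx ler01].
    - by split=> //; exact: open0.
    - by move=> a z x; rewrite ltxx.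
    - by move=> a; rewrite normr0.
    - by move=> i' j' k' c'; rewrite ul => -[<- <- <-] oc; exfalso; apply: nc; exists c'.
  exists (fun=> 0, fun=> 0, set0, set0, fun=> 0); split=> //.
  - by split=> //; [exact: bcont_cst|move=> z; rewrite lexx ler01|exact: bcont_cst|move=> z; rewrite lexx ler01].
  - by split=> //; exact: open0.
  - by move=> a z x; rewrite ltxx.
  - by move=> a; rewrite normr0.
  - by move=> i j k c' ul; exfalso; apply: nul; exists (i, j, k).
have [D hD] := choice data.
pose eta l := (D l).1.1.1.1; pose h l := (D l).1.1.1.2; pose U l := (D l).1.1.2.
pose W l := (D l).1.2; pose c l := (D l).2.
have {}hD l : [/\ [/\ bcont (eta l), forall z, 0 <= eta l z <= 1, bcont (h l) & forall x, 0 <= h l x <= 1],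
      [/\ open (U l), forall x, U l x -> h l x = 1, open (W l) & forall z, W l z -> eta l z = 1],
      forall j z x, 0 < eta l z -> 0 < h l x -> `|f j (z, x) - c l j| <= e,
      forall j, `|c l j| <= M &
      forall i j k c', unpickle l = Some (i, j, k) -> osc (i, j, k) c' ->
        W l = interior (ball (dZ i) k.+1%:R^-1) /\ U l = interior (ball (dX j) k.+1%:R^-1)].
  by have := hD l; rewrite /eta /h /U /W /c; case: (D l) => [[[[? ?] ?] ?] ?].
pose G l : set (Z * X) := [set p | W l p.1 /\ U l p.2].
have cfst : continuous (fst : (Z * X)%type -> Z) by move=> p; exact: cvg_fst.
have csnd : continuous (snd : (Z * X)%type -> X) by move=> p; exact: cvg_snd.
have mG l : measurable (G l : set (borel (Z * X)%type)).
  have [_ [oU _ oW _] _ _ _] := hD l.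
  apply: sub_sigma_algebra; apply: (@openI (Z * X)%type (fst @^-1` W l) (snd @^-1` U l)).
    by apply: open_comp => // p _; exact: cfst.
  by apply: open_comp => // p _; exact: csnd.
pose V := seqDU G.
have mV l : measurable (V l : set (borel (Z * X)%type)).
  apply: (@measurableD _ (borel (Z * X)%type)); first exact: mG.
  by apply: bigsetU_measurable => i _; exact: mG.
have dV l l' p : V l p -> V l' p -> l = l'.
  have := trivIset_seqDU G => /trivIsetP/(_ l l' I I) => disj Vl Vl'.
  apply/eqP; apply: contrapT => /negP ll'.
  have : (V l `&` V l') p by [].
  by rewrite disj.
have cover p : exists l, G l p.
  case: p => z x.
  have near_pt j : exists r : R, 0 < r /\ forall z' x', ball z r z' -> ball x r x' ->
      `|f j (z', x') - f j (z, x)| <= e.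
    have := (bf j).1 (z, x) => /cvgrPdist_le/(_ _ e0)/nbhs_ballP[r /= rp hr].
    by exists r; split=> // z' x' hz hx; rewrite distrC; apply: (hr (z', x')).
  have [rr hrr] := choice near_pt.
  pose r := \big[Num.min/1]_j rr j.
  have rp : 0 < r by apply: lt_bigmin => // j _; have [] := hrr j.
  have hr j z' x' : ball z r z' -> ball x r x' -> `|f j (z', x') - f j (z, x)| <= e.
    move=> hz hx; have [_] := hrr j; apply.
      by apply: le_ball hz; exact: (@bigmin_le_cond _ _ _ 1 j xpredT rr).
    by apply: le_ball hx; exact: (@bigmin_le_cond _ _ _ 1 j xpredT rr).
  (* Three radii: one from the point to the centre and two for the doubled ball. *)
  have [k hk] : exists k : nat, k.+1%:R^-1 < r / 3.
    exists (Num.truncn (r / 3)^-1); rewrite invf_plt ?posrE ?divr_gt0//; exact: truncnS_gt.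
  pose s : R := k.+1%:R^-1; have hs : s + (s + s) <= r by move: hk; rewrite -/s; lra.
  have s2 : 0 < s / 2 by apply: divr_gt0 => //; exact: r0.
  have [i hi] := ddZ z _ s2; have [j hj] := ddX x _ s2.
  have int_ball (Y : pseudoPMetricType R) (y0 y : Y) : ball y0 (s / 2) y -> interior (ball y0 s) y.
    move=> hy; apply/nbhs_ballP; exists (s / 2) => //= w yw.
    by rewrite [s]splitr; exact: ball_triangle yw.
  have oc : osc (i, j, k) (fun a => f a (z, x)).
    split=> // a z' x' hz hx; apply: hr.
      apply: le_ball hs _ _; apply: (@ball_triangle _ _ (dZ i)); last exact: hz.
      by apply: ball_sym; exact: (interior_subset (int_ball _ _ _ hi)).
    apply: le_ball hs _ _; apply: (@ball_triangle _ _ (dX j)); last exact: hx.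
    by apply: ball_sym; exact: (interior_subset (int_ball _ _ _ hj)).
  exists (pickle (i, j, k)).
  have [_ _ _ _ hWU] := hD (pickle (i, j, k)).
  have [WE UE] := hWU i j k _ (pickleK _) oc.
  by split=> /=; [rewrite WE|rewrite UE]; exact: int_ball.
have bV l := bmeas_indic R (mV l).
have [|||_ cv] := @Ex_cvg R (Z * X)%type q (fun N p => \sum_(l < N) (\1_(V l) p : R)) (fun=> 1) 1.
- by move=> N; exact: bmeas_sum.
- move=> N p; rewrite ger0_norm; last by apply: sumr_ge0 => l _; rewrite indicE; case: (_ \in _).
  by apply: sum_indic_le1 => l l'; exact: dV.
- move=> p; have [l Gl] := cover p.
  have [l' Vl'] : exists l', V l' p.
    have : (\bigcup_n G n) p by exists l.
    by rewrite seqDU_bigcup_eq => -[l' _ h']; exists l'.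
  apply: cvg_near_cst; near=> N.
  have lN : (l' < N)%N by near: N; exact: nbhs_infty_gt.
  apply/eqP; rewrite eq_le; apply/andP; split.
    by apply: sum_indic_le1 => i i'; exact: dV.
  rewrite (bigD1 (Ordinal lN))//= [\1_(V l') p]indicE mem_set//= lerDl.
  by apply: sumr_ge0 => i _; rewrite indicE; case: (_ \in _).
have [N hN] : exists N, 1 - e <= Ex q (fun p => \sum_(l < N) (\1_(V l) p : R)).
  rewrite Ex_cst in cv; have lt : 1 - e < 1 by rewrite ltrBlDr ltrDl.
  by have [N _ hN] := cvgr_ge _ cv _ lt; exists N; exact: (hN N (leqnn N)).
exists N, eta, h, U, V, c; split.
- by split=> l; have [[]] := hD l.
- split=> //; [by move=> l; have [_ []] := hD l|by move=> l; have [_ []] := hD l|].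
  by move=> l p [[Wl Ul] _]; split=> //; have [_ [_ _ _ hW] _ _ _] := hD l; exact: hW.
- by move=> l; have [_ _] := hD l.
- by move=> l; have [_ _ _] := hD l.
- by rewrite -Ex_sum.
Unshelve. all: by end_near. Qed.

End RectCover.

(** * Deterministic assignment of points to rectangles *)

Section Derandomize.
Variables (R : realType) (I A : finType).
Variables (w : nat -> I -> R) (g : nat -> A -> I -> R) (C : R).
Hypotheses (w0 : forall i r, 0 <= w i r) (w1 : forall i, \sum_r w i r = 1).
Hypothesis gC : forall i a r, `|g i a r| <= C.

Let mean i a := \sum_r w i r * g i a r.

(* Averaged over [r] with weights [w i], the cross term of the square vanishes. *)
Lemma derandomize_step (S : A -> R) i : exists r, 0 < w i r /\
  \sum_a (S a + (g i a r - mean i a)) ^+ 2 <= \sum_a S a ^+ 2 + #|A|%:R * (2 * C) ^+ 2.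
Proof.
apply: contrapT => /forallNP h.
pose K := \sum_a S a ^+ 2 + #|A|%:R * (2 * C) ^+ 2.
have meanC a : `|mean i a| <= C.
  rewrite (le_trans (ler_norm_sum _ _ _))//.
  apply: (@le_trans _ _ (\sum_r w i r * C)); last by rewrite -mulr_suml w1 mul1r.
  by apply: ler_sum => r _; rewrite normrM (ger0_norm (w0 i r)) ler_wpM2l.
have avg : \sum_r w i r * (\sum_a (S a + (g i a r - mean i a)) ^+ 2) <= K.
  apply: (@le_trans _ _ (\sum_r w i r * (\sum_a (S a ^+ 2 + (2 * S a * (g i a r - mean i a) + (2 * C) ^+ 2))))).
    apply: ler_sum => r _; rewrite ler_wpM2l//; apply: ler_sum => a _.
    rewrite (_ : (S a + _) ^+ 2 = S a ^+ 2 + (2 * S a * (g i a r - mean i a) + (g i a r - mean i a) ^+ 2)); last by ring.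
    rewrite !lerD2l -[leLHS]real_normK ?num_real// lerXn2r ?nnegrE//.
      by rewrite mulr_ge0// (le_trans _ (gC i a r)).
    by rewrite (le_trans (ler_normB _ _))// mulr_natl mulr2n lerD.
  under eq_bigr do rewrite mulr_sumr.
  rewrite exchange_big/=.
  have -> : K = \sum_a (S a ^+ 2 + (2 * C) ^+ 2).
    by rewrite big_split/= /K sumr_const mulr_natl.
  apply: ler_sum => a _.
  have -> : \sum_r w i r * (S a ^+ 2 + (2 * S a * (g i a r - mean i a) + (2 * C) ^+ 2)) =
      \sum_r (w i r * (S a ^+ 2 + (2 * C) ^+ 2 - 2 * S a * mean i a) + 2 * S a * (w i r * g i a r)).
    by apply: eq_bigr => r _; ring.
  rewrite big_split/= -mulr_suml w1 -mulr_sumr -/(mean i a).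
  by rewrite le_eqVlt; apply/orP; left; apply/eqP; ring.
have [r wr] : exists r, 0 < w i r.
  apply: contrapT => /forallNP nw; have := w1 i; rewrite big1 => [/esym/eqP|r _].
    by rewrite oner_eq0.
  by apply/eqP; rewrite eq_le w0 leNgt andbT; apply/negP.
have : \sum_r w i r * K < \sum_r w i r * (\sum_a (S a + (g i a r - mean i a)) ^+ 2).
  have le r' : w i r' * K <= w i r' * (\sum_a (S a + (g i a r' - mean i a)) ^+ 2).
    have [wr'|] := ltP 0 (w i r').
      rewrite ler_wpM2l// leNgt; apply/negP => lt; apply: (h r'); split=> //.
      exact: ltW.
    by move=> wr'; have -> : w i r' = 0 by [apply/eqP; rewrite eq_le wr' w0]; rewrite !mul0r.
  rewrite (bigD1 r)//= [ltRHS](bigD1 r)//= ltr_leD//; last by apply: ler_sum => r' _; exact: le.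
  by rewrite ltr_pM2l// ltNge; apply/negP => hr; apply: (h r).
by rewrite -mulr_suml w1 mul1r ltNge avg.
Qed.

(** The choices are made one index at a time. The summed squared deviations grow at most linearly in
    [n], so every deviation is of order sqrt(n), negligible against [n]. *)
Lemma derandomize n : exists rho : nat -> I, (forall i, (i < n)%N -> 0 < w i (rho i)) /\
  forall a, (\sum_(i < n) g i a (rho i) - \sum_(i < n) mean i a) ^+ 2 <= n%:R * (#|A|%:R * (2 * C) ^+ 2).
Proof.
suff [rho [h1 h2]] : exists rho : nat -> I, (forall i, (i < n)%N -> 0 < w i (rho i)) /\
    \sum_a (\sum_(i < n) (g i a (rho i) - mean i a)) ^+ 2 <= n%:R * (#|A|%:R * (2 * C) ^+ 2).
  exists rho; split=> // a; apply: le_trans h2.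
  rewrite -sumrB (bigD1 a)//= lerDl; apply: sumr_ge0 => b _; exact: sqr_ge0.
elim: n => [|n [rho [h1 h2]]].
  have [r0 _] : exists r : I, True.
    apply: contrapT => /forallNP nI; have := w1 0; rewrite big1 => [/esym/eqP|r _].
      by rewrite oner_eq0.
    by have := nI r.
  exists (fun=> r0); split=> //; rewrite mul0r big1// => a _.
  by rewrite big_ord0 expr0n.
have [r [wr hr]] := derandomize_step (fun a => \sum_(i < n) (g i a (rho i) - mean i a)) n.
exists (fun i => if i == n then r else rho i); split.
  move=> i; rewrite ltnS leq_eqVlt; case: eqP => [->//|_] /=; exact: h1.
rewrite (eq_bigr (fun a => (\sum_(i < n) (g i a (rho i) - mean i a) + (g n a r - mean n a)) ^+ 2)).
  apply: (le_trans hr); move: (#|A|%:R * _) h2 => K h2.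
  by rewrite (_ : n.+1%:R * K = n%:R * K + K) ?lerD2r// -natr1 mulrDl mul1r.
move=> a _; rewrite big_ord_recr/= eqxx; congr ((_ + _) ^+ 2).
by apply: eq_bigr => i _; rewrite (ltn_eqF (ltn_ord i)).
Qed.

End Derandomize.

Lemma big_option (R : realType) (N : nat) (F : option 'I_N -> R) :
  \sum_r F r = F None + \sum_(l < N) F (Some l).
Proof.
rewrite (bigD1 None)//=; congr (_ + _).
rewrite (reindex_omap Some id)/=; last by case.
by apply: eq_bigl => l; rewrite eqxx.
Qed.

(** Here [y i] is the value at the i-th point, [c l] its target, [p l] the mass of piece l, and [t]
    a Markov weight: at least 1 where the target may be missed, with average at most [s]. The four
    errors are the oscillation, the missed targets, the unassigned indices and the wrong counts. *)
Lemma assignment_average (R : realType) (N n : nat) (rho : nat -> option 'I_N) (y t : nat -> R)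
    (c p : 'I_N -> R) (M e d s : R) :
  (forall i, `|y i| <= M) -> (forall l, `|c l| <= M) -> 0 <= e -> (forall i, 0 <= t i) ->
  (forall i l, (i < n)%N -> rho i = Some l -> 1 <= t i \/ `|y i - c l| <= e) ->
  (forall l, `|\sum_(i < n) (rho i == Some l)%:R - n%:R * p l| <= n%:R * d) ->
  1 - e <= \sum_l p l -> \sum_(i < n) t i <= n%:R * s ->
  `|\sum_(i < n) y i - n%:R * \sum_l c l * p l| <=
    n%:R * (e + 2 * M * s + M * (e + N%:R * d) + M * (N%:R * d)).
Proof.
move=> yM cM e0 t0 good cnt pe ts; have M0 : 0 <= M by rewrite (le_trans _ (yM 0%N)).
pose cc i := if rho i is Some l then c l else 0.
have ccE i : cc i = \sum_l c l * (rho i == Some l)%:R.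
  rewrite /cc; case: (rho i) => [l|]; last by rewrite big1// => l _; rewrite mulr0.
  rewrite (bigD1 l)//= eqxx mulr1 big1 ?addr0// => l' l'l.
  by rewrite (inj_eq Some_inj) eq_sym (negbTE l'l) mulr0.
have noneE i : (rho i == None)%:R = 1 - \sum_l (rho i == Some l)%:R :> R.
  case: (rho i) => [l|]; last by rewrite big1 ?subr0.
  rewrite (bigD1 l)//= eqxx big1 ?addr0 ?subrr// => l' l'l.
  by rewrite (inj_eq Some_inj) eq_sym (negbTE l'l).
have h1 : `|\sum_(i < n) y i - \sum_(i < n) cc i| <=
    n%:R * e + 2 * M * (n%:R * s) + M * \sum_(i < n) (rho i == None)%:R.
  apply: (@le_trans _ _ (\sum_(i < n) (e + 2 * M * t i + M * (rho i == None)%:R))).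
    rewrite -sumrB (le_trans (ler_norm_sum _ _ _))//; apply: ler_sum => i _.
    have Mt : 0 <= 2 * M * t i by rewrite mulr_ge0// mulr_ge0.
    rewrite /cc; case rE : (rho i) => [l|] /=; last first.
      by rewrite subr0 mulr1; have := yM i; lra.
    rewrite mulr0 addr0; have [ti|h] := good i l (ltn_ord i) rE; last by lra.
    have : 2 * M * 1 <= 2 * M * t i by rewrite ler_wpM2l// mulr_ge0.
    have := ler_normB (y i) (c l); have := yM i; have := cM l; lra.
  rewrite !big_split/= sumr_const card_ord -[e *+ n]mulr_natl -!mulr_sumr.
  by rewrite lerD2r lerD2l ler_wpM2l// mulr_ge0.
have h2 : `|\sum_(i < n) cc i - n%:R * \sum_l c l * p l| <= M * (N%:R * (n%:R * d)).
  have -> : \sum_(i < n) cc i - n%:R * \sum_l c l * p l =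
      \sum_l c l * (\sum_(i < n) (rho i == Some l)%:R - n%:R * p l).
    under eq_bigr do rewrite ccE.
    rewrite exchange_big/= mulr_sumr -sumrB; apply: eq_bigr => l _.
    by rewrite mulrBr mulr_sumr mulrCA.
  rewrite (le_trans (ler_norm_sum _ _ _))//.
  apply: (@le_trans _ _ (\sum_(l < N) M * (n%:R * d))).
    by apply: ler_sum => l _; rewrite normrM ler_pM.
  by rewrite sumr_const card_ord -[leLHS]mulr_natl mulrCA.
have h3 : \sum_(i < n) (rho i == None)%:R <= n%:R * e + N%:R * (n%:R * d).
  under eq_bigr do rewrite noneE.
  rewrite sumrB sumr_const card_ord exchange_big/=.
  have : n%:R * (1 - e) <= n%:R * \sum_l p l by rewrite ler_wpM2l.
  have : \sum_l n%:R * p l <= \sum_(l < N) (\sum_(i < n) (rho i == Some l)%:R + n%:R * d).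
    apply: ler_sum => l _; have := cnt l; rewrite ler_norml; lra.
  rewrite -mulr_sumr big_split/= sumr_const card_ord -[_ *+ N]mulr_natl; lra.
have h4 := ler_wpM2l M0 h3.
have := ler_distD (\sum_(i < n) cc i) (\sum_(i < n) y i) (n%:R * \sum_l c l * p l).
move: h1 h2 h4; set A := \sum_(i < n) y i; set B := \sum_(i < n) cc i; set D := _ * \sum_l _.
set nn := \sum_(_ < _) _.
have -> : n%:R * (e + 2 * M * s + M * (e + N%:R * d) + M * (N%:R * d)) =
  (n%:R * e + 2 * M * (n%:R * s)) + M * (n%:R * e + N%:R * (n%:R * d)) + M * (N%:R * (n%:R * d)) by ring.
move: `|A - B| `|B - D| `|A - D| (M * nn) (M * (_ + _)) (M * (N%:R * _)) (_ + 2 * _ * _) => *; lra.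
Qed.

Lemma Ex_simple_approx (R : realType) (T : ptopologicalType) (q : Pmeas R T) (f : T -> R)
    (N : nat) (V : nat -> set T) (c : nat -> R) (M e : R) :
  bmeas f -> (forall x, `|f x| <= M) -> 0 <= e ->
  (forall l, measurable (V l : set (borel T))) ->
  (forall l l' x, V l x -> V l' x -> l = l') ->
  (forall l x, V l x -> `|f x - c l| <= e) ->
  1 - e <= \sum_(l < N) Ex q (\1_(V l) : T -> R) ->
  `|Ex q f - \sum_(l < N) c l * Ex q (\1_(V l) : T -> R)| <= e + M * e.
Proof.
move=> bf fM e0 mV dV fc qe; have M0 : 0 <= M by rewrite (le_trans _ (fM point)).
have bV l := bmeas_indic R (mV l).
have bcV l : bmeas (fun x => c l * \1_(V l) x) by exact: bmeasZ.
have bS : bmeas (fun x => \sum_(l < N) c l * \1_(V l) x) by exact: bmeas_sum.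
have bN : bmeas (fun x => \sum_(l < N) (\1_(V l) x : R)) by exact: bmeas_sum.
have -> : \sum_(l < N) c l * Ex q (\1_(V l) : T -> R) = Ex q (fun x => \sum_(l < N) c l * \1_(V l) x).
  by rewrite Ex_sum//; apply: eq_bigr => l _; rewrite ExZ.
rewrite -ExB//; apply: (le_trans (Ex_norm _ _)); first exact: bmeasB.
have bc1 := bmeas_cst T (1 : R).
have b1 : bmeas (fun x => 1 - \sum_(l < N) (\1_(V l) x : R)) by exact: bmeasB.
apply: (@le_trans _ _ (Ex q (fun x => e + M * (1 - \sum_(l < N) (\1_(V l) x : R))))).
  apply: Ex_le; [by apply: bmeas_norm; exact: bmeasB|by apply: bmeasD; [exact: bmeas_cst|exact: bmeasZ]|].
  move=> x; have cE : \sum_(l < N) c l * \1_(V l) x = \sum_(l < N) \1_(V l) x * c l.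
    by apply: eq_bigr => l _; rewrite mulrC.
  have oneE : \sum_(l < N) (\1_(V l) x : R) = \sum_(l < N) \1_(V l) x * 1.
    by apply: eq_bigr => l _; rewrite mulr1.
  rewrite cE oneE; have [[l Vl]|nV] := pselect (exists l : 'I_N, V l x).
    rewrite (sum_indic_in c (fun l l' => dV l l' x) Vl) (sum_indic_in (fun=> 1) (fun l l' => dV l l' x) Vl).
    by rewrite subrr mulr0 addr0 fc.
  by rewrite (sum_indic_out c nV) (sum_indic_out (fun=> 1) nV) !subr0 mulr1; have := fM x; lra.
rewrite ExD; [|exact: bmeas_cst|exact: bmeasZ].
rewrite Ex_cst ExZ// ExB// Ex_cst Ex_sum// lerD2l ler_wpM2l//; lra.
Qed.

Section Assignment.
Variables (R : realType) (Z : completePseudoMetricType R) (z : nat -> nat -> Z) (mu : Pmeas R Z).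
Hypothesis Hmu : forall f : Z -> R, bcont f ->
  (fun n : nat => ((n.+1)%:R)^-1 * \sum_(i < n.+1) f (z n.+1 i)) @ \oo --> Ex mu f.

Lemma avg_near (f : Z -> R) (e : R) : bcont f -> 0 < e -> \forall n \near \oo,
  `|\sum_(i < n.+1) f (z n.+1 i) - n.+1%:R * Ex mu f| <= n.+1%:R * e.
Proof.
move=> bf e0; have := Hmu bf => /cvgrPdist_le/(_ _ e0); apply: filterS => n.
rewrite distrC => h.
have -> : \sum_(i < n.+1) f (z n.+1 i) - n.+1%:R * Ex mu f =
    n.+1%:R * ((n.+1%:R)^-1 * \sum_(i < n.+1) f (z n.+1 i) - Ex mu f).
  by rewrite mulrBr mulrA divff ?mul1r// pnatr_eq0.
by rewrite normrM ger0_norm// ler_pM2l.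
Qed.

(** The i-th point takes piece l with weight [w l] and no piece with the remaining weight. Counts
    and total cost have means that converge by [avg_near], and [derandomize] finds one choice close
    to all these means. *)
Lemma assignment_near (N : nat) (w phi : nat -> Z -> R) (C d : R) :
  (forall l, bcont (w l)) -> (forall l x, 0 <= w l x) -> (forall x, \sum_(l < N) w l x <= 1) ->
  (forall l, bcont (phi l)) -> (forall l x, 0 <= phi l x <= C) -> 0 < d ->
  \forall n \near \oo, exists rho : nat -> option 'I_N,
    [/\ forall i l, (i < n.+1)%N -> rho i = Some l -> 0 < w l (z n.+1 i),
      forall l, `|\sum_(i < n.+1) (rho i == Some l)%:R - n.+1%:R * Ex mu (w l)| <= n.+1%:R * d &
      `|\sum_(i < n.+1) (if rho i is Some l then phi l (z n.+1 i) else 0) -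
        n.+1%:R * Ex mu (fun x => \sum_(l < N) w l x * phi l x)| <= n.+1%:R * d].
Proof.
move=> bw w0 w1 bphi phiC d0; have d2 : 0 < d / 2 by rewrite divr_gt0.
have C0 : 0 <= C by have /andP[] := phiC 0%N point; exact: le_trans.
pose D := 1 + C; pose K : R := #|{: option 'I_N}|%:R * (2 * D) ^+ 2.
have bwphi : bcont (fun x => \sum_(l < N) w l x * phi l x) by apply: bcont_sum => l; exact: bcontM.
have near_w : \forall n \near \oo, forall l, List.In l (enum 'I_N) ->
    `|\sum_(i < n.+1) w l (z n.+1 i) - n.+1%:R * Ex mu (w l)| <= n.+1%:R * (d / 2).
  elim: (enum 'I_N) => [|l s ih]; first exact: nearW.
  apply: filterS2 ih (avg_near (bw l) d2) => n h1 h2 l' [<-//|]; exact: h1.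
near=> n.
have hw (l : 'I_N) : `|\sum_(i < n.+1) w l (z n.+1 i) - n.+1%:R * Ex mu (w l)| <= n.+1%:R * (d / 2).
  have hl : List.In l (enum 'I_N) by apply: mem_In; rewrite mem_enum.
  by move: l hl; near: n.
have hphi : `|\sum_(i < n.+1) \sum_(l < N) w l (z n.+1 i) * phi l (z n.+1 i) -
    n.+1%:R * Ex mu (fun x => \sum_(l < N) w l x * phi l x)| <= n.+1%:R * (d / 2).
  by near: n; exact: avg_near.
(* This makes the square-root deviation at most (n + 1) d / 2; the other half of the error comes
   from [avg_near]. *)
have hK : K / (d / 2) ^+ 2 <= n%:R by near: n; exact: nbhs_infty_ger.
pose wt i (r : option 'I_N) : R := if r is Some l then w l (z n.+1 i) else 1 - \sum_(l < N) w l (z n.+1 i).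
(* [option 'I_N] also indexes the tests: [Some l] counts piece l, [None] measures the cost. *)
pose g i (a r : option 'I_N) : R := if a is Some l then (r == Some l)%:R else
  if r is Some l then phi l (z n.+1 i) else 0.
have wt0 i r : 0 <= wt i r by case: r => [l|] /=; rewrite ?subr_ge0.
have wt1 i : \sum_r wt i r = 1 by rewrite big_option/= subrK.
have gD i a r : `|g i a r| <= D.
  have h0 : 0 <= D by rewrite addr_ge0.
  case: a => [l|] /=; first by case: eqP => _; rewrite ?normr1 ?normr0// lerDl.
  case: r => [l|] /=; last by rewrite normr0.
  by have /andP[h1 h2] := phiC l (z n.+1 i); rewrite ger0_norm// (le_trans h2)// lerDr.
have [rho [rho0 hrho]] := derandomize wt0 wt1 gD n.+1.
have dev (x : R) : x ^+ 2 <= n.+1%:R * K -> `|x| <= n.+1%:R * (d / 2).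
  move=> h; have nd : 0 <= n.+1%:R * (d / 2) by rewrite mulr_ge0// ltW.
  rewrite -ler_sqr ?nnegrE// real_normK ?num_real//.
  rewrite (le_trans h)// exprMn expr2 -mulrA ler_pM2l//.
  rewrite ler_pdivrMr ?exprn_gt0// in hK; rewrite (le_trans hK)// ler_wpM2r ?sqr_ge0//.
  by rewrite ler_nat.
exists rho; split.
- by move=> i l /rho0 + rE; rewrite rE.
- move=> l; have := dev _ (hrho (Some l)); have := hw l.
  rewrite [X in _ -> `|_ - X| <= _ -> _](eq_bigr (fun i : 'I_n.+1 => w l (z n.+1 i))); last first.
    move=> i _; rewrite (bigD1 (Some l))//= eqxx mulr1 big1 ?addr0// => r /negbTE ->.
    by rewrite mulr0.
  move=> h1 h2; rewrite [leRHS](_ : _ = n.+1%:R * (d / 2) + n.+1%:R * (d / 2)); last by field.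
  rewrite (le_trans (ler_distD (\sum_(i < n.+1) w l (z n.+1 i)) _ _))//.
  exact: lerD.
- have := dev _ (hrho None); have := hphi.
  rewrite [X in _ -> `|_ - X| <= _ -> _](eq_bigr (fun i : 'I_n.+1 => \sum_(l < N) w l (z n.+1 i) * phi l (z n.+1 i))); last first.
    by move=> i _; rewrite big_option/= mulr0 add0r.
  move=> h1 h2; rewrite [leRHS](_ : _ = n.+1%:R * (d / 2) + n.+1%:R * (d / 2)); last by field.
  rewrite (le_trans (ler_distD (\sum_(i < n.+1) \sum_(l < N) w l (z n.+1 i) * phi l (z n.+1 i)) _ _))//.
  exact: lerD.
Unshelve. all: by end_near. Qed.

End Assignment.

(** * Cost of prescribing a rectangle *)

Section CappedCost.
Variables (R : realType) (Z X : ptopologicalType).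
Variables (P : nat -> Z -> Pmeas R X) (J : Z -> X -> \bar R).
Hypothesis Hfeller : forall k : nat, (0 < k)%N -> feller (P k).
Hypothesis HLDP : forall z0 : Z, kLDP (fun k => P k z0) (J z0).
Variables (h : X -> R) (L : R).
Hypotheses (bh : bcont h) (h01 : forall x, 0 <= h x <= 1) (L0 : 0 <= L).

(* Scaled exponential cost of keeping [h] positive, capped at [L] so that it stays bounded and continuous in [z]. *)
Definition capped_cost (k : nat) (z : Z) : R :=
  - ((k.+1%:R)^-1 * ln (Num.max (Ex (P k.+1 z) h) (expR (- (k.+1%:R * L))))).

Let max_gt0 k z : 0 < Num.max (Ex (P k.+1 z) h) (expR (- (k.+1%:R * L))).
Proof. by rewrite lt_max expR_gt0 orbT. Qed.

Lemma capped_costE k z :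
  expR (- (k.+1%:R * capped_cost k z)) = Num.max (Ex (P k.+1 z) h) (expR (- (k.+1%:R * L))).
Proof.
by rewrite /capped_cost mulrN opprK mulrA divff ?pnatr_eq0// mul1r lnK// posrE.
Qed.

Lemma capped_cost_bnd k z : 0 <= capped_cost k z <= L.
Proof.
have k0 : 0 < k.+1%:R :> R by [].
apply/andP; split.
  rewrite -(ler_pM2l k0) mulr0 -lerN2 oppr0 -ler_expR capped_costE expR0 ge_max.
  apply/andP; split; last by rewrite -[leRHS]expR0 ler_expR lerNl oppr0 mulr_ge0.
  rewrite -[leRHS](Ex_cst (P k.+1 z)); apply: Ex_le; [exact: bcont_bmeas|exact: bmeas_cst|].
  by move=> x; have /andP[] := h01 x.
by rewrite -(ler_pM2l k0) -lerN2 -ler_expR capped_costE le_max lexx orbT.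
Qed.

Lemma capped_cost_lt k z : capped_cost k z < L ->
  expR (- (k.+1%:R * capped_cost k z)) = Ex (P k.+1 z) h.
Proof.
have k0 : 0 < k.+1%:R :> R by [].
rewrite -(ltr_pM2l k0) -ltrN2 -ltr_expR capped_costE lt_max ltxx orbF => lt.
by apply/max_idPl; exact: ltW.
Qed.

Lemma capped_cost_bcont k : bcont (capped_cost k).
Proof.
split; last first.
  by exists L => z; have /andP[h0 hL] := capped_cost_bnd k z; rewrite ger0_norm.
move=> z; apply: cvgN; apply: cvgM; first exact: cvg_cst.
have c1 : continuous (fun z => Num.max (Ex (P k.+1 z) h) (expR (- (k.+1%:R * L)))).
  move=> y; apply: (@continuous_max _ _ (fun z => Ex (P k.+1 z) h) (fun=> expR (- (k.+1%:R * L))) y).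
    exact: (Hfeller (ltn0Sn k) bh).
  exact: cvg_cst.
exact: (cvg_comp _ _ (c1 z) (continuous_ln (max_gt0 k z))).
Qed.

(** As h = 1 on the open set [U], the mean of [h] is at least P(U), which the LDP bounds below by
    exp(- k (J z x + e)). The cap only lowers the cost. *)
Lemma capped_cost_le (U : set X) z x : open U -> (forall y, U y -> h y = 1) -> U x ->
  ((rlimsup (fun k => capped_cost k z))%:E <= J z x)%E.
Proof.
move=> oU hU Ux.
have J0 : (0 <= J z x)%E by have [[+ _] _] := HLDP z; apply.
case Jx : (J z x) J0 => [j| |]// _; last exact: leey.
rewrite lee_fin; apply/ler_addgt0Pr => e e0.
have costL n : `|capped_cost n z| <= L.
  by have /andP[c0 cL] := capped_cost_bnd n z; rewrite ger0_norm.
apply: (rlimsup_le costL).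
have mU : measurable (U : set (borel X)) by exact: sub_sigma_algebra.
have Jj : (J z x <= j%:E)%E by rewrite Jx.
apply: filterS (ldp_open (HLDP z) oU Ux Jj e0) => k hk.
have k0 : 0 < k.+1%:R :> R by [].
rewrite -(ler_pM2l k0) -lerN2 -ler_expR capped_costE le_max; apply/orP; left.
rewrite -mulrN opprD (le_trans hk)// -(Ex_indic _ mU).
apply: Ex_le; [exact: bmeas_indic|exact: bcont_bmeas|].
move=> y; rewrite indicE; case: (boolP (y \in U)) => /= [|_].
  by rewrite inE => /hU ->.
by have /andP[] := h01 y.
Qed.

End CappedCost.

(** * The two bounds *)

Lemma near_list (I : Type) (s : seq I) (Q : I -> nat -> nat -> Prop) :
  (forall i, List.In i s -> \forall k \near \oo, \forall n \near \oo, Q i k n) ->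
  \forall k \near \oo, \forall n \near \oo, forall i, List.In i s -> Q i k n.
Proof.
elim: s => [|i s ih] h.
  by apply: nearW => k; apply: nearW.
have h1 := h i (or_introl erefl).
have h2 := ih (fun j js => h j (or_intror js)).
apply: filterS2 h1 h2 => k; apply: filterS2 => n Qi Qs j [<-//|]; exact: Qs.
Qed.

Section Bounds.
Variables (R : realType) (Z X : completePseudoMetricType R).
Hypotheses (sepZ : separable_space Z) (sepX : separable_space X).
Variables (z : nat -> nat -> Z) (mu : Pmeas R Z).
Hypothesis Hmu : forall f : Z -> R, bcont f ->
  (fun n : nat => ((n.+1)%:R)^-1 * \sum_(i < n.+1) f (z n.+1 i)) @ \oo --> Ex mu f.
Variables (P : nat -> Z -> Pmeas R X) (J : Z -> X -> \bar R).
Hypothesis Hfeller : forall k : nat, (0 < k)%N -> feller (P k).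
Hypothesis HLDP : forall z0 : Z, kLDP (fun k => P k z0) (J z0).
Variables (dO : measure_display) (Om : measurableType dO) (Pr : probability Om R).
Variable Xv : nat -> nat -> nat -> Om -> X.
Hypothesis Xmeas : forall k n i : nat, (0 < k)%N -> (0 < n)%N -> (i < n)%N ->
  measurable_fun setT (Xv k n i : Om -> borel X).
Hypothesis Xlaw : forall k n i : nat, (0 < k)%N -> (0 < n)%N -> (i < n)%N ->
  forall A : set X, measurable (A : set (borel X)) -> Pr (Xv k n i @^-1` A) = P k (z n i) A.
Hypothesis Xind : forall k n : nat, (0 < k)%N -> (0 < n)%N ->
  mutually_independent Pr (fun i : 'I_n => Xv k n i).

Let mX k n i : (i < n.+1)%N -> measurable_fun setT (Xv k.+1 n.+1 i : Om -> borel X).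
Proof. exact: Xmeas. Qed.

Definition emp_kn (k n : nat) (w : Om) : Pmeas R (Z * X)%type :=
  emp_of n (z n.+1) (Xv k.+1 n.+1) w.

Definition test_event (F : Z * X -> R) (c : R) (k n : nat) : set Om :=
  [set w | n.+1%:R * c < \sum_(i < n.+1) F (z n.+1 i, Xv k.+1 n.+1 i w)].

Lemma measurable_test_event (F : Z * X -> R) c k n : bcont (F : (Z * X)%type -> R) ->
  measurable (test_event F c k n).
Proof.
move=> bF; rewrite -[X in measurable X]setTI.
have m := measurable_avg (@mX k n) (fun i => bcont_bmeas (bcont_section (z n.+1 i) bF)).
have := m measurableT _ (measurable_itv `]n.+1%:R * c, +oo[).
by rewrite set_itvoy.
Qed.

(** Three errors of e / 3: the slicing in [chernoff], the convergence of the averages of the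
    continuous [H k] as n grows with k fixed, and the passage from [H k] to [L] under [mu] by
    reverse Fatou, which decides how large k must be. *)
Lemma test_upper F L (a e : R) : admissible P J F L -> 0 < e ->
  \forall k \near \oo, \forall n \near \oo,
    pr Pr (test_event F (a + Ex mu L) k n) <= expR (- (k.+1%:R * (n.+1%:R * (a - e)))).
Proof.
move=> adm e0; have [bF bL _ [H [C [HC cH EH HL]]]] := adm.
have e3 : 0 < e / 3 by rewrite divr_gt0.
have bH k : bcont (H k) by split=> //; exists C.
have hk := reverse_fatou mu (fun k => bcont_bmeas (bH k)) HC bL HL e3.
near=> k.
have hk' : Ex mu (H k) <= Ex mu L + e / 3 by near: k.
near=> n.
have hn : `|\sum_(i < n.+1) H k (z n.+1 i) - n.+1%:R * Ex mu (H k)| <= n.+1%:R * (e / 3).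
  by near: n; exact: (avg_near Hmu).
have bFs (i : 'I_n.+1) : bmeas (fun x => F (z n.+1 i, x)).
  exact/bcont_bmeas/bcont_section.
have := @chernoff R X dO Om Pr n.+1 (fun i => Xv k.+1 n.+1 i) (fun i => P k.+1 (z n.+1 i)) _ _ _
  (fun i x => F (z n.+1 i, x)) k.+1%:R (e / 3) (n.+1%:R * (a + Ex mu L)) bFs _ e3.
move=> /(_ _ _ _ _ (measurable_test_event _ _ _ bF)) h.
apply: (le_trans (h _ _ _ _)).
- by move=> i; exact: mX.
- by move=> i A mA; exact: Xlaw.
- exact: Xind.
- by rewrite ltr0n.
apply: (@le_trans _ _ (expR (- (k.+1%:R * (n.+1%:R * (a + Ex mu L) - n.+1%:R * (e / 3)))) *
    \prod_(i < n.+1) expR (k.+1%:R * H k (z n.+1 i)))).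
  rewrite ler_wpM2l ?expR_ge0//; apply: ler_prod => i _; rewrite EH andbT.
  by apply: Ex_ge0 => x; exact: expR_ge0.
rewrite -expR_sum -expRD ler_expR -mulr_sumr -mulrN -mulrDr -[leRHS]mulrN ler_pM2l ?ltr0n//.
have h1 : \sum_(i < n.+1) H k (z n.+1 i) <= n.+1%:R * Ex mu (H k) + n.+1%:R * (e / 3).
  by rewrite -lerBlDl (le_trans (ler_norm _)).
have h2 : n.+1%:R * Ex mu (H k) <= n.+1%:R * (Ex mu L + e / 3) by rewrite ler_pM2l ?ltr0n.
move: h1 h2; rewrite !mulrBr !mulrDr.
have -> : n.+1%:R * e = n.+1%:R * (e / 3) + n.+1%:R * (e / 3) + n.+1%:R * (e / 3) by field.
move: (n.+1%:R * (e / 3)) (n.+1%:R * a) (n.+1%:R * Ex mu L) (n.+1%:R * Ex mu (H k)) => x y u v.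
move: (\sum_(_ < _) _) => S; lra.
Unshelve. all: by end_near. Qed.

Lemma upper_near (B : set (Pmeas R (Z * X)%type)) (a e : R) : narrow_measurable B ->
  (forall q, narrow_closure B q -> (a%:E < rate_i mu J q)%E) -> 0 < e ->
  \forall k \near \oo, \forall n \near \oo,
    pr Pr [set w | B (emp_kn k n w)] <= expR (((k.+1 * n.+1)%N)%:R * (- a + e)).
Proof.
move=> mB ha e0; have e2 : 0 < e / 2 by rewrite divr_gt0.
have [s [hs Bs]] := test_cover sepZ sepX Hfeller HLDP ha.
have h := near_list (fun FL hFL => @test_upper FL.1 FL.2 a (e / 2) (hs FL hFL) e2).
near=> k.
have hk : \forall n \near \oo, forall FL, List.In FL s ->
    pr Pr (test_event FL.1 (a + Ex mu FL.2) k n) <= expR (- (k.+1%:R * (n.+1%:R * (a - e / 2)))).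
  by near: k.
near=> n.
have hn : forall FL, List.In FL s ->
    pr Pr (test_event FL.1 (a + Ex mu FL.2) k n) <= expR (- (k.+1%:R * (n.+1%:R * (a - e / 2)))).
  by near: n.
have mtest FL : List.In FL s -> measurable (test_event FL.1 (a + Ex mu FL.2) k n).
  by move=> /hs[bF _ _ _]; exact: measurable_test_event.
have mK := emp_preimage sepX (z n.+1) (@mX k n) mB.
apply: (le_trans (pr_cover Pr mK mtest _)).
  move=> w /= /Bs[FL hFL lt]; exists FL => //.
  have [bF _ _ _] := hs _ hFL.
  move: lt; rewrite Ex_emp; last exact: bcont_bmeas.
  by rewrite /test_event /= -ltr_pdivlMl.
apply: (@le_trans _ _ (\sum_(FL <- s) expR (- (k.+1%:R * (n.+1%:R * (a - e / 2)))))).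
  elim: (s) hn => [|FL t ih] hn; first by rewrite !big_nil.
  rewrite !big_cons lerD//; first by apply: hn; left.
  by apply: ih => FL' hFL'; apply: hn; right.
rewrite big_const_seq count_predT iter_addr addr0 -[leLHS]mulr_natl.
set D : R := k.+1%:R * n.+1%:R.
have -> : - (k.+1%:R * (n.+1%:R * (a - e / 2))) = D * (- a + e / 2) by rewrite /D; ring.
have -> : ((k.+1 * n.+1)%N)%:R * (- a + e) = D * (e / 2) + D * (- a + e / 2).
  by rewrite natrM -/D; field.
rewrite expRD ler_wpM2r ?expR_ge0//.
(* The number of tests is fixed, so for large n it is below D e / 2, hence below exp(D e / 2). *)
apply: (@le_trans _ _ (D * (e / 2))); last first.
  by rewrite (le_trans _ (expR_ge1Dx _))// lerDr.
rewrite -ler_pdivrMr// (@le_trans _ _ n.+1%:R)//.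
  rewrite (@le_trans _ _ n%:R)// ?ler_nat//; near: n; exact: nbhs_infty_ger.
by rewrite /D ler_peMl// ler1n.
Unshelve. all: by end_near. Qed.

(** Unassigned indices and those whose cost reaches the cap are left free: their factor is 1, at
    least exp(- k cost). For the others the mean of [h l] is at most the probability of h l > 0,
    because h l <= 1. *)
Lemma pr_assignment (k n N : nat) (rho : nat -> option 'I_N) (h : nat -> X -> R) (L : R) :
  (forall l, bcont (h l)) -> (forall l x, 0 <= h l x <= 1) -> 0 <= L ->
  let cost i := if rho i is Some l then capped_cost P (h l) L k (z n.+1 i) else 0 in
  exists E, [/\ measurable E, expR (- (k.+1%:R * \sum_(i < n.+1) cost i)) <= pr Pr E &
    forall w i l, E w -> (i < n.+1)%N -> rho i = Some l -> cost i < L ->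
      0 < h l (Xv k.+1 n.+1 i w)].
Proof.
move=> bh h01 L0 cost.
pose A i : set X := if rho i is Some l then
  (if cost i < L then [set x | 0 < h l x] else setT) else setT.
have mA i : measurable (A i : set (borel X)).
  have mT : measurable (setT : set (borel X)) by exact: measurableT.
  rewrite /A; case: (rho i) => [l|//]; case: ifP => // _.
  apply: sub_sigma_algebra; apply: (@open_comp _ _ (h l) [set y : R | 0 < y]); last exact: open_gt.
  by move=> y _; exact: (bh l).1.
have [mE prE] := pr_independent (fun i : 'I_n.+1 => @mX k n i (ltn_ord i))
  (fun i : 'I_n.+1 => Xlaw (ltn0Sn k) (ltn0Sn n) (ltn_ord i)) (Xind (ltn0Sn k) (ltn0Sn n))
  (fun i : 'I_n.+1 => mA i).
eexists; split; [exact: mE| |].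
  rewrite prE mulr_sumr -sumrN expR_sum; apply: ler_prod => i _; rewrite expR_ge0/=.
  have c1 : 0 <= cost i.
    by rewrite /cost; case: (rho i) => [l|//]; have /andP[] := capped_cost_bnd P (bh l) (h01 l) L0 k (z n.+1 i).
  have triv : expR (- (k.+1%:R * cost i)) <= fine (P k.+1 (z n.+1 i) setT).
    rewrite (_ : fine _ = 1); last exact: (congr1 fine (probability_setT (P k.+1 (z n.+1 i)))).
    by rewrite -[leRHS]expR0 ler_expR lerNl oppr0 mulr_ge0.
  have := mA i; rewrite /A; move: triv; rewrite /cost; case: (rho i) => [l|//] triv.
  case: ifP => [lt mAi|_ _]; last exact: triv.
  rewrite (capped_cost_lt lt) -Ex_indic//.
  apply: Ex_le; [exact: bcont_bmeas|exact: bmeas_indic|] => x; rewrite indicE.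
  have /andP[h0 h1] := h01 l x; case: (boolP (x \in _)) => [//|].
  by rewrite notin_setE /= => /negP; rewrite -leNgt.
move=> w i l Ew lin rl lt; have := Ew (Ordinal lin) I.
by rewrite /= /A rl; move: lt; rewrite /cost rl => ->.
Qed.

(** The weights trade the [mu]-integral for [q]-integrals over the pieces, at a price L d each. On
    piece l the point x lies in [U l], so the upper limit of the cost is at most J z x, and reverse
    Fatou applies under [q]. *)
Lemma expected_cost_near (q : Pmeas R (Z * X)%type) (j L d e : R) (N : nat) (V : nat -> set (Z * X))
    (U : nat -> set X) (h : nat -> X -> R) (w : nat -> Z -> R) :
  (\int[q]_p J p.1 p.2 <= j%:E)%E -> 0 <= L -> 0 < e ->
  (forall l, measurable (V l : set (borel (Z * X)%type))) ->
  (forall l l' p, V l p -> V l' p -> l = l') -> (forall l p, V l p -> U l p.2) ->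
  (forall l, open (U l)) -> (forall l x, U l x -> h l x = 1) ->
  (forall l, bcont (h l)) -> (forall l x, 0 <= h l x <= 1) -> (forall l, bcont (w l)) ->
  (forall l (C : R) g, (l < N)%N -> bmeas g -> (forall z, `|g z| <= C) ->
      `|Ex mu (fun z => w l z * g z) - Ex q (fun x => \1_(V l) x * g x.1)| <= C * d) ->
  \forall k \near \oo, Ex mu (fun x => \sum_(l < N) w l x * capped_cost P (h l) L k x) <=
    j + e + N%:R * (L * d).
Proof.
move=> Jq L0 e0 mV dV VU oU hU bh h01 bw hw.
have bphi l k := capped_cost_bcont Hfeller (bh l) (h01 l) L0 k.
have phiL l k x : 0 <= capped_cost P (h l) L k x <= L := capped_cost_bnd P (bh l) (h01 l) L0 k x.
have phiL' l k x : `|capped_cost P (h l) L k x| <= L.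
  by have /andP[h0 h1] := phiL l k x; rewrite ger0_norm.
have bphi' l k := bcont_bmeas (bphi l k).
have bphi2 l k := bmeas_comp (@cfst R Z X) (bphi' l k).
have bV l := bmeas_indic R (mV l).
pose F k (p : Z * X) : R := \sum_(l < N) \1_(V l) p * capped_cost P (h l) L k p.1.
pose Phi l x : R := rlimsup (fun k => capped_cost P (h l) L k x).
pose G (p : Z * X) : R := \sum_(l < N) \1_(V l) p * Phi l p.1.
have bPhi l : bmeas (Phi l) by exact: (bmeas_rlimsup (M := L)).
have bF k : bmeas (F k : (Z * X)%type -> R) by apply: bmeas_sum => l; exact: bmeasM.
have bG : bmeas (G : (Z * X)%type -> R).
  by apply: bmeas_sum => l; apply: bmeasM => //; exact: (bmeas_comp (@cfst R Z X) (bPhi l)).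
have V01 l p : 0 <= (\1_(V l) p : R) by rewrite indicE.
have FL k (p : (Z * X)%type) : `|F k p| <= L.
  rewrite ger0_norm; last first.
    by apply: sumr_ge0 => l _; rewrite mulr_ge0//; have /andP[] := phiL l k p.1.
  apply: (@le_trans _ _ (\sum_(l < N) \1_(V l) p * L)).
    by apply: ler_sum => l _; rewrite ler_wpM2l//; have /andP[] := phiL l k p.1.
  by rewrite -mulr_suml ler_piMl//; apply: sum_indic_le1 => l l'; exact: dV.
have FG (p : (Z * X)%type) (e' : R) : 0 < e' -> \forall k \near \oo, F k p <= G p + e'.
  move=> e'0; have [[l Vl]|nV] := pselect (exists l : 'I_N, V l p).
    have dVp l1 l2 := dV l1 l2 p.
    have := @rlimsup_near _ (fun k => capped_cost P (h l) L k p.1) L e' (fun k => phiL' l k p.1) e'0.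
    apply: filterS => k; rewrite /F /G.
    by rewrite (sum_indic_in (fun l => capped_cost P (h l) L k p.1) dVp Vl) (sum_indic_in (Phi ^~ p.1) dVp Vl).
  apply: nearW => k; rewrite /F /G.
  rewrite (sum_indic_out (fun l => capped_cost P (h l) L k p.1) nV) (sum_indic_out (Phi ^~ p.1) nV).
  by rewrite add0r ltW.
have GJ : Ex q (G : (Z * X)%type -> R) <= j.
  rewrite -lee_fin (le_trans _ Jq)//.
  apply: (le_Ex_rate sepX mu Hfeller HLDP) => // -[x y] /=.
  have [[l Vl]|nV] := pselect (exists l : 'I_N, V l (x, y)).
    rewrite /G (sum_indic_in (Phi ^~ x) (fun l l' => dV l l' (x, y)) Vl).
    exact: (capped_cost_le HLDP (bh l) (h01 l) L0 x (oU l) (hU l) (VU _ _ Vl)).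
  rewrite /G (sum_indic_out (Phi ^~ x) nV).
  by have [[+ _] _] := HLDP x; apply.
have hk := reverse_fatou q bF FL bG FG e0.
apply: filterS hk => k hk.
have bwphi l : bmeas (fun x => w l x * capped_cost P (h l) L k x).
  by apply: bmeasM => //; exact: bcont_bmeas.
rewrite Ex_sum//.
apply: (@le_trans _ _ (\sum_(l < N) (Ex q (fun p => \1_(V l) p * capped_cost P (h l) L k p.1) + L * d))).
  apply: ler_sum => l _; have := hw l L _ (ltn_ord l) (bphi' l k) (phiL' l k).
  by rewrite ler_norml => /andP[_]; rewrite lerBlDl.
rewrite big_split/= sumr_const card_ord -[_ *+ N]mulr_natl lerD2r.
rewrite -Ex_sum; last by move=> l; exact: bmeasM.
by rewrite (le_trans hk)// lerD2r.
Qed.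

Lemma lower_near (B : set (Pmeas R (Z * X)%type)) (q : Pmeas R (Z * X)%type) (j e : R) :
  narrow_measurable B -> narrow_interior B q -> (rate_i mu J q <= j%:E)%E -> 0 < e ->
  \forall k \near \oo, \forall n \near \oo,
    expR (((k.+1 * n.+1)%N)%:R * (- (j + e))) <= pr Pr [set w | B (emp_kn k n w)].
Proof.
move=> mB [W [oW [Wq WB]]]; rewrite /rate_i; case: asboolP => // qmu Jq e0.
have j0 : 0 <= j.
  rewrite -lee_fin (le_trans _ Jq)//; apply: integral_ge0 => p _.
  by have [[+ _] _] := HLDP p.1; apply.
have [m [f [e1 [e10 [bf sW]]]]] := oW _ Wq.
have [M [M1 fM]] : exists M : R, 1 <= M /\ forall a p, `|f a p| <= M.
  have [M hM] := choice (fun a => (bf a).2).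
  exists (1 + \sum_a `|M a|); split; first by rewrite lerDl sumr_ge0.
  move=> a p; rewrite (le_trans (hM a p))// (le_trans (ler_norm _))// (bigD1 a)//= addrCA lerDl.
  by rewrite addr_ge0// sumr_ge0.
have M0 : 0 < M by exact: lt_le_trans M1.
have je : 0 < j + e by exact: ltr_wpDl.
(* The final error is 2 (r + M r) + 2 M (j + e) / L + 2 M N d. Here r <= M r = e1 / 16, and [L], [d]
   are chosen so that the last two terms are at most e1 / 4 each; the total is at most 3 e1 / 4. *)
pose r := e1 / (16 * M); have r0 : 0 < r by rewrite divr_gt0// mulr_gt0.
have [N [eta [h [U [V [c]]]]]] := rectangle_cover sepZ sepX q bf fM (ltW M0) r0.
move=> [[beta eta01 bh h01] [oU hU mV dV VEU] osc cM cover].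
pose L := 8 * M * (j + e) / e1; have L0 : 0 < L by rewrite divr_gt0// !mulr_gt0.
pose d := e1 / (8 * M * N.+1%:R); have d0 : 0 < d by rewrite divr_gt0// !mulr_gt0.
pose d2 := Num.min (d / 2) (e / 2).
have d20 : 0 < d2 by rewrite lt_min (divr_gt0 d0)// (divr_gt0 e0).
(* Of the counting error [d], half goes to the weights and half, through [d2], to the assignment;
   the second bound keeps the cost error N L d1 below e / 4. *)
pose d1 := Num.min (d / 2) (e / (4 * N.+1%:R * L)).
have NL0 : 0 < 4 * N.+1%:R * L by rewrite (mulr_gt0 _ L0)// mulr_gt0.
have d10 : 0 < d1 by rewrite lt_min (divr_gt0 d0)//= (divr_gt0 e0 NL0).
have [w [bw w0 weta w1 hw]] := continuous_weights (@cfst R Z X) qmu N mV dV beta eta01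
  (fun l p Vp => (VEU l p Vp).1) d10.
have e4 : 0 < e / 4 by rewrite divr_gt0.
have NLd : N%:R * (L * d1) <= e / 4.
  have h1 : L * d1 <= L * (e / (4 * N.+1%:R * L)).
    by rewrite ler_pM2l// ge_min lexx orbT.
  have h2 : L * (e / (4 * N.+1%:R * L)) = e / 4 / N.+1%:R.
    by field; rewrite (gt_eqF L0) nat1r pnatr_eq0.
  have h3 : N%:R * (e / 4 / N.+1%:R) <= e / 4.
    by rewrite mulrA ler_pdivrMr// mulrC ler_pM2l// ler_nat.
  by rewrite (le_trans _ h3)// -h2 ler_wpM2l.
have Nd : 2 * M * (N%:R * d) <= e1 / 4.
  have -> : 2 * M * (N%:R * d) = N%:R * (e1 / 4 / N.+1%:R).
    by rewrite /d; field; rewrite (gt_eqF M0) nat1r pnatr_eq0.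
  by rewrite mulrA ler_pdivrMr// mulrC ler_pM2l ?divr_gt0// ler_nat.
have hk := expected_cost_near Jq (ltW L0) e4 mV dV (fun l p Vp => (VEU l p Vp).2) oU hU bh h01 bw hw.
apply: filterS hk => k hk.
have bphi l := capped_cost_bcont Hfeller (bh l) (h01 l) (ltW L0) k.
have phiL l x := capped_cost_bnd P (bh l) (h01 l) (ltW L0) k x.
apply: filterS (assignment_near Hmu bw w0 w1 bphi phiL d20) => n [rho [rho_w rho_n rho_c]].
pose cost (i : nat) : R := if rho i is Some l then capped_cost P (h l) L k (z n.+1 i) else 0.
have [E [mE prE hE]] := pr_assignment k n rho bh h01 (ltW L0).
(* Of the slack [e], half comes from the expected cost and half from the assignment. *)
have costE : \sum_(i < n.+1) cost i <= n.+1%:R * (j + e).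
  have h1 : \sum_(i < n.+1) cost i <= n.+1%:R * (j + e / 4 + e / 4) + n.+1%:R * (e / 2).
    move: rho_c; rewrite ler_norml => /andP[_]; rewrite lerBlDl => /le_trans; apply.
    rewrite lerD// ler_wpM2l//; last by rewrite ge_min lexx orbT.
    by rewrite (le_trans hk)// lerD2l.
  by rewrite (le_trans h1)// -mulrDr ler_wpM2l//; lra.
have mK := emp_preimage sepX (z n.+1) (@mX k n) mB.
apply: (@le_trans _ _ (pr Pr E)).
  rewrite (le_trans _ prE)// ler_expR natrM -mulrA mulrN mulrN lerN2 ler_wpM2l//; exact: costE.
apply: pr_le => // om Eom; apply: WB; apply: sW => a /=.
rewrite narrow_distE// Ex_emp; last exact: bcont_bmeas.
pose y (i : nat) : R := f a (z n.+1 i, Xv k.+1 n.+1 i om).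
pose ql (l : nat) : R := Ex q (\1_(V l) : (Z * X)%type -> R).
have approx : `|\sum_(i < n.+1) y i - n.+1%:R * \sum_(l < N) c l a * ql l| <=
    n.+1%:R * (r + 2 * M * ((j + e) / L) + M * (r + N%:R * d) + M * (N%:R * d)).
  (* The Markov weight is cost / L: it is at least 1 at the cap, and its average is at most (j + e)
     / L by [costE]. *)
  apply: (@assignment_average _ N n.+1 rho y (fun i => cost i / L) (fun l => c l a) ql).
  - by move=> i; exact: fM.
  - by move=> l; exact: cM.
  - exact: ltW.
  - move=> i; rewrite divr_ge0 ?(ltW L0)// /cost; case: (rho i) => [l|//].
    by have /andP[] := phiL l (z n.+1 i).
  - move=> i l lin rl; have [costL|costL] := leP L (cost i).
      by left; rewrite ler_pdivlMr// mul1r.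
    right; apply: osc; last exact: hE Eom lin rl costL.
    by apply: weta; rewrite gt_eqF//; exact: rho_w lin rl.
  - move=> l; have := rho_n l; have := hw l 1 (fun=> 1) (ltn_ord l) (bmeas_cst _ _).
    have -> : (fun z0 => w l z0 * 1) = w l by apply/funext => x; rewrite mulr1.
    have -> : (fun x : Z * X => \1_(V l) x * 1 : R) = \1_(V l) by apply/funext => x; rewrite mulr1.
    rewrite normr1 mul1r -/(ql l) => /(_ (fun=> lexx 1)) hq hn.
    have hq2 : `|n.+1%:R * Ex mu (w l) - n.+1%:R * ql l| <= n.+1%:R * (d / 2).
      rewrite -mulrBr normrM ger0_norm// ler_wpM2l// (le_trans hq)//.
      by rewrite ge_min lexx.
    rewrite (le_trans (ler_distD (n.+1%:R * Ex mu (w l)) _ _))//.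
    rewrite [leRHS](_ : _ = n.+1%:R * (d / 2) + n.+1%:R * (d / 2)); last by field.
    by rewrite lerD// (le_trans hn)// ler_wpM2l// ge_min lexx.
  - exact: cover.
  - by rewrite -mulr_suml mulrA ler_pM2r// invr_gt0.
have simple : `|Ex q (f a : (Z * X)%type -> R) - \sum_(l < N) c l a * ql l| <= r + M * r.
  apply: (@Ex_simple_approx _ _ q (f a) N V (fun l => c l a)) => //; [exact: bcont_bmeas|exact: ltW|].
  move=> l [x u] Vl; have [etaE Ul] := VEU _ _ Vl; apply: osc.
    by rewrite etaE.
  by rewrite hU.
have n0 : 0 < n.+1%:R :> R by [].
have approx' : `|n.+1%:R^-1 * (\sum_(i < n.+1) y i) - \sum_(l < N) c l a * ql l| <=
    r + 2 * M * ((j + e) / L) + M * (r + N%:R * d) + M * (N%:R * d).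
  rewrite -(ler_pM2l n0) (le_trans _ approx)// -[X in X * _ <= _](gtr0_norm n0) -normrM mulrBr.
  by rewrite mulrA divff ?mul1r// gt_eqF.
have LE : 2 * M * ((j + e) / L) = e1 / 4.
  by rewrite /L; field; rewrite (gt_eqF M0) (gt_eqF je) (gt_eqF e10).
have rE : r <= M * r by rewrite ler_peMl// ltW.
have MrE : M * r = e1 / 16 by rewrite /r; field; rewrite gt_eqF.
have := ler_distD (\sum_(l < N) c l a * ql l) (n.+1%:R^-1 * (\sum_(i < n.+1) y i)) (Ex q (f a : (Z * X)%type -> R)).
rewrite [X in _ <= _ + X]distrC => /le_lt_trans; apply.
apply: (le_lt_trans (lerD approx' simple)); rewrite LE mulrDr.
rewrite -mulrA in Nd; move: rE Nd; rewrite MrE; move: (M * (N%:R * d)) => u; lra.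
Qed.

End Bounds.

Lemma lee_dense (R : realType) (m y : \bar R) :
  (forall a : R, (a%:E < m)%E -> (a%:E <= y)%E) -> (m <= y)%E.
Proof.
move=> h; case: m h => [m| |] h; last exact: leNye.
  case: y h => [y| |] h; [|exact: leey|].
    rewrite lee_fin; apply/ler_addgt0Pr => e e0; rewrite -lerBlDr -lee_fin; apply: h.
    by rewrite lte_fin ltrBlDr ltrDl.
  have := h (m - 1); rewrite lte_fin ltrBlDr ltrDl ltr01 => /(_ isT).
  by rewrite leeNy_eq.
case: y h => [y| |] h //.
  by have := h (y + 1) (ltry _); rewrite lee_fin -subr_ge0 opprD addNKr oppr_ge0 ler10.
by have := h 0 (ltry _); rewrite leeNy_eq.
Qed.

Theorem mainTheorem9 (R : realType) (Z X : completePseudoMetricType R)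
  (polZ : polish Z) (polX : polish X)
  (* triangular array z_{n,i}, i < n, and the limit mu *)
  (z : nat -> nat -> Z) (mu : Pmeas R Z)
  (Hmu : forall f : Z -> R, bcont f ->
     (fun n : nat => ((n.+1)%:R)^-1 * \sum_(i < n.+1) f (z n.+1 i))
       @ \oo --> fine (pint mu f))
  (* P k z = P^k_z *)
  (P : nat -> Z -> Pmeas R X)
  (Hfeller : forall k : nat, (0 < k)%N -> feller (P k))
  (J : Z -> X -> \bar R)
  (HLDP : forall z0 : Z, kLDP (fun k => P k z0) (J z0))
  (* the random variables X^k_{n,i} (k,n >= 1, i < n) on a probability space *)
  (dO : measure_display) (Om : measurableType dO) (Pr : probability Om R)
  (Xv : nat -> nat -> nat -> Om -> X)
  (Xmeas : forall k n i : nat, (0 < k)%N -> (0 < n)%N -> (i < n)%N ->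
     measurable_fun setT (Xv k n i : Om -> borel X))
  (Xlaw : forall k n i : nat, (0 < k)%N -> (0 < n)%N -> (i < n)%N ->
     forall A : set X, measurable (A : set (borel X)) ->
       Pr (Xv k n i @^-1` A) = P k (z n i) A)
  (Xind : forall k n : nat, (0 < k)%N -> (0 < n)%N ->
     mutually_independent Pr (fun i : 'I_n => Xv k n i)) :
  let K_in (k n : nat) (B : set (Pmeas R (Z * X)%type)) : set Om :=
    [set w | exists q, B q /\
       is_empirical (fun i : 'I_n => (z n i, Xv k n i w)) q] in
  narrow_good_rate (rate_i mu J) /\
  forall B : set (Pmeas R (Z * X)%type), narrow_measurable B ->
    let a := fun k n : nat =>
      (((((k.+1 * n.+1)%N)%:R)^-1)%:E * elog (Pr (K_in k.+1 n.+1 B)))%E in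
    ((- ereal_inf (rate_i mu J @` narrow_interior B)
        <= limn_einf (fun k => limn_einf (fun n => a k n))) /\
     (limn_einf (fun k => limn_einf (fun n => a k n))
        <= limn_esup (fun k => limn_esup (fun n => a k n))) /\
     (limn_esup (fun k => limn_esup (fun n => a k n))
        <= - ereal_inf (rate_i mu J @` narrow_closure B)))%E.
Proof.
move=> K_in; have sZ := polZ.2; have sX := polX.2.
split; first exact: (rate_good sZ sX mu Hfeller HLDP).
move=> B mB a.
have mX k n i : (i < n.+1)%N -> measurable_fun setT (Xv k.+1 n.+1 i : Om -> borel X).
  exact: Xmeas.
have aE k n : a k n = ((((k.+1 * n.+1)%N)%:R^-1)%:E *
    elog (Pr [set w | B (emp_kn z Xv k n w)]))%E.
  by rewrite /a /K_in (emp_preimageE _ _ _ mB).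
have mK k n : measurable [set w | B (emp_kn z Xv k n w)].
  exact: (emp_preimage sX (z n.+1) (@mX k n) mB).
have p0 k n : (0 <= Pr [set w | B (emp_kn z Xv k n w)])%E by exact: measure_ge0.
have p1 k n : (Pr [set w | B (emp_kn z Xv k n w)] <= 1)%E by exact: probability_le1.
split; [|split].
- rewrite leeNl; apply: le_ereal_inf_tmp => _ [q Bq <-].
  have r0 : (0 <= rate_i mu J q)%E by have [/(_ q)] := rate_good sZ sX mu Hfeller HLDP.
  case rE : (rate_i mu J q) r0 => [j| |]// _; last exact: leey.
  rewrite leeNl -EFinN; apply: lee_dense => b; rewrite lte_fin => bj.
  have rj : (rate_i mu J q <= j%:E)%E by rewrite rE.
  (* The gap between [b] and - j is the error given away in [lower_near]. *)
  have e0 : 0 < - b - j by lra.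
  have := lower_near sZ sX Hmu Hfeller HLDP Xmeas Xlaw Xind mB Bq rj e0.
  move=> h; apply: einf_ge; apply: filterS h => k h; apply: einf_ge.
  apply: filterS h => n h; rewrite aE; apply: elog_ge => //.
  by rewrite (_ : b = - (j + (- b - j)))//; ring.
(* The comparison passes through the mixed limit: lower in k, upper in n. *)
- apply: (@le_trans _ _ (limn_einf (fun k => limn_esup (fun n => a k n)))); last exact: limn_einf_sup.
  rewrite /limn_einf leeN2; apply: le_esup; apply: nearW => k.
  by rewrite leeN2; exact: limn_einf_sup.
(* A real level strictly below the infimum over the closure gives the strict inequality that
   [test_cover] needs, also when the infimum is infinite. *)
- rewrite leeNr; apply: lee_dense => b hb.
  rewrite leeNr -EFinN; apply/lee_addgt0Pr => e e0; rewrite -EFinD.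
  have hB q : narrow_closure B q -> (b%:E < rate_i mu J q)%E.
    by move=> Bq; apply: (lt_le_trans hb); apply: ereal_inf_lbound; exists q.
  have := upper_near sZ sX Hmu Hfeller HLDP Xmeas Xlaw Xind mB hB e0.
  move=> h; apply: esup_le; apply: filterS h => k h; apply: esup_le.
  apply: filterS h => n h; rewrite aE; exact: elog_le.
Qed.
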